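(* Let $M$ be a smooth manifold equipped with a Nirenberg integrable complex distribution $P\subset TM_{\mathbb C}$, and let $Q=TM_{\mathbb C}/P$. Let $(E,d_P^E)$ and $(E',d_P^{E'})$ be any locally free $P$-modules, and let $\mathrm{pbw}^{E,E'}$ be the Poincaré--Birkhoff--Witt map constructed from a choice of a splitting $TM_{\mathbb C}=P\oplus Q$, a torsion-free connection $\nabla^Q$ on $Q$, and a connection $\nabla^E$ on $E$ extending $d_P^E$. Then $$\mathrm{pbw}^{E,E'}:\Gamma(-,\mathrm{Sym}\,Q\otimes E^*\otimes E')\to\Gamma(-,\widetilde D(E,E'))$$ is an isomorphism of filtered $\mathcal C_M^\infty$-modules.
   Context: Functions are complex valued, $\mathbb N=\{0,1,\dots\}$. $P$ is Nirenberg integrable: a complex subbundle of $TM_{\mathbb C}$ such that $P\cap\overline P$ has constant rank and $P$, $P+\overline P$ are involutive. $\pi:TM_{\mathbb C}\to Q$ is the projection. $\mathcal O(U)=\{f\in\mathcal C^\infty(U):\mathcal L_Yf=0\ \forall Y\in\Gamma(U,P)\}$. A $P$-module $(E,d_P^E)$ is a complex vector bundle with a flat $P$-connection $d_P^E:\Gamma(M,E)\to\Gamma(M,P^*\otimes E)$; it is locally free if its sheaf of $d_P^E$-closed sections is a locally free $\mathcal O$-module, in the sense that $E$ admits local frames of $d_P^E$-closed sections. $\underline{\mathbb C}$ is the trivial line bundle with $d$. $J^rE$ is the $r$-jet bundle; $D^r(E,E')=\mathrm{Hom}(J^rE,E')$, whose sections are identified with differential operators of order $\le r$ from $E$ to $E'$;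 $\circ$ is composition. $\widetilde J^0E=E$; for $r\ge1$, $\widetilde J^rE\subset J^rE$ is the subbundle whose sections over $U$ are the $\sigma\in\Gamma(U,J^rE)$ with $\langle\Phi\circ\iota_Y\circ d_P^E,\sigma\rangle=0$ for all $Y\in\Gamma(U,P)$, $\Phi\in\Gamma(U,D^{r-1}(E,\underline{\mathbb C}))$. $\widetilde D^r(E,E')=\mathrm{Hom}(\widetilde J^rE,E')$ and $\widetilde D(E,E')=\varinjlim_r\widetilde D^r(E,E')$, filtered by the $\widetilde D^r(E,E')$. Restriction to $\widetilde J^rE$ gives a surjection $D^r(E,E')\to\widetilde D^r(E,E')$, and composition of operators descends to a composition $\Gamma(D^{r'}(E',E''))\times\Gamma(\widetilde D^r(E,E'))\to\Gamma(\widetilde D^{r+r'}(E,E''))$. A connection $\nabla^Q$ on $Q$ is torsion-free if $\nabla^Q_X\pi(X')-\nabla^Q_{X'}\pi(X)=\pi([X,X'])$ for all $X,X'\in\Gamma(M,TM_{\mathbb C})$. Using the splitting, $Q$ is regarded as a subbundle of $TM_{\mathbb C}$. Define a morphism of sheaves of $\mathcal C^\infty_M$-modules $\Gamma(-,\mathrm{Sym}\,Q)\to\Gamma(-,\widetilde D(E,E))$, $G\mapsto\nabla^E_G$, recursively by $\nabla^E_f=f\,\mathrm{Id}_E$ for functions $f$ and, for $r\ge1$ and sections $Z_1,\dots,Z_r$ of $Q$, $$\nabla^E_{Z_1\cdots Z_r}=\frac1r\sum_{i=1}^r\Big(\nabla^E_{Z_i}\circ\nabla^E_{Z_1\cdots\widehat{Z_i}\cdots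 Z_r}-\nabla^E_{\nabla^Q_{Z_i}(Z_1\cdots\widehat{Z_i}\cdots Z_r)}\Big),$$ where $\nabla^Q$ is extended to $\mathrm{Sym}\,Q$ as a derivation. The map $\mathrm{pbw}^{E,E'}$ is defined $\mathcal C^\infty_M$-linearly by $\mathrm{pbw}^{E,E'}(G\otimes A)=A\circ\nabla^E_G$ for $G$ a section of $\mathrm{Sym}^rQ$ and $A$ a section of $E^*\otimes E'$. The filtration on the source is by $\mathrm{Sym}^{\le r}Q\otimes E^*\otimes E'$. *)

(* Defs.v *)
From HB Require Import structures.
From mathcomp Require Import all_boot all_order all_algebra.
From mathcomp Require Import all_classical reals topology normedtype derive.
From mathcomp Require Import complex.
(* The notations of mpoly clash with those of the analysis library. *)
From mathcomp Require Import -(notations) mpoly.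

Set Implicit Arguments.
Unset Strict Implicit.
Unset Printing Implicit Defensive.

Import Order.TTheory GRing.Theory Num.Theory.
Import numFieldNormedType.Exports.

Local Open Scope classical_set_scope.
Local Open Scope complex_scope.
Local Open Scope ring_scope.

Section Euclidean.
Variables (R : realType) (n : nat).
Implicit Types (f : 'rV[R]_n -> R[i]) (D : set 'rV[R]_n).

Definition Re_of f (y : 'rV[R]_n) : R := complex.Re (f y).
Definition Im_of f (y : 'rV[R]_n) : R := complex.Im (f y).

Definition partial (i : 'I_n) f : 'rV[R]_n -> R[i] := fun y =>
  'D_(delta_mx 0 i) (Re_of f) y +i* 'D_(delta_mx 0 i) (Im_of f) y.

Definition mpartial (a : multinom n) f : 'rV[R]_n -> R[i] :=
  foldr (fun i g => iter (a i) (partial i) g) f (enum 'I_n).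

(* Only meant for open D. *)
Fixpoint class_C (k : nat) D f : Prop :=
  {in D, continuous (Re_of f)} /\ {in D, continuous (Im_of f)} /\
  if k is k'.+1 then
    forall i : 'I_n,
      (forall y, D y -> derivable (Re_of f) y (delta_mx 0 i) /\
                        derivable (Im_of f) y (delta_mx 0 i)) /\
      class_C k' D (partial i f)
  else True.

Definition smooth D f : Prop := forall k, class_C k D f.

End Euclidean.

(* A smooth manifold of dimension n; its atlas is indexed by the points: one
   chart (dom x, phi x), with inverse psi x, is fixed around every point x.
   Every smooth structure has such an atlas. *)
Record manifold (R : realType) (n : nat) := Manifold {
  mcarrier :> topologicalType;
  dom : mcarrier -> set mcarrier;
  phi : mcarrier -> mcarrier -> 'rV[R]_n;
  psi : mcarrier -> 'rV[R]_n -> mcarrier;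
  manifold_hausdorff : hausdorff_space mcarrier;
  manifold_second_countable : @second_countable mcarrier;
  dom_open : forall x, open (dom x);
  mem_dom : forall x, dom x x;
  phi_dom_open : forall x, open (phi x @` dom x);
  phiK : forall x y, dom x y -> psi x (phi x y) = y;
  phi_continuous : forall x, {in dom x, continuous (phi x)};
  psi_continuous : forall x, {in phi x @` dom x, continuous (psi x)};
  transition_smooth : forall x x' (i : 'I_n),
    smooth (phi x @` (dom x `&` dom x')) (fun y => (phi x' (psi x y) 0 i)%:C) }.

Section Bundles.
Variables (R : realType) (n : nat) (M : manifold R n).
Implicit Types (U V : set M) (f : M -> R[i]).

(* Sections over U, here and below, are total functions considered on U only. *)
Definition smooth_fun U f : Prop :=
  forall x, smooth (phi x @` (dom x `&` U)) (f \o psi x).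

(* A family of vector spaces with a notion of smooth section over open sets. *)
Record bundle := Bundle {
  fiber :> M -> vectType R[i];
  sm : set M -> (forall x, fiber x) -> Prop }.

Definition sect (F : bundle) := forall x, F x.

(* A complex vector bundle, given by local frames. *)
Record vbundle := VBundle {
  vfiber : M -> vectType R[i];
  rk : M -> nat;
  tdom : M -> set M;
  frame : forall x0 y, (rk x0).-tuple (vfiber y);
  tdom_open : forall x0, open (tdom x0);
  mem_tdom : forall x0, tdom x0 x0;
  frame_basis : forall x0 y, tdom x0 y -> basis_of fullv (frame x0 y);
  frame_smooth : forall x0 x1 (i : 'I_(rk x0)) (j : 'I_(rk x1)),
    smooth_fun (tdom x0 `&` tdom x1)
      (fun y => coord (frame x1 y) j (tnth (frame x0 y) i)) }.

Definition bundle_of_vbundle (E : vbundle) : bundle :=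
  @Bundle (vfiber E) (fun U s => forall x0 (j : 'I_(rk E x0)),
    smooth_fun (tdom E x0 `&` U) (fun y => coord (frame E x0 y) j (s y))).
Coercion bundle_of_vbundle : vbundle >-> bundle.

(* The trivial line bundle. *)
Definition trivial_line : bundle :=
  @Bundle (fun _ => R[i]^o : vectType R[i]) (fun U s => smooth_fun U s).

(* Sections over U of Hom(F, F'). *)
Definition smooth_hom (F F' : bundle) U (A : forall x, 'Hom(F x, F' x)) : Prop :=
  forall V (s : sect F), open V -> V `<=` U ->
    sm V s -> @sm F' V (fun x => A x (s x)).

Definition sub_bundle (F : bundle) (W : forall x, {vspace F x}) : bundle :=
  @Bundle (fun x => subvs_of (W x) : vectType R[i])
    (fun U s => sm U (fun x => vsval (s x))).

(* W is a smooth subbundle of F: it has local frames of smooth sections. *)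
Definition is_subbundle (F : bundle) (W : forall x, {vspace F x}) : Prop :=
  forall x0, exists U, [/\ open U, U x0 &
    exists (k : nat) (e : 'I_k -> sect F),
      (forall i, sm U (e i)) /\
      (forall y, U y -> basis_of (W y) [seq e i y | i <- enum 'I_k])].

(* The complexified tangent bundle: a tangent vector at x is written in the
   coordinates of the chart fixed around x. *)
Definition vec_act (x : M) (v : 'rV[R[i]]_n) f : R[i] :=
  \sum_(i < n) v 0 i * partial i (f \o psi x) (phi x x).

Definition coordfun (x0 : M) (i : 'I_n) : M -> R[i] :=
  fun y => (phi x0 y 0 i)%:C.

Definition TMC : bundle :=
  @Bundle (fun _ => 'rV[R[i]]_n : vectType R[i])
    (fun U X => forall x0 (i : 'I_n),
      smooth_fun (dom x0 `&` U) (fun y => vec_act y (X y) (coordfun x0 i))).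

Definition lie (X : sect TMC) f : M -> R[i] := fun y => vec_act y (X y) f.

Definition bracket (X Y : sect TMC) : sect TMC := fun x =>
  \row_(i < n) (lie X (lie Y (coordfun x i)) x - lie Y (lie X (coordfun x i)) x).

Definition involutive (W : forall x, {vspace TMC x}) : Prop :=
  forall U (X Y : sect TMC), open U -> sm U X -> sm U Y ->
    (forall x, U x -> X x \in W x) -> (forall x, U x -> Y x \in W x) ->
    forall x, U x -> bracket X Y x \in W x.

Definition conj_space (W : {vspace 'rV[R[i]]_n}) : {vspace 'rV[R[i]]_n} :=
  <<[seq map_mx (@conjc R) v | v <- vbasis W]>>%VS.

Definition nirenberg_integrable (P : forall x, {vspace TMC x}) : Prop :=
  [/\ is_subbundle P,
      exists d, forall x, \dim (P x :&: conj_space (P x)) = d,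
      involutive P &
      involutive (fun x => P x + conj_space (P x))%VS].

(* (Q, pi) is the quotient of TMC by P. *)
Definition is_quotient (P : forall x, {vspace TMC x}) (Q : vbundle)
    (pi : forall x, 'Hom(TMC x, Q x)) : Prop :=
  smooth_hom setT pi /\
  forall x, limg (pi x) = fullv /\ lker (pi x) = P x.

Definition is_splitting (Q : vbundle) (pi : forall x, 'Hom(TMC x, Q x))
    (j : forall x, 'Hom(Q x, TMC x)) : Prop :=
  smooth_hom setT j /\ forall x, (pi x \o j x)%VF = \1%VF.

(* F-connections on E, for a bundle F with an anchor to TMC. *)
Definition is_connection (F : bundle) (a : forall x, F x -> TMC x) (E : bundle)
    (D : sect E -> forall x, 'Hom(F x, E x)) : Prop :=
  [/\ (forall U s, open U -> sm U s -> smooth_hom U (D s)),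
      (forall U s t, open U -> sm U s -> sm U t ->
         (forall x, U x -> s x = t x) -> forall x, U x -> D s x = D t x),
      (forall U s t, open U -> sm U s -> sm U t ->
         forall x, U x -> D (fun y => s y + t y) x = D s x + D t x) &
      (forall U f s, open U -> smooth_fun U f -> sm U s ->
         forall x v, U x -> D (fun y => f y *: s y) x v =
           vec_act x (a x v) f *: s x + f x *: D s x v)].

Definition is_TMC_connection (E : bundle)
    (D : sect E -> forall x, 'Hom(TMC x, E x)) : Prop :=
  is_connection (F := TMC) (fun x v => v) D.

Definition torsion_free (Q : vbundle) (pi : forall x, 'Hom(TMC x, Q x))
    (D : sect Q -> forall x, 'Hom(TMC x, Q x)) : Prop :=
  forall X X' : sect TMC, sm setT X -> sm setT X' -> forall x,
    D (fun y => pi y (X' y)) x (X x) - D (fun y => pi y (X y)) x (X' x)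
    = pi x (bracket X X' x).

Section PModules.
Variable P : forall x, {vspace TMC x}.

Definition Pbundle : bundle := sub_bundle P.

Definition contract (E : bundle) (D : sect E -> forall x, 'Hom(Pbundle x, E x))
    (Y : sect Pbundle) : sect E -> sect E := fun s x => D s x (Y x).

Definition is_flat (E : bundle) (D : sect E -> forall x, 'Hom(Pbundle x, E x))
    : Prop :=
  forall U (X Y : sect Pbundle) (s : sect E),
    open U -> sm U X -> sm U Y -> sm U s -> forall x, U x ->
    contract D X (contract D Y s) x - contract D Y (contract D X s) x
    = D s x (vsproj (P x)
        (bracket (fun y => vsval (X y)) (fun y => vsval (Y y)) x)).

Definition is_Pmodule (E : vbundle)
    (D : sect E -> forall x, 'Hom(Pbundle x, E x)) : Prop :=
  is_connection (F := Pbundle) (fun x v => vsval v) D /\ is_flat D.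

Definition locally_free (E : vbundle)
    (D : sect E -> forall x, 'Hom(Pbundle x, E x)) : Prop :=
  forall x0, exists U, [/\ open U, U x0 &
    exists (k : nat) (e : 'I_k -> sect E),
      (forall i, sm U (e i) /\ (forall y, U y -> D (e i) y = 0)) /\
      (forall y, U y -> basis_of fullv [seq e i y | i <- enum 'I_k])].

Definition extends (E : bundle) (D : sect E -> forall x, 'Hom(Pbundle x, E x))
    (D' : sect E -> forall x, 'Hom(TMC x, E x)) : Prop :=
  forall U s, open U -> sm U s -> forall x (v : Pbundle x), U x ->
    D' s x (vsval v) = D s x v.

End PModules.

(* An r-jet at x is written as the family of its derivatives of order at most r,
   in the chart and the frame fixed around x. *)
Section Jets.
Variable E : vbundle.

Definition jet_fiber (r : nat) (x : M) : vectType R[i] :=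
  {ffun bmultinom n r.+1 -> E x}.

Definition jet (r : nat) (x : M) (s : sect E) : jet_fiber r x :=
  [ffun a : bmultinom n r.+1 =>
    \sum_(j < rk E x)
      mpartial (bmnm a) (fun y => coord (frame E x (psi x y)) j (s (psi x y)))
        (phi x x) *: tnth (frame E x x) j].

(* The smooth sections of J^r E are generated by the jets of sections of E. *)
Definition Jet (r : nat) : bundle :=
  @Bundle (jet_fiber r) (fun U sigma =>
    forall x, U x -> exists V, [/\ open V, V x, V `<=` U &
      exists (m : nat) (f : 'I_m -> M -> R[i]) (s : 'I_m -> sect E),
        (forall i, smooth_fun V (f i) /\ sm V (s i)) /\
        (forall y, V y -> sigma y = \sum_(i < m) f i y *: jet r y (s i))]).

(* The section A over U of D^r(E, F) = Hom(J^r E, F) is identified with the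
   differential operator T. *)
Definition is_operator_of (F : bundle) (r : nat) U
    (A : forall x, 'Hom(Jet r x, F x)) (T : sect E -> sect F) : Prop :=
  smooth_hom U A /\
  forall V s x, open V -> V `<=` U -> V x -> sm V s -> A x (jet r x s) = T s x.

Definition truncate (r N : nat) (x : M) (v : jet_fiber N x) : jet_fiber r x :=
  [ffun a : bmultinom n r.+1 =>
    oapp (fun b : bmultinom n N.+1 => v b) 0 (insub (bmnm a))].

End Jets.

(* The subspace with underlying set S, when there is one (see vspace_ofP). *)
Definition vspace_of (K : fieldType) (L : vectType K) (S : set L) : {vspace L} :=
  xget 0%VS [set W : {vspace L} | forall v, v \in W <-> S v].

Lemma vspace_ofP (K : fieldType) (L : vectType K) (S : set L) :
  S 0 -> (forall c u v, S u -> S v -> S (c *: u + v)) ->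
  forall v, v \in vspace_of S <-> S v.
Proof.
move=> S0 SZD; rewrite /vspace_of; case: xgetP => [W -> //|noW].
pose sub (W : {vspace L}) := forall v, v \in W -> S v.
pose p d := `[< exists2 W, sub W & \dim W = d >].
have p_ex : exists d, p d.
  exists 0%N; apply/asboolP; exists 0%VS; last exact: dimv0.
  by move=> v; rewrite memv0 => /eqP ->.
have p_le d : p d -> (d <= \dim {:L})%N.
  by move=> /asboolP [W _ <-]; rewrite dimvS ?subvf.
case: (ex_maxnP p_ex p_le) => d /asboolP [W subW dimW] max_d.
case: (noW W) => v; split; first exact: subW.
move=> Sv; case: (boolP (v \in W)) => // vW.
have : (\dim (W + <[v]>) <= d)%N.
  apply/max_d/asboolP; exists (W + <[v]>)%VS => // u.
  by move=> /memv_addP [w wW [_ /vlineP [c ->] ->]]; rewrite addrC; apply: SZD => //; apply: subW.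
rewrite -dimW => le_dim.
have /eqP eqW : W == (W + <[v]>)%VS by rewrite eqEdim addvSl.
by move: vW; rewrite eqW memvE addvSr.
Qed.

Section TildeD.
Variables (P : forall x, {vspace TMC x}) (E : vbundle).
Variable dE : sect E -> forall x, 'Hom(Pbundle P x, E x).

(* The jets at x killed by all the operators Phi o iota_Y o d_P^E of order at
   most r defined near x. *)
Definition tilde_cond (r : nat) (x : M) : set (Jet E r x) :=
  match r return set (Jet E r x) with
  | 0 => setT
  | r'.+1 => [set v | forall U (Y : sect (Pbundle P))
      (Phi : forall y, 'Hom(Jet E r' y, trivial_line y))
      (A : forall y, 'Hom(Jet E r'.+1 y, trivial_line y)),
      open U -> U x -> sm U Y -> smooth_hom U Phi ->
      is_operator_of (F := trivial_line) U A
        (fun s y => Phi y (jet r' y (contract dE Y s))) ->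
      A x v = 0]
  end.

Definition tilde_jet (r : nat) (x : M) : {vspace Jet E r x} :=
  vspace_of (@tilde_cond r x).

Lemma mem_tilde_jet (r : nat) (x : M) (v : Jet E r x) :
  v \in tilde_jet r x <-> tilde_cond v.
Proof.
apply: vspace_ofP; case: r {v} => [|r] //=.
  by move=> U Y Phi A *; rewrite linear0.
move=> c u v Su Sv U Y Phi A oU Ux sY sPhi opA.
have Au := Su U Y Phi A oU Ux sY sPhi opA; have Av := Sv U Y Phi A oU Ux sY sPhi opA.
by rewrite linearP /= Au Av scaler0 addr0.
Qed.

Definition tildeJ (r : nat) : bundle := sub_bundle (tilde_jet r).

Definition tilde_proj (r N : nat) (x : M) : 'Hom(tildeJ N x, tildeJ r x) :=
  linfun (fun v : tildeJ N x =>
    vsproj (tilde_jet r x) (truncate r (vsval v))).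

Definition tilde_restrict (F : bundle) (r : nat) (x : M)
    (A : 'Hom(Jet E r x, F x)) : 'Hom(tildeJ r x, F x) :=
  linfun (fun v : tildeJ r x => A (vsval v)).

Section Colimit.
Variable F : bundle.

(* Representatives of the elements of the fibre at x of the direct limit of the
   Hom(tildeJ r, F), and their equality in the limit. *)
Definition tildeD (x : M) := {r : nat & 'Hom(tildeJ r x, F x)}.

Definition tD (r : nat) (x : M) (A : 'Hom(tildeJ r x, F x)) : tildeD x :=
  existT (fun r => 'Hom(tildeJ r x, F x)) r A.

Definition tD_lift (N : nat) (x : M) (a : tildeD x) : 'Hom(tildeJ N x, F x) :=
  (projT2 a \o tilde_proj (projT1 a) N x)%VF.

Definition tD_eq (x : M) (a b : tildeD x) : Prop :=
  exists N, [/\ (projT1 a <= N)%N, (projT1 b <= N)%N & tD_lift N a = tD_lift N b].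

Definition tD_zero (x : M) : tildeD x := tD (r := 0) 0.

Definition tD_add (x : M) (a b : tildeD x) : tildeD x :=
  let N := maxn (projT1 a) (projT1 b) in tD (tD_lift N a + tD_lift N b).

Definition tD_scale (x : M) (c : R[i]) (a : tildeD x) : tildeD x :=
  tD (c *: projT2 a).

Definition tD_order_le (r : nat) U (a : forall x, tildeD x) : Prop :=
  exists A : forall x, 'Hom(tildeJ r x, F x),
    smooth_hom U A /\ forall x, U x -> tD_eq (a x) (tD (A x)).

Definition tD_smooth U (a : forall x, tildeD x) : Prop :=
  forall x, U x -> exists V r, [/\ open V, V x, V `<=` U & tD_order_le r V a].

(* a is the class over U of the differential operator T. *)
Definition is_class_of U (T : sect E -> sect F) (a : forall x, tildeD x) : Prop :=
  exists (r : nat) (A : forall x, 'Hom(Jet E r x, F x)),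
    is_operator_of U A T /\
    forall x, U x -> tD_eq (a x) (tD (tilde_restrict (A x))).

End Colimit.

(* c is the class over U of the composition B o a, for a differential operator
   B from F to F'. *)
Definition is_tilde_comp (F F' : bundle) U (B : sect F -> sect F')
    (a : forall x, tildeD F x) (c : forall x, tildeD F' x) : Prop :=
  exists T : sect E -> sect F,
    is_class_of U T a /\ is_class_of U (fun s => B (T s)) c.

Definition tD_postcomp (F F' : bundle) (x : M) (A : 'Hom(F x, F' x))
    (a : tildeD F x) : tildeD F' x := tD (A \o projT2 a)%VF.

End TildeD.

(* Raw data of a filtered sheaf of modules over the smooth functions; fsec_eq U
   is the equality of sections over U. *)
Record fmodule := FModule {
  fsec :> Type;
  fsec_smooth : set M -> fsec -> Prop;
  fsec_eq : set M -> fsec -> fsec -> Prop;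
  fsec_add : fsec -> fsec -> fsec;
  fsec_scale : (M -> R[i]) -> fsec -> fsec;
  fsec_filt : nat -> set M -> fsec -> Prop }.

Definition is_morphism (S T : fmodule) (N : set M -> S -> T) : Prop :=
  [/\ (forall U s, open U -> fsec_smooth U s -> fsec_smooth U (N U s)),
      (forall U V s t, open U -> open V -> V `<=` U ->
         fsec_smooth U s -> fsec_smooth V t -> fsec_eq V s t ->
         fsec_eq V (N U s) (N V t)) &
      (forall U f s t, open U -> smooth_fun U f ->
         fsec_smooth U s -> fsec_smooth U t ->
         fsec_eq U (N U (fsec_add (fsec_scale f s) t))
                   (fsec_add (fsec_scale f (N U s)) (N U t)))].

Definition is_filtered_iso (S T : fmodule) (N : set M -> S -> T) : Prop :=
  [/\ is_morphism N,
      (forall U s t, open U -> fsec_smooth U s -> fsec_smooth U t ->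
         fsec_eq U (N U s) (N U t) -> fsec_eq U s t),
      (forall U b, open U -> fsec_smooth U b ->
         exists2 s, fsec_smooth U s & fsec_eq U (N U s) b) &
      (forall r U s, open U -> fsec_smooth U s ->
         fsec_filt r U s <-> fsec_filt r U (N U s))].

Definition tildeD_sheaf (P : forall x, {vspace TMC x}) (E : vbundle)
    (dE : sect E -> forall x, 'Hom(Pbundle P x, E x)) (F : bundle) : fmodule :=
  @FModule (forall x, tildeD dE F x) (@tD_smooth P E dE F)
    (fun U a b => forall x, U x -> tD_eq (a x) (b x))
    (fun a b x => tD_add (a x) (b x)) (fun f a x => tD_scale (f x) (a x))
    (@tD_order_le P E dE F).

Section Sym.
Variable Q : vbundle.

(* Sym Q_x is the polynomial ring on a basis of Q_x. *)
Definition sym_fiber (x : M) := mpoly (\dim {:Q x}) R[i].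

Definition sym_in (x : M) (v : Q x) : sym_fiber x :=
  \sum_i coord (vbasis {:Q x}) i v *: mpolyX R[i] (mnm1 i).

Definition sym_smooth U (G : forall x, sym_fiber x) : Prop :=
  forall x, U x -> exists V, [/\ open V, V x, V `<=` U &
    exists (m : nat) (f : 'I_m -> M -> R[i]) (d : 'I_m -> nat)
           (Z : 'I_m -> nat -> sect Q),
      (forall i, smooth_fun V (f i) /\ forall k, sm V (Z i k)) /\
      (forall y, V y ->
         G y = \sum_(i < m) f i y *: \prod_(k < d i) sym_in (Z i k y))].

Definition sym_sheaf : fmodule :=
  @FModule (forall x, sym_fiber x) sym_smooth
    (fun U G H => forall x, U x -> G x = H x)
    (fun G H x => G x + H x) (fun f G x => f x *: G x)
    (fun r U G => forall x, U x -> (msize (G x) <= r.+1)%N).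

(* Elements of Sym Q_x (x) H are polynomials with coefficients in H, written as
   families of elements of H indexed by monomials; here H = E_x^* (x) F_x. *)
Definition symhom_fiber (E F : bundle) (x : M) :=
  multinom (\dim {:Q x}) -> 'Hom(E x, F x).

Definition tensor (E F : bundle) (G : forall x, sym_fiber x)
    (A : forall x, 'Hom(E x, F x)) : forall x, symhom_fiber E F x :=
  fun x a => mcoeff a (G x) *: A x.
Arguments tensor {E F} G A x a.

Definition symhom_smooth (E F : bundle) U (T : forall x, symhom_fiber E F x)
    : Prop :=
  forall x, U x -> exists V, [/\ open V, V x, V `<=` U &
    exists (m : nat) (G : 'I_m -> forall x, sym_fiber x)
           (A : 'I_m -> forall x, 'Hom(E x, F x)),
      (forall i, sym_smooth V (G i) /\ smooth_hom V (A i)) /\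
      (forall y a, V y -> T y a = \sum_(i < m) tensor (G i) (A i) y a)].

Definition symhom_sheaf (E F : bundle) : fmodule :=
  @FModule (forall x, symhom_fiber E F x) (@symhom_smooth E F)
    (fun U S T => forall x, U x -> S x = T x)
    (fun S T x a => S x a + T x a) (fun f S x a => f x *: S x a)
    (fun r U S => forall x a, U x -> (r < mdeg a)%N -> S x a = 0).

End Sym.

Section PBW.
Variables (P : forall x, {vspace TMC x}) (Q E : vbundle).
Variable dE : sect E -> forall x, 'Hom(Pbundle P x, E x).
Variable j : forall x, 'Hom(Q x, TMC x).
Variable nabQ : sect Q -> forall x, 'Hom(TMC x, Q x).
Variable nabE : sect E -> forall x, 'Hom(TMC x, E x).

Definition covQ (Z W : sect Q) : sect Q := fun x => nabQ W x (j x (Z x)).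
Definition covE (Z : sect Q) (s : sect E) : sect E := fun x => nabE s x (j x (Z x)).

(* Z_1 ... Z_m, with the factors of index in I removed *)
Definition sym_prod (m : nat) (Z : 'I_m -> sect Q) (I : pred 'I_m)
    : sym_sheaf Q :=
  fun x => \prod_(k | ~~ I k) sym_in (Z k x).

(* covariant derivative along Z_i of Z_1 ... Z_m with Z_i removed *)
Definition cov_sym_prod (m : nat) (Z : 'I_m -> sect Q) (i : 'I_m)
    : sym_sheaf Q :=
  fun x => \sum_(k | k != i)
    sym_in (covQ (Z i) (Z k) x) * sym_prod Z (pred2 i k) x.

(* N is the map G |-> nabla^E_G, characterised by its recursive definition. *)
Definition is_nabla (N : set M -> sym_sheaf Q -> tildeD_sheaf dE E) : Prop :=
  [/\ is_morphism N,
      (forall U f, open U -> smooth_fun U f ->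
         is_class_of U (fun (s : sect E) x => f x *: s x)
           (N U (fun x => mpolyC _ (f x)))) &
      (forall U m (Z : 'I_m.+1 -> sect Q), open U -> (forall i, sm U (Z i)) ->
         exists C : 'I_m.+1 -> tildeD_sheaf dE E,
           (forall i, is_tilde_comp U (covE (Z i))
                        (N U (sym_prod Z (pred1 i))) (C i)) /\
           forall x, U x -> tD_eq (N U (sym_prod Z pred0) x)
             (tD_scale m.+1%:R^-1
               (\big[@tD_add P E dE E x/@tD_zero P E dE E x]_(i < m.+1)
                  tD_add (C i x)
                    (tD_scale (-1) (N U (cov_sym_prod Z i) x)))))].

Definition is_pbw (F : bundle) (N : set M -> sym_sheaf Q -> tildeD_sheaf dE E)
    (pbw : set M -> symhom_sheaf Q E F -> tildeD_sheaf dE F) : Prop :=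
  is_morphism pbw /\
  forall U (G : sym_sheaf Q) (A : forall x, 'Hom(E x, F x)),
    open U -> fsec_smooth U G -> smooth_hom U A ->
    fsec_eq U (pbw U (fun x => tensor G A (x := x))) (fun x => tD_postcomp (A x) (N U G x)).

End PBW.

End Bundles.

(* Main.v *)
From HB Require Import structures.
From mathcomp Require Import all_boot all_order all_algebra.
From mathcomp Require Import all_classical reals topology normedtype derive landau realfun.
From mathcomp Require Import perm complex ring zify.
From mathcomp Require Import -(notations) mpoly.
Require Import Defs.

Set Implicit Arguments.
Unset Strict Implicit.
Unset Printing Implicit Defensive.

Import Order.TTheory GRing.Theory Num.Theory.
Import numFieldNormedType.Exports.

Local Open Scope classical_set_scope.
Local Open Scope complex_scope.
Local Open Scope ring_scope.

(** Locally there is a frame [X] of the complexified tangent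
    bundle made of lifts of a frame of [Q] followed by a frame of [P], and a frame of
    [E] of closed sections, on which the operators [iota_Y o d_P] act as [Y] on each
    component ([adapted_exists]). Differential operators of order at most [r] on [E]
    are then, componentwise, combinations of iterated derivatives along sorted words
    of at most [r] fields of [X]. Sorting a word costs only shorter words, and by
    involutivity of [P] it never destroys the presence of a direction of [P] once the
    word ends with one ([sort_word]). Consequently a jet lies in [\tilde J^r] exactly
    when it is killed by the sorted words that contain a direction of [P]
    ([mem_tildeP]).

    The recursion that defines the PBW map makes sense for honest differential
    operators [Top Z], attached to sections [Z 0, ..., Z (m - 1)] of [Q]. These are
    symmetric and multilinear over the smooth functions ([Top_perm], [Top_upd_lin]),
    hence define an operator [nu p] for every element [p] of [Sym Q_x] ([nu_prod]),
    and the leading term of [Top Z] for sections of the frame is the corresponding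
    sorted word ([Top_lead]). So the PBW operators of the monomials in the frame of
    [Q], together with the words that contain a direction of [P], are unitriangular
    with respect to all sorted words: they form a frame of the operators of order at
    most [r], and the dual frame of the jet bundle is smooth ([dual_frame]). Its
    part dual to the PBW operators is a frame of [\tilde J^r] ([dual_horizontal]).
    In each fibre, the PBW operators of degree at most [r] are therefore coordinates
    on [\tilde J^r] ([tilde_inj], [tilde_surj]).

    An element of the direct limit of the [Hom(\tilde J^r, F)] is handled by its
    action on germs of sections with jets in [\tilde J^k] for [k] large ([RepE]).
    Existence of the maps [N] and [pbw] follows by taking the classes of [nu p]. They
    are determined by the requirements because an operator that vanishes on
    [\tilde J^r] is a combination of words with a direction of [P], so that its
    covariant derivatives vanish on [\tilde J^(r+1)] ([covE_vanish]): composition with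
    a covariant derivative is well defined on classes, and the recursion can be
    solved in one way only ([RepE_N], [RepE_pbw]).

    Finally the map is an isomorphism since the coefficients of a symbol are the values
    of its operator on the dual frame: this gives injectivity ([PB_inj]), local
    preimages that are smooth because the dual frame is ([local_symbol]) and that glue
    by uniqueness ([pbw_surj]), and the compatibility with the filtrations in both
    directions ([pbw_filt]). *)

(** * Partial derivatives in Euclidean space *)

Section RealCalculus.
Variables (R : realType) (n : nat).
Local Notation V := 'rV[R]_n.
Implicit Types (f g : V -> R) (y z : V) (D : set V).

Local Notation ee i := (delta_mx 0 i : V).

Lemma is_derive_line f (p e : V) (t : R) : derivable f (p + t *: e) e ->
  is_derive t 1 (fun t : R => f (p + t *: e)) ('D_e f (p + t *: e)).
Proof.
have E : (fun h : R => h^-1 *: (((fun t : R => f (p + t *: e)) \o shift t) (h *: (1 : R))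
      - f (p + t *: e)))
    = (fun h : R => h^-1 *: ((f \o shift (p + t *: e)) (h *: e) - f (p + t *: e))).
  apply/funext => h /=; congr (_ *: (f _ - _)).
  by rewrite [h *: (1 : R)]mulr1 scalerDl addrCA.
by move=> df; split; rewrite /derivable /derive E.
Qed.

Lemma mvt_line f (p e : V) (h : R) :
  (forall t : R, `|t| <= `|h| -> derivable f (p + t *: e) e) ->
  exists2 c, `|c| <= `|h| & f (p + h *: e) - f p = h * 'D_e f (p + c *: e).
Proof.
move=> df; pose g (t : R) := f (p + t *: e).
have dg (t : R) : `|t| <= `|h| -> is_derive t (1 : R) g ('D_e f (p + t *: e)).
  by move=> /df; exact: is_derive_line.
have g0 : g 0 = f p by rewrite /g scale0r addr0.
have cont (a b : R) : (forall t, t \in `[a, b] -> `|t| <= `|h|) ->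
    {within `[a, b], continuous g}.
  move=> ab; apply: derivable_within_continuous => t /ab/dg dt.
  exact: ex_derive.
have [h0|h0] := leP 0 h.
  have ab (t : R) : t \in `[0, h] -> `|t| <= `|h|.
    by rewrite in_itv /= => /andP[t0 th]; rewrite !ger0_norm.
  have ab' (t : R) : t \in `]0, h[ -> is_derive t (1 : R) g ('D_e f (p + t *: e)).
    move=> tI; apply/dg/ab; move: tI; rewrite !in_itv /= => /andP[a b].
    by rewrite !ltW.
  have [c cI E] := MVT_segment h0 ab' (cont _ _ ab).
  by exists c; [exact: ab|rewrite -g0 -/(g h) E subr0 mulrC].
have ab (t : R) : t \in `[h, 0] -> `|t| <= `|h|.
  by rewrite in_itv /= => /andP[th t0]; rewrite !ler0_norm ?lerN2 // ltW.
have ab' (t : R) : t \in `]h, 0[ -> is_derive t (1 : R) g ('D_e f (p + t *: e)).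
  move=> tI; apply/dg/ab; move: tI; rewrite !in_itv /= => /andP[a b].
  by rewrite !ltW.
have [c cI E] := MVT_segment (ltW h0) ab' (cont _ _ ab).
exists c; first exact: ab.
by apply: oppr_inj; rewrite opprB -g0 -/(g h) E sub0r mulrN mulrC.
Qed.

Lemma coord_le_norm (v : V) i : `|v 0 i| <= `|v|.
Proof.
by rewrite [leRHS]/Num.Def.normr/= mx_normrE; exact: (le_bigmax _ _ (0, i)).
Qed.

Lemma norm_le_coord (v : V) (e : R) : 0 <= e -> (forall i, `|v 0 i| <= e) -> `|v| <= e.
Proof.
move=> e0 ve; rewrite [leLHS]/Num.Def.normr/= mx_normrE bigmax_le //.
by move=> [i j] _ /=; rewrite ord1.
Qed.

(** Walk from [y] to [v + y] along the coordinate axes: the mean value theorem on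
    each leg produces a partial derivative close to the one at [y]. *)
Lemma C1_increment f y :
  (\forall z \near y, forall i, derivable f z (ee i)) ->
  (forall i, {for y, continuous (fun z => 'D_(ee i) f z)}) ->
  forall e : R, 0 < e -> \forall v \near (0 : V),
    `|f (v + y) - f y - \sum_i v 0 i * 'D_(ee i) f y| <= e * `|v|.
Proof.
move=> df cf e e0.
have e'0 : 0 < e / n.+1%:R by rewrite divr_gt0 // ltr0n.
have cf' : \forall z \near y, forall i,
    `|'D_(ee i) f y - 'D_(ee i) f z| < e / n.+1%:R.
  have ci i : \forall z \near y, `|'D_(ee i) f y - 'D_(ee i) f z| < e / n.+1%:R.
    by have /cvgrPdist_lt := cf i; exact.
  exact: filter_forall ci.
have [d /= d0 Hd] := (@nbhs_ballP R V y _).1 (filterI df cf').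
apply/nbhs_ballP; exists d => //= v; rewrite -ball_normE /= sub0r normrN => vd.
(* The corners of the path. *)
pose w (k : nat) : V := \row_i (if (i < k)%N then v 0 i else 0).
have w0 : w 0%N = 0 by apply/rowP => i; rewrite !mxE.
have wn : w n = v by apply/rowP => i; rewrite !mxE ltn_ord.
have wS (i : 'I_n) : w i.+1 = w i + v 0 i *: ee i.
  apply/rowP => k; rewrite !mxE eqxx /=.
  have [->|ki] := eqVneq k i; first by rewrite ltnSn ltnn add0r mulr1.
  by rewrite mulr0 addr0 ltnS leq_eqVlt val_eqE (negPf ki).
have in_ball (i : 'I_n) (c : R) : `|c| <= `|v 0 i| ->
    ball y d ((y + w i) + c *: ee i).
  move=> cv; rewrite -ball_normE /=; apply: le_lt_trans vd.
  rewrite -addrA opprD addNKr normrN.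
  apply: norm_le_coord => // k; rewrite !mxE eqxx /=.
  have [->|ki] := eqVneq k i.
    by rewrite ltnn add0r mulr1 (le_trans cv) // coord_le_norm.
  by rewrite mulr0 addr0; case: ifP => _; rewrite ?normr0 ?coord_le_norm.
have step (i : 'I_n) :
  `|f (y + w i.+1) - f (y + w i) - v 0 i * 'D_(ee i) f y| <= e / n.+1%:R * `|v|.
  have dfi (t : R) : `|t| <= `|v 0 i| -> derivable f ((y + w i) + t *: ee i) (ee i).
    by move=> /in_ball/Hd[+ _]; apply.
  have [c cv E] := mvt_line dfi.
  rewrite wS addrA E -mulrBr normrM mulrC ler_pM ?coord_le_norm //.
  by rewrite distrC; have [_ /(_ i)/ltW] := Hd _ (in_ball _ _ cv).
have -> : f (v + y) - f y - \sum_i v 0 i * 'D_(ee i) f y =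
    \sum_(i < n) (f (y + w i.+1) - f (y + w i) - v 0 i * 'D_(ee i) f y).
  rewrite sumrB; congr (_ - _).
  rewrite -(big_mkord xpredT (fun i => f (y + w i.+1) - f (y + w i))).
  by rewrite (telescope_sumr (fun i => f (y + w i)) (leq0n n)) w0 wn addr0 [v + y]addrC.
apply: le_trans (ler_norm_sum _ _ _) _.
apply: le_trans (ler_sum _ (fun i _ => step i)) _.
rewrite sumr_const card_ord -[_ *+ n]mulr_natr mulrAC; apply: ler_wpM2r => //.
rewrite -[leRHS]mulr1 -mulrA; apply: ler_wpM2l; first exact: ltW.
by rewrite mulrC ler_pdivrMr ?ltr0n // mul1r ler_nat.
Qed.

Lemma C1_differentiable f y :
  (\forall z \near y, forall i, derivable f z (ee i)) ->
  (forall i, {for y, continuous (fun z => 'D_(ee i) f z)}) ->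
  differentiable f y /\ forall v, 'd f y v = \sum_i v 0 i * 'D_(ee i) f y.
Proof.
move=> df cf.
pose L (v : V) : R := \sum_i v 0 i * 'D_(ee i) f y.
have linL : linear L.
  move=> a u v; rewrite /L scaler_sumr -big_split /=; apply: eq_bigr => i _.
  by rewrite !mxE mulrDl -mulrA.
pose LL := GRing.isLinear.Build _ _ _ _ L linL.
pose LH : {linear V -> R} := HB.pack L LL.
have cL : continuous LH.
  move=> v; rewrite /LH /= /L.
  have -> : (fun v : V => \sum_i v 0 i * 'D_(ee i) f y) =
     \sum_i (fun v : V => v 0 i * 'D_(ee i) f y).
    by apply/funext => u; rewrite fct_sumE.
  apply: (@differentiable_continuous R V R v).
  apply: differentiable_sum => i; apply: differentiableM => //.
  exact: differentiable_coord.
have dE : 'd f y = LH :> (V -> R).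
  apply: diff_unique => //; apply/eqaddoP => e e0; have := C1_increment df cf e0.
  apply: filterS => v /=; congr (`|_| <= _).
  by rewrite /shift /= opprD addrA.
split; last by move=> v; rewrite dE.
apply/diff_locallyP; rewrite dE; split=> //.
apply/eqaddoP => e e0; have := C1_increment df cf e0.
apply: filterS => v /=; congr (`|_| <= _).
by rewrite /shift /= opprD addrA.
Qed.

(** The second difference is the increment along [e1] of [f (z + h *: e2) - f z];
    the mean value theorem, used along [e1] and then along [e2], gives the mixed
    derivative. *)
Lemma second_difference f y (e1 e2 : V) (d : R) : 0 < d ->
  (forall z, ball y d z -> derivable f z e1 /\ derivable ('D_e1 f) z e2) ->
  forall h : R, (forall a b : R, `|a| <= `|h| -> `|b| <= `|h| -> ball y d (y + a *: e1 + b *: e2)) ->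
  exists2 z, ball y d z &
    f (y + h *: e1 + h *: e2) - f (y + h *: e1) - (f (y + h *: e2) - f y)
    = h * (h * 'D_e2 ('D_e1 f) z).
Proof.
move=> d0 df h hb.
have b0 (a : R) : `|a| <= `|h| -> ball y d (y + a *: e1).
  by move=> ah; have := hb a 0 ah; rewrite normr0 scale0r addr0; apply.
pose g := (f \o shift (h *: e2)) \- f.
have dsh z : derivable f (z + h *: e2) e1 ->
    is_derive z e1 (f \o shift (h *: e2)) ('D_e1 f (z + h *: e2)).
  have E : (fun t : R => t^-1 *: (((f \o shift (h *: e2)) \o shift z) (t *: e1)
      - (f \o shift (h *: e2)) z))
    = (fun t : R => t^-1 *: ((f \o shift (z + h *: e2)) (t *: e1) - f (z + h *: e2))).
    by apply/funext => t /=; rewrite addrA.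
  by move=> dz; split; rewrite /derivable /derive E.
have dg (t : R) : `|t| <= `|h| -> is_derive (y + t *: e1) e1 g
    ('D_e1 f (y + t *: e1 + h *: e2) - 'D_e1 f (y + t *: e1)).
  move=> th.
  have d1 := (df _ (hb _ h th (lexx _))).1; have d2 := (df _ (b0 _ th)).1.
  have i1 := dsh _ d1; have i2 := derivableP d2.
  exact: is_deriveB.
have [c ch E] : exists2 c, `|c| <= `|h| & g (y + h *: e1) - g y = h * 'D_e1 g (y + c *: e1).
  by apply: mvt_line => t /dg dt; exact: ex_derive.
have [c' ch' E'] : exists2 c', `|c'| <= `|h| &
    'D_e1 f (y + c *: e1 + h *: e2) - 'D_e1 f (y + c *: e1)
     = h * 'D_e2 ('D_e1 f) (y + c *: e1 + c' *: e2).
  apply: (@mvt_line ('D_e1 f) (y + c *: e1) e2 h) => t th.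
  exact: (df _ (hb _ _ ch th)).2.
exists (y + c *: e1 + c' *: e2); first exact: hb.
by rewrite -E'; have /@derive_val <- := dg c ch; rewrite -E /g /=.
Qed.

(** Both mixed derivatives are values, at points close to [y], of the same second
    difference quotient. *)
Lemma schwarz f y (e1 e2 : V) :
  (\forall z \near y, derivable f z e1 /\ derivable ('D_e1 f) z e2) ->
  (\forall z \near y, derivable f z e2 /\ derivable ('D_e2 f) z e1) ->
  {for y, continuous ('D_e2 ('D_e1 f))} -> {for y, continuous ('D_e1 ('D_e2 f))} ->
  'D_e2 ('D_e1 f) y = 'D_e1 ('D_e2 f) y.
Proof.
move=> d12 d21 c12 c21; apply/eqP; rewrite -subr_eq0 -normr_le0; apply/ler_addgt0Pr => e e0; rewrite add0r.
have e20 : 0 < e / 2 by rewrite divr_gt0.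
move/cvgrPdist_lt: c12 => /(_ _ e20) c12; move/cvgrPdist_lt: c21 => /(_ _ e20) c21.
have [d /= d0 Hd] := (@nbhs_ballP R V y _).1 (filterI (filterI d12 d21) (filterI c12 c21)).
pose N := `|e1| + `|e2| + 1.
have N0 : 0 < N by rewrite /N ltr_wpDl // addr_ge0.
pose h := d / 2 / N.
have h0 : 0 < h by rewrite !divr_gt0.
have small (a b : R) (u v : V) : `|u| + `|v| + 1 = N -> `|a| <= `|h| -> `|b| <= `|h| ->
    ball y d (y + a *: u + b *: v).
  move=> uv ah bh; rewrite -ball_normE /= -addrA opprD addNKr normrN.
  apply: le_lt_trans (ler_normD _ _) _; rewrite !normrZ.
  have : `|a| * `|u| + `|b| * `|v| <= h * N.
    rewrite (ger0_norm (ltW h0)) in ah bh.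
    rewrite -uv !mulrDr mulr1 -[leLHS]addr0.
    by apply: lerD (ltW h0); apply: lerD; apply: ler_wpM2r.
  by move=> /le_lt_trans; apply; rewrite /h divfK ?gt_eqF // ltr_pdivrMr // mulr_natr mulr2n ltrDl.
have [z zb E] := second_difference d0 (fun z zb => (Hd z zb).1.1) (fun a b => @small a b e1 e2 erefl).
have [z' zb' E'] := second_difference d0 (fun z zb => (Hd z zb).1.2)
   (fun a b => @small a b e2 e1 (congr1 (+%R^~ 1) (addrC _ _))).
have ZZ : 'D_e2 ('D_e1 f) z = 'D_e1 ('D_e2 f) z'.
  apply: (mulfI (lt0r_neq0 h0)); apply: (mulfI (lt0r_neq0 h0)).
  have alg (a b c k : R) : a - b - (c - k) = a - c - (b - k) by ring.
  apply: etrans (esym E) _; apply: etrans _ E'.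
  by rewrite (addrAC y); exact: alg.
have fin (a b c : R) : `|b - c| < e / 2 -> `|a - c| < e / 2 -> `|a - b| <= e.
  move=> bc ac; have -> : a - b = (a - c) - (b - c) by ring.
  apply: le_trans (ler_normB _ _) _; rewrite (splitr e).
  by apply: lerD; apply: ltW.
have := (Hd z zb).2.1; have := (Hd z' zb').2.2; rewrite /= -ZZ.
exact: fin.
Qed.

End RealCalculus.

(** * Functions of class C^k *)

Section RealClass.
Variables (R : realType) (n : nat).
Local Notation V := 'rV[R]_n.
Implicit Types (f g h : V -> R) (y z : V) (D : set V).

Local Notation ee i := (delta_mx 0 i : V).

Lemma continuous_near_eq f g y : {near y, f =1 g} ->
  {for y, continuous f} -> {for y, continuous g}.
Proof.
move=> fg; have E : f y = g y := nbhs_singleton fg.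
rewrite /prop_for /continuous_at -E => cf.
exact: (cvg_trans (near_eq_cvg (F := nbhs y) fg) cf).
Qed.

(** The real counterpart of [class_C]: real and imaginary parts are treated
    separately. *)
Fixpoint rC (k : nat) D f : Prop :=
  {in D, continuous f} /\
  if k is k'.+1 then
    forall i : 'I_n, (forall y, D y -> derivable f y (ee i)) /\ rC k' D ('D_(ee i) f)
  else True.

Lemma rC_continuous k D f y : rC k D f -> D y -> {for y, continuous f}.
Proof. by case: k => [|k] [cf _] Dy; apply: cf; rewrite inE. Qed.

Lemma rC_sub k D D' f : D' `<=` D -> rC k D f -> rC k D' f.
Proof.
move=> DD'; elim: k f => [|k IH] f [cf H]; split=> //.
- by move=> y; rewrite inE => /DD' Dy; apply: cf; rewrite inE.
- by move=> y; rewrite inE => /DD' Dy; apply: cf; rewrite inE.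
- by move=> i; have [d c] := H i; split; [move=> y /DD'; exact: d|exact: IH].
Qed.

Lemma rC_pred k D f : rC k.+1 D f -> rC k D f.
Proof.
elim: k f => [|k IH] f [cf H]; split=> // i; have [d c] := H i; split=> //.
exact: IH.
Qed.

Lemma rC_ext k D f g : open D -> {in D, f =1 g} -> rC k D f -> rC k D g.
Proof.
move=> oD; elim: k f g => [|k IH] f g fg [cf H].
  split=> // y Dy; apply: continuous_near_eq (cf y Dy).
  have := open_nbhs_nbhs (conj oD (set_mem Dy)).
  by apply: filterS => z Dz; apply: fg; rewrite inE.
have near_fg y : D y -> {near y, f =1 g}.
  move=> Dy; have := open_nbhs_nbhs (conj oD Dy).
  by apply: filterS => z Dz; apply: fg; rewrite inE.
split.
  move=> y Dy; apply: continuous_near_eq (cf y Dy).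
  exact: near_fg (set_mem Dy).
move=> i; have [d c] := H i; split.
  by move=> y Dy; apply: near_eq_derivable (d y Dy); exact: near_fg.
apply: IH c => y; rewrite inE => Dy; exact: near_eq_derive (near_fg y Dy).
Qed.

Lemma rC_cst k D (c : R) : rC k D (cst c).
Proof.
elim: k c => [|k IH] c; first by split=> // y _; exact: cst_continuous.
split; first by move=> y _; exact: cst_continuous.
move=> i; split; first by move=> y _; exact: derivable_cst.
have -> : 'D_(ee i) (cst c) = (cst 0 : V -> R) by apply/funext => y; rewrite derive_cst.
exact: IH.
Qed.

Lemma rC_add k D f g : open D -> rC k D f -> rC k D g -> rC k D (fun y => f y + g y).
Proof.
move=> oD; elim: k f g => [|k IH] f g [cf Hf] [cg Hg].
  by split=> // y Dy; exact: (cvgD (cf y Dy) (cg y Dy)).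
split; first by move=> y Dy; exact: (cvgD (cf y Dy) (cg y Dy)).
move=> i; have [df Cf] := Hf i; have [dg Cg] := Hg i; split.
  by move=> y Dy; apply: derivableD; [exact: df|exact: dg].
apply: rC_ext (IH _ _ Cf Cg) => // y; rewrite inE => Dy.
by rewrite [RHS]deriveD; [|exact: df|exact: dg].
Qed.

Lemma rC_mul k D f g : open D -> rC k D f -> rC k D g -> rC k D (fun y => f y * g y).
Proof.
move=> oD; elim: k f g => [|k IH] f g Hf Hg.
  case: Hf Hg => [cf _] [cg _].
  by split=> // y Dy; exact: (cvgM (cf y Dy) (cg y Dy)).
have Pf := rC_pred Hf; have Pg := rC_pred Hg.
case: Hf Hg => [cf Hf] [cg Hg].
split; first by move=> y Dy; exact: (cvgM (cf y Dy) (cg y Dy)).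
move=> i; have [df Cf] := Hf i; have [dg Cg] := Hg i; split.
  by move=> y Dy; apply: derivableM; [exact: df|exact: dg].
apply: rC_ext (rC_add oD (IH _ _ Pf Cg) (IH _ _ Pg Cf)) => // y; rewrite inE => Dy.
by rewrite [RHS]deriveM; [|exact: df|exact: dg].
Qed.

Lemma rC_opp k D f : open D -> rC k D f -> rC k D (fun y => - f y).
Proof.
move=> oD Hf; apply: rC_ext (rC_mul oD (rC_cst k D (-1)) Hf) => // y _.
by rewrite mulN1r.
Qed.

Lemma rC_inv k D f : open D -> (forall y, D y -> f y != 0) -> rC k D f ->
  rC k D (fun y => (f y)^-1).
Proof.
move=> oD f0; elim: k => [|k IH] Hf.
  case: Hf => [cf _].
  by split=> // y Dy; exact: (continuousV (f0 y (set_mem Dy)) (cf y Dy)).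
have Pf := rC_pred Hf.
case: Hf => [cf Hf].
split; first by move=> y Dy; exact: (continuousV (f0 y (set_mem Dy)) (cf y Dy)).
move=> i; have [df Cf] := Hf i; split.
  by move=> y Dy; apply: derivableV; [exact: f0|exact: df].
have H := rC_opp oD (rC_mul oD (rC_mul oD (IH Pf) (IH Pf)) Cf).
apply: rC_ext H => // y; rewrite inE => Dy.
rewrite [RHS]deriveV; [|exact: f0|exact: df].
by rewrite -exprVn expr2 -mulNr.
Qed.

Lemma continuous_coord (T : topologicalType) (tau : T -> V) (x : T) :
  (forall i, {for x, continuous (fun z : T => tau z 0 i)}) -> {for x, continuous tau}.
Proof.
move=> ct; apply/cvgrPdist_lt => e e0.
have e20 : 0 < e / 2 by rewrite divr_gt0.
have H i : \forall z \near x, `|tau x 0 i - tau z 0 i| < e / 2.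
  by have /cvgrPdist_lt := ct i; exact.
have H' : \forall z \near x, forall i, `|tau x 0 i - tau z 0 i| < e / 2 by exact: filter_forall H.
  apply: filterS H' => z Hz.
apply: (@le_lt_trans _ _ (e / 2)); last by rewrite ltr_pdivrMr // mulr_natr mulr2n ltrDl.
by apply: norm_le_coord => [|i]; [exact: ltW|rewrite !mxE ltW].
Qed.

Lemma rC1_near k D f y : open D -> rC k.+1 D f -> D y ->
  \forall z \near y, forall i, derivable f z (ee i).
Proof.
move=> oD [_ Hf] Dy; have := open_nbhs_nbhs (conj oD Dy).
by apply: filterS => z Dz i; exact: (Hf i).1.
Qed.

Lemma rC_differentiable k D f y : open D -> rC k.+1 D f -> D y ->
  differentiable f y /\ forall v, 'd f y v = \sum_i v 0 i * 'D_(ee i) f y.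
Proof.
move=> oD Hf Dy; apply: C1_differentiable; first exact: rC1_near Hf Dy.
by move=> i; case: Hf => _ /(_ i) [_ /rC_continuous]; exact.
Qed.

(** Restricting [tau] to the line through [y] with direction [v] reduces the chain
    rule to functions of one variable. *)
Lemma is_derive_comp (h : V -> R) (tau : V -> V) y (v : V) :
  differentiable h (tau y) -> (forall k, derivable (fun z => tau z 0 k) y v) ->
  is_derive y v (h \o tau) ('d h (tau y) (\row_k 'D_v (fun z => tau z 0 k) y)).
Proof.
move=> dh dt.
have dt' : derivable tau y v by apply/derivable_mxP => i k; rewrite ord1.
pose c (t : R) := tau (t *: v + y).
have dc : derivable c 0 1 by exact: (derivable1P tau y v).1 dt'.
have c0 : c 0 = tau y by rewrite /c scale0r add0r.
have dc' : differentiable c 0 by apply/derivable1_diffP.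
have dhc : differentiable (h \o c) 0 by apply: differentiable_comp => //; rewrite c0.
have D1 : derivable (h \o tau) y v.
  exact: (derivable1P (h \o tau) y v).2 ((derivable1_diffP (h \o c) 0).2 dhc).
split=> //.
have E (W : normedModType R) (f : V -> W) : 'D_v f y = 'D_1 (fun t : R => f (t *: v + y)) 0.
  rewrite /derive.
  have -> // : (fun t : R => t^-1 *: ((f \o shift y) (t *: v) - f y)) =
    (fun t : R => t^-1 *: (((fun t : R => f (t *: v + y)) \o shift 0) (t *: (1 : R))
       - f ((0 : R) *: v + y))).
  by apply/funext => t /=; rewrite scale0r add0r addr0 [t *: (1 : R)]mulr1.
have Eh : 'D_v (h \o tau) y = 'D_1 (h \o c) 0 := E _ _.
have Et : 'D_v tau y = 'D_1 c 0 := E _ _.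
have Ec : 'd c 0 (1 : R) = 'D_v tau y by rewrite Et deriveE.
have Er : 'd c 0 (1 : R) = \row_k 'D_v (fun z => tau z 0 k) y.
  by rewrite Ec (derive_mx dt'); apply/rowP => k; rewrite !mxE.
have dh' : differentiable h (c 0) by rewrite c0.
have Dc : 'd (h \o c) 0 = 'd h (c 0) \o 'd c 0 :> (R -> R) := diff_comp dc' dh'.
rewrite Eh (deriveE _ dhc) Dc.
have -> : ('d h (c 0) \o 'd c 0) 1 = 'd h (c 0) ('d c 0 1) by exact: erefl.
by rewrite Er c0.
Qed.

(** By induction on the order: the chain rule writes the partial derivatives of the
    composite with products and composites of functions of one order less. *)
Lemma rC_comp k D D' h (tau : V -> V) : open D -> open D' ->
  (forall y, D y -> D' (tau y)) -> rC k D' h ->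
  (forall i, rC k D (fun y => tau y 0 i)) -> rC k D (h \o tau).
Proof.
move=> oD oD' DD'; elim: k h => [|k IH] h Hh Ht.
  split=> // y; rewrite inE => Dy; apply: continuous_comp.
    by apply: continuous_coord => i; exact: (rC_continuous (Ht i) Dy).
  exact: rC_continuous Hh (DD' _ Dy).
split.
  move=> y; rewrite inE => Dy; apply: continuous_comp.
    by apply: continuous_coord => i; exact: (rC_continuous (Ht i) Dy).
  exact: rC_continuous Hh (DD' _ Dy).
move=> i.
have key y : D y -> is_derive y (ee i) (h \o tau)
    (\sum_k 'D_(ee i) (fun z => tau z 0 k) y * 'D_(ee k) h (tau y)).
  move=> Dy; have [dh dE] := rC_differentiable oD' Hh (DD' _ Dy).
  have dt l : derivable (fun z => tau z 0 l) y (ee i).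
    by case: (Ht l) => _ /(_ i) [d _]; exact: d.
  have := is_derive_comp dh dt; rewrite dE.
  by under eq_bigr do rewrite mxE.
split; first by move=> y /key Hy; exact: ex_derive.
apply: (@rC_ext _ _ (fun y => \sum_k 'D_(ee i) (fun z => tau z 0 k) y * 'D_(ee k) h (tau y))) => //.
  by move=> y; rewrite inE => /key Hy; rewrite derive_val.
elim: (index_enum _) => [|l s IHs].
  by apply: rC_ext (rC_cst k D 0) => // y _; rewrite big_nil.
have H1 : rC k D ('D_(ee i) (fun z => tau z 0 l)) by case: (Ht l) => _ /(_ i) [].
have H2 : rC k D ('D_(ee l) h \o tau).
  apply: IH; first by case: Hh => _ /(_ l) [].
  by move=> m; exact: rC_pred.
apply: rC_ext (rC_add oD (rC_mul oD H1 H2) IHs) => // y _.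
by rewrite big_cons.
Qed.

Lemma rC_schwarz D f i j y : open D -> (forall k, rC k D f) -> D y ->
  'D_(ee i) ('D_(ee j) f) y = 'D_(ee j) ('D_(ee i) f) y.
Proof.
move=> oD Hf Dy; apply: schwarz.
- have := open_nbhs_nbhs (conj oD Dy); apply: filterS => z Dz.
  case: (Hf 2%N) => _ H; have [d [_ H']] := H j; split; first exact: d.
  exact: (H' i).1.
- have := open_nbhs_nbhs (conj oD Dy); apply: filterS => z Dz.
  case: (Hf 2%N) => _ H; have [d [_ H']] := H i; split; first exact: d.
  exact: (H' j).1.
- by case: (Hf 2%N) => _ /(_ j) [_ [_ /(_ i) [_ C]]]; exact: (@rC_continuous 0%N D _ y C Dy).
- by case: (Hf 2%N) => _ /(_ i) [_ [_ /(_ j) [_ C]]]; exact: (@rC_continuous 0%N D _ y C Dy).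
Qed.

End RealClass.

(** * Complex valued smooth functions *)

Section ComplexCalculus.
Variables (R : realType) (n : nat).
Local Notation V := 'rV[R]_n.
Implicit Types (f g : V -> R[i]) (y z : V) (D : set V).

Local Notation ee i := (delta_mx 0 i : V).

Lemma class_CE k D f : class_C k D f <-> rC k D (Re_of f) /\ rC k D (Im_of f).
Proof.
elim: k f => [|k IH] f /=.
  by split=> [[? [? _]]|[[? _] [? _]]].
split.
  move=> [cr [ci H]]; split; split=> // i; have [d /IH [cr' ci']] := H i.
    by split=> // y /d [].
  by split=> // y /d [].
move=> [[cr Hr] [ci Hi]]; split=> //; split=> // i.
have [dr cr'] := Hr i; have [di ci'] := Hi i; split; first by split; [exact: dr|exact: di].
exact/IH.
Qed.

Lemma smoothE D f : smooth D f <-> forall k, rC k D (Re_of f) /\ rC k D (Im_of f).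
Proof. by split=> H k; apply/class_CE. Qed.

Lemma smooth_sub D D' f : D' `<=` D -> smooth D f -> smooth D' f.
Proof.
by move=> DD' /smoothE H; apply/smoothE => k; have [? ?] := H k; split; exact: rC_sub DD' _.
Qed.

Lemma rC_set1 k D (f : V -> R) : (forall y, D y -> rC k [set y] f) <-> rC k D f.
Proof.
split; last by move=> H y Dy; apply: rC_sub H => z ->.
elim: k f => [|k IH] f H.
  by split=> // y; rewrite inE => /H [c _]; apply: c; rewrite inE.
split.
  by move=> y; rewrite inE => /H [c _]; apply: c; rewrite inE.
move=> i; split; first by move=> y /H [_ /(_ i) [d _]]; exact: d.
by apply: IH => y /H [_ /(_ i) []].
Qed.

(** The derivatives are those of the ambient space, so that smoothness on a set is
    tested point by point. *)
Lemma smooth_set1 D f : (forall y, D y -> smooth [set y] f) <-> smooth D f.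
Proof.
split.
  move=> H; apply/smoothE => k; split; apply/rC_set1 => y /H/smoothE/(_ k) [] //.
by move=> H y Dy; apply: smooth_sub H => z ->.
Qed.

Lemma smooth_ext D f g : open D -> {in D, f =1 g} -> smooth D f -> smooth D g.
Proof.
move=> oD fg /smoothE H; apply/smoothE => k; have [Hr Hi] := H k.
split; [apply: rC_ext Hr|apply: rC_ext Hi] => // y Dy; by rewrite /Re_of /Im_of fg.
Qed.

Lemma smooth_real D (f : V -> R) : open D ->
  smooth D (fun y => (f y)%:C) <-> forall k, rC k D f.
Proof.
move=> oD; split=> [/smoothE H k|H]; first by have [] := H k.
by apply/smoothE => k; split=> //; exact: rC_cst.
Qed.

Lemma smooth_cst D (c : R[i]) : smooth D (fun=> c).
Proof. by apply/smoothE => k; split; exact: rC_cst. Qed.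

Lemma Re_add (a b : R[i]) : complex.Re (a + b) = complex.Re a + complex.Re b.
Proof. by case: a b => [a a'] [b b']. Qed.
Lemma Im_add (a b : R[i]) : complex.Im (a + b) = complex.Im a + complex.Im b.
Proof. by case: a b => [a a'] [b b']. Qed.
Lemma Re_mul (a b : R[i]) : complex.Re (a * b) =
  complex.Re a * complex.Re b + - (complex.Im a * complex.Im b).
Proof. by case: a b => [a a'] [b b']. Qed.
Lemma Im_mul (a b : R[i]) : complex.Im (a * b) =
  complex.Re a * complex.Im b + complex.Im a * complex.Re b.
Proof. by case: a b => [a a'] [b b']. Qed.

Lemma smooth_add D f g : open D -> smooth D f -> smooth D g -> smooth D (fun y => f y + g y).
Proof.
move=> oD /smoothE Hf /smoothE Hg; apply/smoothE => k.
have [fr fi] := Hf k; have [gr gi] := Hg k; split.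
  by apply: rC_ext (rC_add oD fr gr) => // y _; rewrite /Re_of Re_add.
by apply: rC_ext (rC_add oD fi gi) => // y _; rewrite /Im_of Im_add.
Qed.

Lemma smooth_mul D f g : open D -> smooth D f -> smooth D g -> smooth D (fun y => f y * g y).
Proof.
move=> oD /smoothE Hf /smoothE Hg; apply/smoothE => k.
have [fr fi] := Hf k; have [gr gi] := Hg k; split.
  have H := rC_add oD (rC_mul oD fr gr) (rC_opp oD (rC_mul oD fi gi)).
  by apply: rC_ext H => // y _; rewrite /Re_of Re_mul.
have H := rC_add oD (rC_mul oD fr gi) (rC_mul oD fi gr).
by apply: rC_ext H => // y _; rewrite /Im_of Im_mul.
Qed.

Lemma smooth_inv D f : open D -> (forall y, D y -> f y != 0) -> smooth D f ->
  smooth D (fun y => (f y)^-1).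
Proof.
move=> oD f0 /smoothE Hf; apply/smoothE => k; have [fr fi] := Hf k.
have N0 y : D y -> Re_of f y * Re_of f y + Im_of f y * Im_of f y != 0.
  move=> /f0; rewrite /Re_of /Im_of; case: (f y) => a b.
  rewrite eq_complex /= negb_and -!expr2 => ab.
  by rewrite paddr_eq0 ?sqr_ge0 // !sqrf_eq0 negb_and.
have HN := rC_inv oD N0 (rC_add oD (rC_mul oD fr fr) (rC_mul oD fi fi)).
split.
  apply: rC_ext (rC_mul oD fr HN) => // y _.
  by rewrite /Re_of /Im_of; case: (f y) => a b /=; rewrite !expr2.
apply: rC_ext (rC_opp oD (rC_mul oD fi HN)) => // y _.
by rewrite /Re_of /Im_of; case: (f y) => a b /=; rewrite !expr2.
Qed.

Lemma Re_partial i f : Re_of (partial i f) = 'D_(ee i) (Re_of f).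
Proof. by []. Qed.
Lemma Im_partial i f : Im_of (partial i f) = 'D_(ee i) (Im_of f).
Proof. by []. Qed.

Lemma smooth_partial D f i : smooth D f -> smooth D (partial i f).
Proof.
move=> /smoothE H; apply/smoothE => k; have [Hr Hi] := H k.+1.
by split; [case: Hr => _ /(_ i) []|case: Hi => _ /(_ i) []].
Qed.

Lemma smooth_comp D D' f (tau : V -> V) : open D -> open D' ->
  (forall y, D y -> D' (tau y)) -> smooth D' f ->
  (forall i, smooth D (fun y => (tau y 0 i)%:C)) -> smooth D (f \o tau).
Proof.
move=> oD oD' DD' /smoothE Hf Ht; apply/smoothE => k; have [fr fi] := Hf k.
have Ht' i : rC k D (fun y => tau y 0 i) by have /smooth_real := Ht i; exact.
by split; [exact: (rC_comp oD oD' DD' fr Ht')|exact: (rC_comp oD oD' DD' fi Ht')].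
Qed.

Lemma smooth_derivable D f i y : smooth D f -> D y ->
  derivable (Re_of f) y (ee i) /\ derivable (Im_of f) y (ee i).
Proof. by move=> /(_ 1%N) [_ [_ /(_ i) [d _]]] /d. Qed.

Lemma partial_near_eq f g y i : {near y, f =1 g} -> partial i f y = partial i g y.
Proof.
move=> fg; congr (_ +i* _); apply: near_eq_derive; apply: filterS fg => z;
by rewrite /Re_of /Im_of => ->.
Qed.

Lemma partial_open_eq D f g y i : open D -> D y -> {in D, f =1 g} ->
  partial i f y = partial i g y.
Proof.
move=> oD Dy fg; apply: partial_near_eq; have := open_nbhs_nbhs (conj oD Dy).
by apply: filterS => z Dz; apply: fg; rewrite inE.
Qed.

Lemma partial_cst (c : R[i]) y i : partial i (fun=> c) y = 0.
Proof.
by apply/eqP; rewrite eq_complex /= (_ : Re_of _ = cst (complex.Re c)) //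
  (_ : Im_of _ = cst (complex.Im c)) // !derive_cst !eqxx.
Qed.

Lemma partial_add D f g i y : smooth D f -> smooth D g -> D y ->
  partial i (fun z => f z + g z) y = partial i f y + partial i g y.
Proof.
move=> Hf Hg Dy; have [fr fi] := smooth_derivable i Hf Dy.
have [gr gi] := smooth_derivable i Hg Dy.
rewrite /partial (_ : Re_of _ = Re_of f + Re_of g); last first.
  by apply/funext => z; rewrite /Re_of Re_add.
rewrite (_ : Im_of (fun z => f z + g z) = Im_of f + Im_of g); last first.
  by apply/funext => z; rewrite /Im_of Im_add.
by rewrite (deriveD fr gr) (deriveD fi gi).
Qed.

Lemma partial_mul D f g i y : smooth D f -> smooth D g -> D y ->
  partial i (fun z => f z * g z) y = partial i f y * g y + f y * partial i g y.
Proof.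
move=> Hf Hg Dy; have [fr fi] := smooth_derivable i Hf Dy.
have [gr gi] := smooth_derivable i Hg Dy.
rewrite /partial (_ : Re_of _ = Re_of f * Re_of g - Im_of f * Im_of g); last first.
  by apply/funext => z; rewrite /Re_of Re_mul.
rewrite (_ : Im_of (fun z => f z * g z) = Re_of f * Im_of g + Im_of f * Re_of g); last first.
  by apply/funext => z; rewrite /Im_of Im_mul.
rewrite (deriveB (derivableM fr gr) (derivableM fi gi)).
rewrite (deriveD (derivableM fr gi) (derivableM fi gr)).
rewrite (deriveM fr gr) (deriveM fi gi) (deriveM fr gi) (deriveM fi gr).
rewrite /Re_of /Im_of.
have alg (p q r s a b c d : R) :
  (p * b + r * a - (q * d + s * c)) +i* (p * d + s * a + (q * b + r * c)) =
  (a +i* c) * (r +i* s) + (p +i* q) * (b +i* d).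
  by apply/eqP; rewrite eq_complex /=; apply/andP; split; apply/eqP; ring.
by case: (f y) (g y) => p q [r s]; exact: alg.
Qed.

Lemma partial_schwarz D f i j y : open D -> smooth D f -> D y ->
  partial i (partial j f) y = partial j (partial i f) y.
Proof.
move=> oD /smoothE Hf Dy.
have Er := rC_schwarz i j oD (fun k => (Hf k).1) Dy.
have Ei := rC_schwarz i j oD (fun k => (Hf k).2) Dy.
have E l m : partial l (partial m f) y =
    'D_(ee l) ('D_(ee m) (Re_of f)) y +i* 'D_(ee l) ('D_(ee m) (Im_of f)) y.
  by rewrite {1}/partial Re_partial Im_partial.
by rewrite !E Er Ei.
Qed.

Lemma partial_comp D D' f (tau : V -> V) i y : open D -> open D' ->
  (forall y, D y -> D' (tau y)) -> smooth D' f ->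
  (forall i, smooth D (fun y => (tau y 0 i)%:C)) -> D y ->
  partial i (f \o tau) y =
  \sum_k partial k f (tau y) * partial i (fun y => (tau y 0 k)%:C) y.
Proof.
move=> oD oD' DD' /smoothE Hf Ht Dy.
have dt k : derivable (fun z => tau z 0 k) y (ee i).
  by have [] := smooth_derivable i (Ht k) Dy.
have E (h : V -> R) : rC 1 D' h -> 'D_(ee i) (h \o tau) y =
    \sum_k 'D_(ee k) h (tau y) * 'D_(ee i) (fun z => tau z 0 k) y.
  move=> Hh; have [dh dE] := rC_differentiable oD' Hh (DD' _ Dy).
  have H := is_derive_comp dh dt; rewrite derive_val dE.
  by apply: eq_bigr => k _; rewrite mxE mulrC.
have [fr fi] := Hf 1%N.
rewrite /partial -[Re_of (f \o tau)]/(Re_of f \o tau) -[Im_of (f \o tau)]/(Im_of f \o tau).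
rewrite !E // => {E}.
apply/eqP; rewrite eq_complex; apply/andP; split; apply/eqP.
  rewrite [LHS]/=; elim/big_rec2: _ => // k a b _ ->; rewrite Re_add Re_mul /=; congr (_ + _).
  rewrite (_ : Im_of (fun y0 => (tau y0 0 k)%:C) = cst 0) // derive_cst.
  by rewrite mulr0 subr0.
rewrite [LHS]/=; elim/big_rec2: _ => // k a b _ ->; rewrite Im_add Im_mul /=; congr (_ + _).
rewrite (_ : Im_of (fun y0 => (tau y0 0 k)%:C) = cst 0) // derive_cst.
by rewrite mulr0 add0r.
Qed.

End ComplexCalculus.

(** * Smooth functions on a manifold *)

Section ManifoldFunctions.
Variables (R : realType) (n : nat) (M : manifold R n).
Implicit Types (f g : M -> R[i]) (x y z : M) (U W : set M).

Lemma phi_image_preimage x U : phi x @` (dom x `&` U) =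
  (phi x @` dom x) `&` (psi x @^-1` (dom x `&` U)).
Proof.
apply/seteqP; split=> [_ [y [dy Uy] <-]|_ [[y dy <-]]].
  by split; [exists y|rewrite /= phiK].
by rewrite /= phiK // => -[_ Uy]; exists y.
Qed.

Lemma phi_open x U : open U -> open (phi x @` (dom x `&` U)).
Proof.
move=> oU; rewrite phi_image_preimage openE => _ [[y dy <-]] /=.
rewrite phiK // => yU; apply: filterI.
  by apply: open_nbhs_nbhs; split; [exact: phi_dom_open|exists y].
have cp := @psi_continuous _ _ M x (phi x y) (mem_set (ex_intro2 _ _ y dy erefl)).
apply: cp; rewrite phiK //; apply: open_nbhs_nbhs; split=> //.
by apply: openI => //; exact: dom_open.
Qed.

Arguments phi_open x [U] _.

Lemma dom_preimage_open x (D : set 'rV[R]_n) : open D -> open (dom x `&` phi x @^-1` D).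
Proof.
move=> oD; rewrite openE => y [dy Dy]; apply: filterI.
  by apply: open_nbhs_nbhs; split=> //; exact: dom_open.
apply: (phi_continuous (mem_set dy)); exact: open_nbhs_nbhs.
Qed.

(** Smoothness near a point. Being smooth on an open set is a pointwise matter, so
    that most statements below are about germs, which spares the bookkeeping of
    domains. *)
Definition sf x f := exists U, [/\ open U, U x & smooth_fun U f].

Lemma smooth_fun_sub U W f : W `<=` U -> smooth_fun U f -> smooth_fun W f.
Proof.
move=> WU Hf x; apply: smooth_sub (Hf x) => _ [y [dy Wy] <-].
by exists y => //; split=> //; exact: WU.
Qed.

Lemma smooth_funP U f : open U -> smooth_fun U f <-> forall x, U x -> sf x f.
Proof.
move=> oU; split=> [Hf x Ux|H x]; first by exists U.
apply/smooth_set1 => _ [y [dy Uy] <-]; have [W [oW Wy Hf]] := H y Uy.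
by apply: smooth_sub (Hf x) => _ ->; exists y.
Qed.

Lemma sf_open U f x : open U -> smooth_fun U f -> U x -> sf x f.
Proof. by move=> oU /smooth_funP-/(_ oU); exact. Qed.

Lemma sf_nearP x f : sf x f <-> \forall z \near x, sf z f.
Proof.
split=> [[U [oU Ux Hf]]|]; last exact: nbhs_singleton.
by apply: filterS (open_nbhs_nbhs (conj oU Ux)) => z Uz; exists U.
Qed.

Lemma sf_near x f : sf x f -> \forall z \near x, sf z f.
Proof. by move/sf_nearP. Qed.

Lemma nearP x (P : set M) : (\forall z \near x, P z) ->
  exists U, [/\ open U, U x & U `<=` P].
Proof.
by move=> H; exists (interior P); split; [exact: open_interior|exact: H|exact: interior_subset].
Qed.

Lemma near2 x (P1 P2 P : set M) : (\forall z \near x, P1 z) -> (\forall z \near x, P2 z) ->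
  (forall z, P1 z -> P2 z -> P z) -> \forall z \near x, P z.
Proof. by move=> H1 H2 H; apply: filterS (filterI H1 H2) => z [? ?]; exact: H. Qed.

Lemma sf_ext x f g : {near x, f =1 g} -> sf x f -> sf x g.
Proof.
move=> /nearP [W [oW Wx fg]] [U [oU Ux Hf]].
exists (U `&` W); split=> //; first exact: openI.
move=> x0; have oD := phi_open x0 (openI oU oW).
apply: (@smooth_ext _ _ _ (f \o psi x0)) => //.
  move=> _ /set_mem [z [dz [Uz Wz]] <-] /=; rewrite phiK //; exact: fg.
by exact: (smooth_fun_sub (@subIsetl _ U W) Hf x0).
Qed.

Lemma sf_cst x (c : R[i]) : sf x (fun=> c).
Proof. by exists setT; split=> //; [exact: openT|move=> x0; exact: smooth_cst]. Qed.

Lemma sf_add x f g : sf x f -> sf x g -> sf x (fun y => f y + g y).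
Proof.
move=> [U [oU Ux Hf]] [W [oW Wx Hg]]; exists (U `&` W); split=> //; first exact: openI.
move=> x0; apply: smooth_add; first exact/phi_open/openI.
  by exact: (smooth_fun_sub (@subIsetl _ U W) Hf x0).
by exact: (smooth_fun_sub (@subIsetr _ U W) Hg x0).
Qed.

Lemma sf_mul x f g : sf x f -> sf x g -> sf x (fun y => f y * g y).
Proof.
move=> [U [oU Ux Hf]] [W [oW Wx Hg]]; exists (U `&` W); split=> //; first exact: openI.
move=> x0; apply: smooth_mul; first exact/phi_open/openI.
  by exact: (smooth_fun_sub (@subIsetl _ U W) Hf x0).
by exact: (smooth_fun_sub (@subIsetr _ U W) Hg x0).
Qed.

Lemma sf_opp x f : sf x f -> sf x (fun y => - f y).
Proof.
move=> Hf; apply: (@sf_ext _ (fun y => -1 * f y)).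
  by apply: nearW => y; rewrite mulN1r.
exact: sf_mul (sf_cst _ _) Hf.
Qed.

Lemma sf_sum x (I : Type) (s : seq I) (P : pred I) (F : I -> M -> R[i]) :
  (forall i, P i -> sf x (F i)) -> sf x (fun y => \sum_(i <- s | P i) F i y).
Proof.
move=> HF; elim: s => [|i s IH].
  by apply: sf_ext (sf_cst x 0); apply: nearW => y; rewrite big_nil.
case Pi: (P i); last by apply: sf_ext IH; apply: nearW => y; rewrite big_cons Pi.
apply: sf_ext (sf_add (HF i Pi) IH).
by apply: nearW => y; rewrite big_cons Pi.
Qed.

Lemma sf_prod x (I : Type) (s : seq I) (P : pred I) (F : I -> M -> R[i]) :
  (forall i, P i -> sf x (F i)) -> sf x (fun y => \prod_(i <- s | P i) F i y).
Proof.
move=> HF; elim: s => [|i s IH].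
  by apply: sf_ext (sf_cst x 1); apply: nearW => y; rewrite big_nil.
case Pi: (P i); last by apply: sf_ext IH; apply: nearW => y; rewrite big_cons Pi.
apply: sf_ext (sf_mul (HF i Pi) IH).
by apply: nearW => y; rewrite big_cons Pi.
Qed.

Lemma sf_continuous x f : sf x f -> {for x, continuous (Re_of (f \o psi x) \o phi x)} /\
  {for x, continuous (Im_of (f \o psi x) \o phi x)}.
Proof.
move=> [U [oU Ux /(_ x) /smoothE /(_ 0%N) [[cr _] [ci _]]]].
have dx := mem_dom x; have cp := phi_continuous (mem_set dx).
have im : (phi x @` (dom x `&` U)) (phi x x) by exists x.
by split; apply: continuous_comp => //; [apply: cr|apply: ci]; rewrite inE.
Qed.

Lemma sf_neq0 x f : sf x f -> f x != 0 -> \forall z \near x, f z != 0.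
Proof.
move=> Hf fx0; have [cr ci] := sf_continuous Hf.
have dx : \forall z \near x, dom x z.
  by apply: open_nbhs_nbhs; split; [exact: dom_open|exact: mem_dom].
have : Re_of (f \o psi x) (phi x x) != 0 \/ Im_of (f \o psi x) (phi x x) != 0.
  move: fx0; rewrite /Re_of /Im_of /= phiK; last exact: mem_dom.
  by case: (f x) => a b; rewrite eq_complex /= negb_and => /orP.
have key (h : M -> R) : {for x, continuous h} -> h x != 0 -> \forall z \near x, h z != 0.
  by move=> ch hx; exact: (cvgr_neq0 _ ch hx).
case=> H.
  apply: (near2 dx (key _ cr H)) => z dz; apply: contraNN.
  by rewrite /Re_of /= phiK // => /eqP ->.
apply: (near2 dx (key _ ci H)) => z dz; apply: contraNN.
by rewrite /Im_of /= phiK // => /eqP ->.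
Qed.

Lemma sf_inv x f : sf x f -> f x != 0 -> sf x (fun y => (f y)^-1).
Proof.
move=> Hf fx0; have [U [oU Ux Hf']] := Hf.
have [W [oW Wx HW]] := nearP (sf_neq0 Hf fx0).
exists (U `&` W); split=> //; first exact: openI.
move=> x0; apply: smooth_inv; first exact/phi_open/openI.
  by move=> _ [z [dz [Uz Wz]] <-] /=; rewrite phiK //; exact: HW.
by exact: (smooth_fun_sub (@subIsetl _ U W) Hf' x0).
Qed.

Lemma transition_real x x' (i : 'I_n) :
  smooth (phi x @` (dom x `&` dom x')) (fun t => (phi x' (psi x t) 0 i)%:C).
Proof. exact: transition_smooth. Qed.

(** Transition maps are smooth, hence one chart is enough to test smoothness. *)
Lemma sf_chart x0 y f (D : set 'rV[R]_n) : dom x0 y -> open D -> D (phi x0 y) ->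
  D `<=` phi x0 @` dom x0 -> smooth D (f \o psi x0) -> sf y f.
Proof.
move=> dy oD Dy Dsub Hf; exists (dom x0 `&` phi x0 @^-1` D); split=> //.
  exact: dom_preimage_open.
move=> x; pose U := dom x0 `&` phi x0 @^-1` D.
have oU : open U by exact: dom_preimage_open.
have oI := phi_open x oU.
apply: (@smooth_ext _ _ _ ((f \o psi x0) \o (phi x0 \o psi x))) => //.
  by move=> _ /set_mem [z [dz [d0z Dz]] <-] /=; rewrite !phiK.
apply: smooth_comp oI oD _ Hf _.
  by move=> _ [z [dz [d0z Dz]] <-] /=; rewrite phiK.
move=> i; apply: smooth_sub (transition_real x x0 i) => _ [z [dz [d0z Dz]] <-].
by exists z.
Qed.

Lemma sf_coord x0 y i : dom x0 y -> sf y (coordfun x0 i).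
Proof.
move=> dy; exists (dom x0); split=> //; first exact: dom_open.
by move=> x; exact: transition_real.
Qed.

(** The coordinate derivatives of the chart around [x0]. *)
Definition dd x0 (i : 'I_n) f : M -> R[i] := fun y => partial i (f \o psi x0) (phi x0 y).

Lemma sf_dd x0 y i f : dom x0 y -> sf y f -> sf y (dd x0 i f).
Proof.
move=> dy [U [oU Uy Hf]]; have oD := phi_open x0 oU.
apply: (@sf_chart x0 y _ (phi x0 @` (dom x0 `&` U))) => //; first by exists y.
  by move=> _ [z [dz _] <-]; exists z.
apply: (@smooth_ext _ _ _ (partial i (f \o psi x0))) => //.
  by move=> _ /set_mem [z [dz _] <-]; rewrite /dd /= phiK.
exact: smooth_partial.
Qed.

Lemma phi_near x0 y (P : set M) : dom x0 y -> (\forall z \near y, P z) ->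
  \forall t \near phi x0 y, P (psi x0 t).
Proof.
move=> dy Py; have im : phi x0 y \in phi x0 @` dom x0 by rewrite inE; exists y.
by apply: (psi_continuous im); rewrite phiK.
Qed.

Lemma dd_near_eq x0 y i f g : dom x0 y -> {near y, f =1 g} -> dd x0 i f y = dd x0 i g y.
Proof. by move=> dy fg; apply: partial_near_eq; exact: phi_near fg. Qed.

Lemma dd_cst x0 y i (c : R[i]) : dd x0 i (fun=> c) y = 0.
Proof. exact: partial_cst. Qed.

Lemma sf2 y f g : sf y f -> sf y g -> exists U, [/\ open U, U y, smooth_fun U f & smooth_fun U g].
Proof.
move=> [U [oU Uy Hf]] [W [oW Wy Hg]]; exists (U `&` W); split=> //; first exact: openI.
  by apply: smooth_fun_sub Hf => z [].
by apply: smooth_fun_sub Hg => z [].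
Qed.

Lemma dd_add x0 y i f g : dom x0 y -> sf y f -> sf y g ->
  dd x0 i (fun z => f z + g z) y = dd x0 i f y + dd x0 i g y.
Proof.
move=> dy Hf Hg; have [U [oU Uy sF sG]] := sf2 Hf Hg.
by apply: (partial_add _ (sF x0) (sG x0)); exists y.
Qed.

Lemma dd_mul x0 y i f g : dom x0 y -> sf y f -> sf y g ->
  dd x0 i (fun z => f z * g z) y = dd x0 i f y * g y + f y * dd x0 i g y.
Proof.
move=> dy Hf Hg; have [U [oU Uy sF sG]] := sf2 Hf Hg.
rewrite {1}/dd; have := partial_mul i (sF x0) (sG x0) (ex_intro2 _ _ y (conj dy Uy) erefl).
by rewrite /= phiK.
Qed.

Lemma dd_comm x0 y i k f : dom x0 y -> sf y f ->
  dd x0 i (dd x0 k f) y = dd x0 k (dd x0 i f) y.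
Proof.
move=> dy [U [oU Uy Hf]]; have oD := phi_open x0 oU.
have Dy : (phi x0 @` (dom x0 `&` U)) (phi x0 y) by exists y.
have E l m : dd x0 l (dd x0 m f) y = partial l (partial m (f \o psi x0)) (phi x0 y).
  apply: (partial_open_eq _ oD Dy) => _ /set_mem [z [dz _] <-].
  by rewrite /dd /= phiK.
by rewrite !E (partial_schwarz _ _ oD (Hf x0) Dy).
Qed.

Lemma dd_coord x0 y i k : dom x0 y -> dd x0 i (coordfun x0 k) y = (k == i)%:R.
Proof.
move=> dy; have Dy : (phi x0 @` dom x0) (phi x0 y) by exists y.
have -> : dd x0 i (coordfun x0 k) y = partial i (fun t => (t 0 k)%:C) (phi x0 y).
  have oD : open (phi x0 @` dom x0) by exact: phi_dom_open.
  apply: (partial_open_eq _ oD Dy) => _ /set_mem [z dz <-].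
  by rewrite /coordfun /= phiK.
rewrite /partial (_ : Im_of _ = cst 0) // derive_cst.
have := derive_mx (@derivable_id R _ (phi x0 y) (delta_mx 0 i)).
rewrite derive_id => /matrixP/(_ 0 k); rewrite !mxE eqxx /= => <-.
by case: eqP.
Qed.

Lemma dd_chain x0 x1 y i f : dom x0 y -> dom x1 y -> sf y f ->
  dd x0 i f y = \sum_k dd x1 k f y * dd x0 i (coordfun x1 k) y.
Proof.
move=> d0 d1 [U [oU Uy Hf]].
have oD := phi_open x0 (openI oU (dom_open x1)).
have Dy : (phi x0 @` (dom x0 `&` (U `&` dom x1))) (phi x0 y) by exists y.
have E : dd x0 i f y = partial i ((f \o psi x1) \o (phi x1 \o psi x0)) (phi x0 y).
  apply: (partial_open_eq _ oD Dy) => _ /set_mem [z [dz [_ d1z]] <-].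
  by rewrite /= !phiK.
rewrite E (partial_comp i oD (phi_open x1 oU) _ (Hf x1) _ Dy).
- by rewrite /dd /= phiK.
- by move=> _ [z [dz [Uz d1z]] <-]; exists z => //=; rewrite phiK.
move=> k; apply: smooth_sub (transition_real x0 x1 k) => _ [z [dz [Uz d1z]] <-].
by exists z.
Qed.

End ManifoldFunctions.

(** * Vector fields *)

Section VectorFields.
Variables (R : realType) (n : nat) (M : manifold R n).
Local Notation C := (R[i]).
Implicit Types (f g : M -> C) (x y z : M) (U W : set M).

Lemma near_sym x (T : Type) (f g : M -> T) : {near x, f =1 g} -> {near x, g =1 f}.
Proof. by move=> H; apply: filterS H => z E; exact: esym E. Qed.

Lemma vec_actE y (v : 'rV[C]_n) f : vec_act y v f = \sum_i v 0 i * dd y i f y.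
Proof. by []. Qed.

Lemma vec_act_lin y a (u v : 'rV[C]_n) f :
  vec_act y (a *: u + v) f = a * vec_act y u f + vec_act y v f.
Proof.
rewrite /vec_act mulr_sumr -big_split /=; apply: eq_bigr => i _.
by rewrite !mxE mulrDl mulrA.
Qed.

Lemma vec_act_sum y (I : Type) (s : seq I) (P : pred I) (c : I -> C) (v : I -> 'rV[C]_n) f :
  vec_act y (\sum_(i <- s | P i) c i *: v i) f = \sum_(i <- s | P i) c i * vec_act y (v i) f.
Proof.
elim: s => [|i s IH].
  by rewrite !big_nil /vec_act big1 // => i _; rewrite mxE mul0r.
by rewrite !big_cons; case: ifP => // _; rewrite vec_act_lin IH.
Qed.

Lemma vec_act_near_eq y v f g : {near y, f =1 g} -> vec_act y v f = vec_act y v g.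
Proof.
move=> fg; apply: eq_bigr => i _; congr (_ * _).
by apply: dd_near_eq => //; exact: mem_dom.
Qed.

Lemma vec_act_cst y v (c : C) : vec_act y v (fun=> c) = 0.
Proof. by rewrite vec_actE big1 // => i _; rewrite dd_cst mulr0. Qed.

Lemma vec_act_add y v f g : sf y f -> sf y g ->
  vec_act y v (fun z => f z + g z) = vec_act y v f + vec_act y v g.
Proof.
move=> Hf Hg; rewrite !vec_actE -big_split; apply: eq_bigr => i _ /=.
by rewrite dd_add ?mulrDr //; exact: mem_dom.
Qed.

Lemma vec_act_mul y v f g : sf y f -> sf y g ->
  vec_act y v (fun z => f z * g z) = vec_act y v f * g y + f y * vec_act y v g.
Proof.
move=> Hf Hg; rewrite !vec_actE mulr_suml mulr_sumr -big_split; apply: eq_bigr => i _ /=.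
by rewrite dd_mul //; [ring|exact: mem_dom].
Qed.

Lemma vec_act_chart x0 y v f : dom x0 y -> sf y f ->
  vec_act y v f = \sum_i vec_act y v (coordfun x0 i) * dd x0 i f y.
Proof.
move=> d0 Hf; rewrite vec_actE.
under [RHS]eq_bigr do rewrite vec_actE mulr_suml.
rewrite exchange_big; apply: eq_bigr => k _ /=.
rewrite (dd_chain k (mem_dom y) d0 Hf) mulr_sumr; apply: eq_bigr => i _.
by ring.
Qed.

Lemma vec_act_coord y (v : 'rV[C]_n) i : vec_act y v (coordfun y i) = v 0 i.
Proof.
rewrite vec_actE (bigD1 i) //= dd_coord ?eqxx ?mulr1; last exact: mem_dom.
rewrite big1 ?addr0 // => k ki; rewrite dd_coord; last exact: mem_dom.
by rewrite eq_sym (negPf ki) mulr0.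
Qed.

Lemma vec_inj x0 y (u v : 'rV[C]_n) : dom x0 y ->
  (forall i, vec_act y u (coordfun x0 i) = vec_act y v (coordfun x0 i)) -> u = v.
Proof.
move=> d0 H; apply/rowP => i; rewrite -!(vec_act_coord y).
have Hc := @sf_coord _ _ M y y i (mem_dom y).
by rewrite !(vec_act_chart _ d0 Hc); apply: eq_bigr => k _; rewrite H.
Qed.

(** Smoothness near a point, for sections. *)
Definition sv (F : bundle M) x (s : sect F) := exists U, [/\ open U, U x & sm U s].

Lemma sv_nearP (F : bundle M) x (s : sect F) : sv x s -> \forall z \near x, sv z s.
Proof.
by move=> [U [oU Ux Hs]]; apply: filterS (open_nbhs_nbhs (conj oU Ux)) => z Uz; exists U.
Qed.

Lemma lie_near_eq (X : sect (TMC M)) f g y : {near y, f =1 g} -> lie X f y = lie X g y.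
Proof. exact: vec_act_near_eq. Qed.

Lemma lie_add (X : sect (TMC M)) f g y : sf y f -> sf y g ->
  lie X (fun z => f z + g z) y = lie X f y + lie X g y.
Proof. exact: vec_act_add. Qed.

Lemma lie_mul (X : sect (TMC M)) f g y : sf y f -> sf y g ->
  lie X (fun z => f z * g z) y = lie X f y * g y + f y * lie X g y.
Proof. exact: vec_act_mul. Qed.

Lemma near_near x (P : set M) : (\forall z \near x, P z) -> \forall z \near x, \near z, P z.
Proof.
move=> /nearP [U [oU Ux UP]]; apply: filterS (open_nbhs_nbhs (conj oU Ux)) => z Uz.
by apply: filterS UP _; exact: open_nbhs_nbhs.
Qed.

Lemma near_dom x0 y : dom x0 y -> \forall z \near y, dom x0 z.
Proof. by move=> d0; apply: open_nbhs_nbhs; split=> //; exact: dom_open. Qed.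

Lemma lie_chart_near (X : sect (TMC M)) x0 y f : dom x0 y -> sf y f ->
  {near y, lie X f =1 fun z => \sum_i lie X (coordfun x0 i) z * dd x0 i f z}.
Proof.
by move=> d0 Hf; apply: near2 (near_dom d0) (sf_near Hf) _ => z dz Hz; exact: vec_act_chart.
Qed.

Lemma svT_chart (X : sect (TMC M)) x0 y : dom x0 y ->
  sv y X <-> forall i, sf y (lie X (coordfun x0 i)).
Proof.
move=> d0; split.
  move=> [U [oU Uy HX]] i; exists (dom x0 `&` U); split=> //; last exact: HX.
  by apply: openI => //; exact: dom_open.
move=> H.
have : \forall z \near y, forall i, sf z (lie X (coordfun x0 i)).
  have H' i : \forall z \near y, sf z (lie X (coordfun x0 i)) by exact: sf_near.
  exact: filter_forall H'.
move=> /nearP [U [oU Uy HU]]; exists (U `&` dom x0); split=> //.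
  by apply: openI => //; exact: dom_open.
move=> x1 i; apply/smooth_funP.
  by apply: openI; [exact: dom_open|apply: openI => //; exact: dom_open].
move=> z [d1 [Uz dz]].
have Hc := @sf_coord _ _ M x1 z i d1.
apply: (@sf_ext _ _ _ _ (fun z => \sum_k lie X (coordfun x0 k) z * dd x0 k (coordfun x1 i) z)).
  exact: near_sym (lie_chart_near X dz Hc).
by apply: sf_sum => k _; apply: sf_mul; [exact: HU|exact: sf_dd].
Qed.

Lemma sf_lie (X : sect (TMC M)) f y : sv y X -> sf y f -> sf y (lie X f).
Proof.
move=> HX Hf; have d := mem_dom y.
apply: (@sf_ext _ _ _ _ (fun z => \sum_k lie X (coordfun y k) z * dd y k f z)).
  exact: near_sym (lie_chart_near X d Hf).
apply: sf_sum => k _; apply: sf_mul; last exact: sf_dd.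
by have /(svT_chart X d) := HX; exact.
Qed.

(** The coordinate vector fields of the chart around [x0]. *)
Definition dX x0 (i : 'I_n) : sect (TMC M) := fun y => \row_k dd x0 i (coordfun y k) y.

Lemma lie_dX x0 i y f : dom x0 y -> sf y f -> lie (dX x0 i) f y = dd x0 i f y.
Proof.
move=> d0 Hf; rewrite /lie vec_actE (dd_chain i d0 (mem_dom y) Hf).
by apply: eq_bigr => k _; rewrite mxE mulrC.
Qed.

Lemma sv_dX x0 i y : dom x0 y -> sv y (dX x0 i).
Proof.
move=> d0; apply/(svT_chart _ d0) => k.
apply: (@sf_ext _ _ _ _ (dd x0 i (coordfun x0 k))).
  by apply: filterS (near_dom d0) => z dz; rewrite lie_dX //; exact: sf_coord.
by apply: sf_dd => //; exact: sf_coord.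
Qed.

(** In a chart the second order parts of [X (Y f)] and [Y (X f)] agree because
    coordinate derivatives commute. *)
Lemma lie_bracket (X Y : sect (TMC M)) f y : sv y X -> sv y Y -> sf y f ->
  lie (bracket X Y) f y = lie X (lie Y f) y - lie Y (lie X f) y.
Proof.
move=> HX HY Hf; have d := mem_dom y.
have cX k : sf y (lie X (coordfun y k)) by apply: sf_lie => //; exact: sf_coord.
have cY k : sf y (lie Y (coordfun y k)) by apply: sf_lie => //; exact: sf_coord.
have Hd k : sf y (dd y k f) by exact: sf_dd.
have expand (A B : sect (TMC M)) : sv y A -> (forall k, sf y (lie B (coordfun y k))) ->
    lie A (lie B f) y = \sum_k (lie A (lie B (coordfun y k)) y * dd y k f y +
     \sum_l lie B (coordfun y k) y * lie A (coordfun y l) y * dd y l (dd y k f) y).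
  move=> HA HB; rewrite (lie_near_eq A (lie_chart_near B d Hf)).
  have -> : lie A (fun z => \sum_i lie B (coordfun y i) z * dd y i f z) y =
     \sum_i lie A (fun z => lie B (coordfun y i) z * dd y i f z) y.
    elim: (index_enum _) => [|k s IH].
      rewrite big_nil; apply: etrans (vec_act_cst y (A y) 0).
      by apply: lie_near_eq; apply: nearW => z; rewrite big_nil.
    rewrite big_cons -IH.
    have E : {near y, (fun z => \sum_(i <- k :: s) lie B (coordfun y i) z * dd y i f z)
       =1 (fun z => lie B (coordfun y k) z * dd y k f z +
              \sum_(i <- s) lie B (coordfun y i) z * dd y i f z)}.
      by apply: nearW => z; rewrite big_cons.
    rewrite (lie_near_eq A E); apply: vec_act_add; first exact: sf_mul.
    by apply: sf_sum => i _; exact: sf_mul.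
  apply: eq_bigr => k _; rewrite lie_mul //; congr (_ + _).
  rewrite [lie A (dd y k f) y](vec_act_chart (A y) d (Hd k)) mulr_sumr; apply: eq_bigr => l _.
  by rewrite mulrA.
rewrite !expand // -sumrB /lie vec_actE.
have -> : \sum_k (vec_act y (X y) (lie Y (coordfun y k)) * dd y k f y +
     \sum_l lie Y (coordfun y k) y * lie X (coordfun y l) y * dd y l (dd y k f) y -
    (vec_act y (Y y) (lie X (coordfun y k)) * dd y k f y +
     \sum_l lie X (coordfun y k) y * lie Y (coordfun y l) y * dd y l (dd y k f) y)) =
  \sum_k (bracket X Y y) 0 k * dd y k f y +
  (\sum_k \sum_l lie Y (coordfun y k) y * lie X (coordfun y l) y * dd y l (dd y k f) y -
   \sum_k \sum_l lie X (coordfun y k) y * lie Y (coordfun y l) y * dd y l (dd y k f) y).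
  rewrite -sumrB -big_split; apply: eq_bigr => k _ /=; rewrite mxE /lie.
  by move: (\sum_l _) (\sum_l _) => a b; ring.
rewrite [X in _ - X]exchange_big /= -sumrB [X in _ + X]big1 ?addr0 // => k _.
rewrite -sumrB big1 // => l _; rewrite (dd_comm l k) //.
by rewrite [lie Y _ _ * _]mulrC subrr.
Qed.

End VectorFields.

Section SmoothMatrices.
Variables (R : realType) (n : nat) (M : manifold R n).
Local Notation C := (R[i]).
Implicit Types (x y z : M).

Lemma sf_det y m (A : M -> 'M[C]_m) : (forall i j, sf y (fun z => A z i j)) ->
  sf y (fun z => \det (A z)).
Proof.
move=> HA; rewrite /determinant; apply: sf_sum => s _; apply: sf_mul; first exact: sf_cst.
by apply: sf_prod => i _.
Qed.

(** By the formula with cofactors. *)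
Lemma sf_invmx y m (A : M -> 'M[C]_m) : (forall i j, sf y (fun z => A z i j)) ->
  A y \in unitmx -> forall i j, sf y (fun z => invmx (A z) i j).
Proof.
move=> HA uA i j; have Hd := sf_det HA.
have d0 : \det (A y) != 0 by rewrite -unitfE -unitmxE.
apply: (@sf_ext _ _ _ _ (fun z => (\det (A z))^-1 * cofactor (A z) j i)).
  apply: filterS (sf_neq0 Hd d0) => z dz.
  by rewrite /invmx unitmxE unitfE dz !mxE.
apply: sf_mul; first exact: sf_inv.
apply: sf_mul; first exact: sf_cst.
by apply: sf_det => k l; apply: sf_ext (HA (lift j k) (lift i l)); apply: nearW => z; rewrite !mxE.
Qed.

Lemma unitmx_near y m (A : M -> 'M[C]_m) : (forall i j, sf y (fun z => A z i j)) ->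
  A y \in unitmx -> \forall z \near y, A z \in unitmx.
Proof.
move=> HA; rewrite unitmxE unitfE => d0.
by apply: filterS (sf_neq0 (sf_det HA) d0) => z; rewrite unitmxE unitfE.
Qed.

End SmoothMatrices.

(** * Frames and connections *)

Section Bundles.
Variables (R : realType) (n : nat) (M : manifold R n).
Local Notation C := (R[i]).
Implicit Types (f g : M -> C) (x y z : M) (U W : set M).

(** The smooth sections form a sheaf. *)
Definition localb (F : bundle M) :=
  (forall U W (s : sect F), open W -> W `<=` U -> sm U s -> sm W s) /\
  (forall U (s : sect F), open U -> (forall x, U x -> sv x s) -> sm U s).

Lemma sv_open (F : bundle M) U (s : sect F) x : open U -> sm U s -> U x -> sv x s.
Proof. by move=> oU Hs Ux; exists U. Qed.

Lemma localb_vbundle (E : vbundle M) : localb E.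
Proof.
split=> [U W s _ WU Hs x0 j|U s oU H x0 j].
  by apply: smooth_fun_sub (Hs x0 j) => z [? ?]; split=> //; exact: WU.
apply/smooth_funP; first by apply: openI => //; exact: tdom_open.
move=> z [tz Uz]; have [W [oW Wz Hs]] := H z Uz.
exists (tdom E x0 `&` W); split=> //.
by apply: openI => //; exact: tdom_open.
Qed.

Lemma localb_TMC : localb (TMC M).
Proof.
split=> [U W s _ WU Hs x0 j|U s oU H x0 j].
  by apply: smooth_fun_sub (Hs x0 j) => z [? ?]; split=> //; exact: WU.
apply/smooth_funP; first by apply: openI => //; exact: dom_open.
move=> z [tz Uz]; have [W [oW Wz Hs]] := H z Uz.
exists (dom x0 `&` W); split=> //.
by apply: openI => //; exact: dom_open.
Qed.

Lemma localb_trivial : localb (trivial_line M).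
Proof.
split=> [U W s _ WU Hs|U s oU H]; first exact: smooth_fun_sub WU Hs.
by apply/smooth_funP => // x /H [W [oW Wx Hs]]; exists W.
Qed.

Lemma localb_sub (F : bundle M) (V : forall x, {vspace F x}) : localb F ->
  localb (sub_bundle V).
Proof.
move=> [H1 H2]; split=> [U W s oW WU Hs|U s oU H]; first exact: H1 oW WU Hs.
by apply: H2 => // x /H [W [oW Wx Hs]]; exists W.
Qed.

Lemma sv_sub (F : bundle M) (V : forall x, {vspace F x}) x (s : sect (sub_bundle V)) :
  sv x s <-> sv x (fun y => vsval (s y) : F y).
Proof. by []. Qed.

Lemma smooth_homP (F F' : bundle M) U (A : forall x, 'Hom(F x, F' x)) :
  localb F -> localb F' -> open U ->
  smooth_hom U A <-> forall y (s : sect F), U y -> sv y s -> sv y (fun x => A x (s x) : F' x).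
Proof.
move=> lF lF' oU; split=> [H y s Uy [V [oV Vy Hs]]|H V s oV VU Hs].
  exists (V `&` U); split=> //; first exact: openI.
  apply: H; [exact: openI|exact: subIsetr|].
  exact: (lF.1 _ _ _ (openI oV oU) (@subIsetl _ V U) Hs).
by apply: lF'.2 => // y Vy; apply: H; [exact: VU|exists V].
Qed.

Section VBundle.
Variable E : vbundle M.

Lemma frame_expand x0 y (v : E y) : tdom E x0 y ->
  v = \sum_j coord (frame E x0 y) j v *: tnth (frame E x0 y) j.
Proof.
move=> ty; have := frame_basis ty; move=> /andP [/eqP span_eq _].
have := @coord_span _ _ _ (frame E x0 y) v; rewrite span_eq memvf => /(_ isT) {1}->.
by apply: eq_bigr => j _; rewrite (tnth_nth 0).
Qed.

Definition fr x0 (j : 'I_(rk E x0)) : sect E := fun y => tnth (frame E x0 y) j.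

Lemma near_tdom x0 y : tdom E x0 y -> \forall z \near y, tdom E x0 z.
Proof. by move=> d0; apply: open_nbhs_nbhs; split=> //; exact: tdom_open. Qed.

(** Changes of frame are smooth, hence one trivialization is enough to test
    smoothness. *)
Lemma svE_chart x0 y (s : sect E) : tdom E x0 y ->
  sv y s <-> forall j, sf y (fun z => coord (frame E x0 z) j (s z)).
Proof.
move=> t0; split.
  move=> [U [oU Uy Hs]] j; exists (tdom E x0 `&` U); split=> //.
  by apply: openI => //; exact: tdom_open.
move=> H.
have : \forall z \near y, forall j, sf z (fun z => coord (frame E x0 z) j (s z)).
  have H' j : \forall z \near y, sf z (fun z => coord (frame E x0 z) j (s z)) by exact: sf_near.
  exact: filter_forall H'.
move=> /nearP [U [oU Uy HU]]; exists (U `&` tdom E x0); split=> //.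
  by apply: openI => //; exact: tdom_open.
move=> x1 i; apply/smooth_funP.
  by apply: openI; [exact: tdom_open|apply: openI => //; exact: tdom_open].
move=> z [t1 [Uz tz]].
apply: (@sf_ext _ _ _ _ (fun z => \sum_j coord (frame E x0 z) j (s z) *
    coord (frame E x1 z) i (tnth (frame E x0 z) j))).
  apply: filterS (near_tdom tz) => w tw /=.
  rewrite [in RHS](frame_expand (s w) tw) linear_sum /=.
  by apply: eq_bigr => j _; rewrite linearZ.
apply: sf_sum => j _; apply: sf_mul; first exact: HU.
exists (tdom E x0 `&` tdom E x1); split=> //; last exact: frame_smooth.
by apply: openI; exact: tdom_open.
Qed.

Lemma svE_lin y c (s t : sect E) : sf y c -> sv y s -> sv y t ->
  sv y (fun z => c z *: s z + t z : E z).
Proof.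
move=> Hc /(svE_chart _ (mem_tdom E y)) Hs /(svE_chart _ (mem_tdom E y)) Ht.
apply/(svE_chart _ (mem_tdom E y)) => j.
apply: (@sf_ext _ _ _ _ (fun z => c z * coord (frame E y z) j (s z) + coord (frame E y z) j (t z))).
  by apply: nearW => z; rewrite linearP.
by apply: sf_add => //; exact: sf_mul.
Qed.

Lemma svE_near_eq y (s t : sect E) : (\forall z \near y, s z = t z) -> sv y s -> sv y t.
Proof.
move=> st /(svE_chart _ (mem_tdom E y)) Hs; apply/(svE_chart _ (mem_tdom E y)) => j.
by apply: sf_ext (Hs j); apply: filterS st => z ->.
Qed.

Lemma svE_0 y : sv y (fun z => 0 : E z).
Proof.
apply/(svE_chart _ (mem_tdom E y)) => j.
by apply: sf_ext (sf_cst y 0); apply: nearW => z; rewrite linear0.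
Qed.

Lemma svE_scale y c (s : sect E) : sf y c -> sv y s -> sv y (fun z => c z *: s z : E z).
Proof.
move=> Hc Hs; apply: svE_near_eq (svE_lin Hc Hs (svE_0 y)).
by apply: nearW => z; rewrite addr0.
Qed.

Lemma svE_add y (s t : sect E) : sv y s -> sv y t -> sv y (fun z => s z + t z : E z).
Proof.
move=> Hs Ht; apply: svE_near_eq (svE_lin (sf_cst y 1) Hs Ht).
by apply: nearW => z; rewrite scale1r.
Qed.

Lemma svE_opp y (s : sect E) : sv y s -> sv y (fun z => - s z : E z).
Proof.
move=> Hs; apply: svE_near_eq (svE_scale (sf_cst y (-1)) Hs).
by apply: nearW => z; rewrite scaleN1r.
Qed.

Lemma svE_sum y (I : Type) (r : seq I) (P : pred I) (s : I -> sect E) :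
  (forall i, P i -> sv y (s i)) -> sv y (fun z => \sum_(i <- r | P i) s i z : E z).
Proof.
move=> H; elim: r => [|i r IH].
  by apply: svE_near_eq (svE_0 y); apply: nearW => z; rewrite big_nil.
case Pi: (P i); last by apply: svE_near_eq IH; apply: nearW => z; rewrite big_cons Pi.
apply: svE_near_eq (svE_add (H i Pi) IH).
by apply: nearW => z; rewrite big_cons Pi.
Qed.

Lemma sv_fr x0 j y : tdom E x0 y -> sv y (@fr x0 j).
Proof.
move=> t0; apply/(svE_chart _ t0) => k.
apply: (@sf_ext _ _ _ _ (fun=> (k == j)%:R)); last exact: sf_cst.
apply: filterS (near_tdom t0) => z tz; have /andP [_ fz] := frame_basis tz.
by rewrite /fr (tnth_nth 0) coord_free // eq_sym.
Qed.

End VBundle.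

Section Frames.
Variables (F : bundle M) (m : nat) (e : 'I_m -> sect F).

Definition frtup z : m.-tuple (F z) := [tuple e k z | k < m].

(** The components of a section in a local frame, as functions on the base. *)
Definition cfr (k : 'I_m) (s : sect F) : M -> C := fun z => coord (frtup z) k (s z).

Lemma frtupE z (k : 'I_m) : (frtup z)`_k = e k z.
Proof. by rewrite -(tnth_nth 0) tnth_mktuple. Qed.

Lemma coord_expand z (v : F z) : basis_of fullv (frtup z) ->
  v = \sum_k coord (frtup z) k v *: e k z.
Proof.
move=> /andP [/eqP span_eq _].
have := @coord_span _ _ _ (frtup z) v; rewrite span_eq memvf => /(_ isT) {1}->.
by apply: eq_bigr => j _; rewrite frtupE.
Qed.

Lemma cfr_expand z (s : sect F) : basis_of fullv (frtup z) -> s z = \sum_k cfr k s z *: e k z.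
Proof. exact: coord_expand. Qed.

Lemma cfr_eq z (c : 'I_m -> C) (k : 'I_m) : basis_of fullv (frtup z) ->
  coord (frtup z) k (\sum_k c k *: e k z) = c k.
Proof.
move=> /andP [_ fz].
have -> : \sum_k c k *: e k z = \sum_(k < m) c k *: (frtup z)`_k.
  by apply: eq_bigr => l _; rewrite frtupE.
by rewrite coord_sum_free.
Qed.

(** The numbers [theta i] are linear coordinates that detect smoothness; in these
    coordinates the frame has an invertible smooth matrix, and the components are
    obtained by applying the inverse matrix. *)
Lemma sf_cfr y (theta : 'I_m -> forall z, F z -> C) (k : 'I_m) (s : sect F) :
  (forall i (t : sect F), sv y t -> sf y (fun z => theta i z (t z))) ->
  (\forall z \near y, (forall i a u v, theta i z (a *: u + v) = a * theta i z u + theta i z v) /\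
     (forall v, (forall i, theta i z v = 0) -> v = 0)) ->
  (forall k, sv y (e k)) -> (\forall z \near y, basis_of fullv (frtup z)) ->
  sv y s -> sf y (cfr k s).
Proof.
move=> th_sf th_lin e_sm e_bas s_sm.
pose H z : 'M[C]_m := \matrix_(k, i) theta i z (e k z).
pose a z : 'rV[C]_m := \row_i theta i z (s z).
have th_sum z i (c : 'I_m -> C) (u : 'I_m -> F z) :
    (forall i a u v, theta i z (a *: u + v) = a * theta i z u + theta i z v) ->
    theta i z (\sum_k c k *: u k) = \sum_k c k * theta i z (u k).
  move=> L; have L0 : theta i z 0 = 0.
    by have := L i 1 0 0; rewrite scale1r addr0 mul1r => /eqP; rewrite addrC -subr_eq subrr => /eqP.
  elim: (index_enum _) => [|l r IH]; first by rewrite !big_nil.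
  by rewrite !big_cons L IH.
have unitH : \forall z \near y, H z \in unitmx.
  apply: near2 th_lin e_bas _ => z [L I] bz; rewrite -row_free_unit.
  apply/row_freeP; apply: contrapT => nE.
  have : ~~ row_free (H z) by apply/negP => /row_freeP.
  rewrite -kermx_eq0 => /rowV0Pn [w /sub_kermxP wH /negP []].
  have : \sum_k w 0 k *: e k z = 0.
    apply: I => i; rewrite th_sum //.
    by move/rowP: wH => /(_ i); rewrite !mxE => E0; rewrite -[RHS]E0; apply: eq_bigr => l _; rewrite mxE.
  move=> E0; apply/eqP/rowP => l; rewrite mxE -(cfr_eq (w 0) l bz) E0.
  by rewrite linear0.
have HE z : basis_of fullv (frtup z) ->
    (forall i a u v, theta i z (a *: u + v) = a * theta i z u + theta i z v) ->
    a z = (\row_k cfr k s z) *m H z.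
  move=> bz L; apply/rowP => i; rewrite !mxE {1}(cfr_expand s bz) th_sum //.
  by apply: eq_bigr => l _; rewrite !mxE.
have Hsm i j : sf y (fun z => H z i j).
  by apply: sf_ext (th_sf j _ (e_sm i)); apply: nearW => z; rewrite mxE.
have := unitH => /nbhs_singleton uy.
apply: (@sf_ext _ _ _ _ (fun z => \sum_i a z 0 i * invmx (H z) i k)); last first.
  apply: sf_sum => i _; apply: sf_mul; last exact: sf_invmx.
  by apply: sf_ext (th_sf i _ s_sm); apply: nearW => z; rewrite mxE.
apply: near2 (filterI unitH e_bas) th_lin _ => z [uz bz] [L _].
have := congr1 (mulmx^~ (invmx (H z))) (HE z bz L); rewrite mulmxK //.
by move=> /rowP /(_ k); rewrite !mxE.
Qed.

End Frames.

Lemma size_frtup (E : vbundle M) y m (e : 'I_m -> sect E) :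
  basis_of fullv (frtup e y) -> m = rk E y.
Proof.
move=> b; rewrite -(vector.size_basis b).
by rewrite -(vector.size_basis (frame_basis (mem_tdom E y))).
Qed.

Lemma sf_cfrE (E : vbundle M) y m (e : 'I_m -> sect E) k s :
  (forall k, sv y (e k)) -> (\forall z \near y, basis_of fullv (frtup e z)) ->
  sv y s -> sf y (cfr e k s).
Proof.
move=> He Hb Hs; have Em := size_frtup (nbhs_singleton Hb).
move: e k He Hb; rewrite {}Em => e k He Hb.
apply: (@sf_cfr E (rk E y) e y (fun i z v => coord (frame E y z) i v) k s) => //.
  by move=> i t /(svE_chart _ (mem_tdom E y)); exact.
apply: filterS (near_tdom (mem_tdom E y)) => z tz; split.
  by move=> i a u v; rewrite linearP.
move=> v Hv; rewrite (frame_expand v tz) big1 // => i _.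
by rewrite Hv scale0r.
Qed.

Lemma sf_cfrT y (e : 'I_n -> sect (TMC M)) k s :
  (forall k, sv y (e k)) -> (\forall z \near y, basis_of fullv (frtup e z)) ->
  sv y s -> sf y (cfr e k s).
Proof.
move=> He Hb Hs.
apply: (@sf_cfr (TMC M) n e y (fun i z v => vec_act z v (coordfun y i)) k s) => //.
  by move=> i t /(svT_chart _ (mem_dom y)); exact.
apply: filterS (near_dom (mem_dom y)) => z dz; split.
  by move=> i a u v; rewrite vec_act_lin.
move=> v Hv; apply: (vec_inj dz) => i; rewrite Hv.
by rewrite /vec_act big1 // => k' _; rewrite mxE mul0r.
Qed.

Section Connections.
Variables (F : bundle M) (a : forall x, F x -> TMC M x) (E : vbundle M).
Variable D : sect E -> forall x, 'Hom(F x, E x).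
Hypotheses (lF : localb F) (hD : is_connection a D).

Lemma sv_two y (s t : sect E) : sv y s -> sv y t ->
  exists U, [/\ open U, U y, sm U s & sm U t].
Proof.
move=> [U [oU Uy Hs]] [W [oW Wy Ht]]; exists (U `&` W); split=> //; first exact: openI.
  exact: ((localb_vbundle E).1 _ _ _ (openI oU oW) (@subIsetl _ U W) Hs).
exact: ((localb_vbundle E).1 _ _ _ (openI oU oW) (@subIsetr _ U W) Ht).
Qed.

Lemma conn_smooth y (s : sect E) (Z : sect F) : sv y s -> sv y Z ->
  sv y (fun z => D s z (Z z) : E z).
Proof.
case: hD => H1 _ _ _ [U [oU Uy Hs]] HZ.
by have /(smooth_homP _ lF (localb_vbundle E) oU) := H1 U s oU Hs; exact.
Qed.

Lemma conn_near_eq y (s t : sect E) : sv y s -> sv y t -> (\forall z \near y, s z = t z) ->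
  D s y = D t y.
Proof.
case: hD => _ H2 _ _ Hs Ht /nearP [W [oW Wy st]].
have [U [oU Uy sU tU]] := sv_two Hs Ht.
have oUW := openI oU oW.
apply: (H2 (U `&` W)) => //.
- exact: ((localb_vbundle E).1 _ _ _ (openI oU oW) (@subIsetl _ U W) sU).
- exact: ((localb_vbundle E).1 _ _ _ (openI oU oW) (@subIsetl _ U W) tU).
by move=> x [_ /st].
Qed.

Lemma conn_add y (s t : sect E) : sv y s -> sv y t ->
  D (fun z => s z + t z : E z) y = D s y + D t y.
Proof.
case: hD => _ _ H3 _ Hs Ht; have [U [oU Uy sU tU]] := sv_two Hs Ht.
exact: (H3 U).
Qed.

Lemma conn_scale y f (s : sect E) v : sf y f -> sv y s ->
  D (fun z => f z *: s z : E z) y v = vec_act y (a v) f *: s y + f y *: D s y v.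
Proof.
case: hD => _ _ _ H4 [U [oU Uy fU]] [W [oW Wy sW]].
apply: (H4 (U `&` W)) => //; first exact: openI.
  exact: (smooth_fun_sub (@subIsetl _ U W) fU).
exact: ((localb_vbundle E).1 _ _ _ (openI oU oW) (@subIsetr _ U W) sW).
Qed.

Lemma conn_sum y (I : Type) (r : seq I) (s : I -> sect E) v : (forall i, sv y (s i)) ->
  D (fun z => \sum_(i <- r) s i z : E z) y v = \sum_(i <- r) D (s i) y v.
Proof.
move=> H; elim: r => [|i r IH].
  rewrite big_nil.
  have E0 : \forall z \near y, (\sum_(i <- [::]) s i z : E z) = 0 *: (0 : E z).
    by apply: nearW => z; rewrite big_nil scale0r.
  have S0 := svE_scale (sf_cst y 0) (svE_0 E y).
  rewrite (conn_near_eq _ _ E0) //; last first.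
    by apply: svE_near_eq S0; apply: nearW => z; rewrite big_nil scaler0.
  rewrite conn_scale; [|exact: sf_cst|exact: svE_0].
  by rewrite vec_act_cst !scale0r addr0.
have E1 : \forall z \near y, (\sum_(i <- i :: r) s i z : E z) = s i z + \sum_(i <- r) s i z.
  by apply: nearW => z; rewrite big_cons.
have S1 : sv y (fun z => \sum_(i <- r) s i z : E z) by exact: svE_sum.
rewrite (conn_near_eq _ _ E1) //; last 2 first.
- by apply: svE_sum.
- exact: svE_add.
by rewrite conn_add // lfunE /= IH big_cons.
Qed.

End Connections.

End Bundles.

(** * Iterated derivatives along a frame *)

Section Systems.
Variables (R : realType) (n : nat) (M : manifold R n).
Local Notation C := (R[i]).
Implicit Types (f g : M -> C) (x y z : M).

Lemma sv_bracket (X Y : sect (TMC M)) y : sv y X -> sv y Y -> sv y (bracket X Y).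
Proof.
move=> HX HY; apply/(svT_chart _ (mem_dom y)) => k.
apply: (@sf_ext _ _ _ _ (fun z => lie X (lie Y (coordfun y k)) z - lie Y (lie X (coordfun y k)) z)).
  apply: near2 (filterI (sv_nearP HX) (sv_nearP HY)) (near_dom (mem_dom y)) _ => z [Xz Yz] dz.
  by rewrite lie_bracket //; exact: sf_coord.
have Hc := @sf_coord _ _ M y y k (mem_dom y).
by apply: sf_add; [|apply: sf_opp]; apply: sf_lie => //; exact: sf_lie.
Qed.

Variable E : vbundle M.

Definition leo : rel 'I_n := fun i j => (i <= j)%N.
Lemma leo_total : total leo. Proof. by move=> i j; exact: leq_total. Qed.
Lemma leo_trans : transitive leo. Proof. by move=> j i k; exact: leq_trans. Qed.
Lemma leo_anti : antisymmetric leo.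
Proof. by move=> i j /anti_leq /val_inj. Qed.

Definition op := sect E -> M -> C.

(** Data near a point for comparing derivatives of sections: a frame [X] of the
    complexified tangent bundle over [W], the last fields of which (those selected
    by [isY]) span an involutive distribution, and a frame [e] of [E]. *)
Record system (W : set M) (X : 'I_n -> sect (TMC M)) (isY : pred 'I_n) (K : nat)
    (e : 'I_K -> sect E) : Prop := System {
  sys_open : open W;
  sys_X : forall i y, W y -> sv y (X i);
  sys_Xb : forall y, W y -> basis_of fullv (frtup X y);
  sys_inv : forall i j y k, isY i -> isY j -> W y -> ~~ isY k ->
    cfr X k (bracket (X i) (X j)) y = 0;
  sys_up : forall i k : 'I_n, isY i -> (i <= k)%N -> isY k;
  sys_e : forall k y, W y -> sv y (e k);
  sys_eb : forall y, W y -> basis_of fullv (frtup e y) }.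

Section Span.
Variable W : set M.
Hypothesis oW : open W.
Implicit Types (B : op -> Prop) (t : op).

(** Smooth combinations, over [W], of the operators in [B], up to equality on
    smooth sections. *)
Inductive span B : op -> Prop :=
| span0 : span B (fun _ _ => 0)
| span_in t : B t -> span B t
| spanD t t' : span B t -> span B t' -> span B (fun s y => t s y + t' s y)
| spanZ c t : (forall y, W y -> sf y c) -> span B t -> span B (fun s y => c y * t s y)
| span_ext t t' : span B t -> (forall s y, W y -> sv y s -> t s y = t' s y) -> span B t'.

Definition smoothing t := forall s y, W y -> sv y s -> sf y (t s).
Definition oplin t := forall s s' c y, W y -> sv y s -> sv y s' ->
  t (fun z => c *: s z + s' z : E z) y = c * t s y + t s' y.

Lemma near_W y : W y -> \forall z \near y, W z.
Proof. by move=> Wy; exact: open_nbhs_nbhs. Qed.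

Lemma span_sum B (I : Type) (r : seq I) (t : I -> op) :
  (forall i, span B (t i)) -> span B (fun s y => \sum_(i <- r) t i s y).
Proof.
move=> H; elim: r => [|i r IH].
  by apply: span_ext (span0 B) _ => s y _ _; rewrite big_nil.
by apply: span_ext (spanD (H i) IH) _ => s y _ _; rewrite big_cons.
Qed.

Lemma span_smoothing B t : (forall b, B b -> smoothing b) -> span B t -> smoothing t.
Proof.
move=> HB; elim=> {t} [|t /HB //|t t' _ IH _ IH'|c t Hc _ IH|t t' _ IH tt'] s y Wy Hs.
- exact: sf_cst.
- by apply: sf_add; [exact: IH|exact: IH'].
- by apply: sf_mul; [exact: Hc|exact: IH].
- apply: sf_ext (IH s y Wy Hs).
  by apply: near2 (near_W Wy) (sv_nearP Hs) _ => z Wz Hz; exact: tt'.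
Qed.

Lemma span_lin B t : (forall b, B b -> oplin b) -> span B t -> oplin t.
Proof.
move=> HB; elim=> {t} [|t /HB //|t t' _ IH _ IH'|c t Hc _ IH|t t' _ IH tt'] s s' a y Wy Hs Hs'.
- by rewrite mulr0 addr0.
- by rewrite IH // IH' //; ring.
- by rewrite IH //; ring.
- rewrite -!tt' //; first exact: IH.
  exact: svE_lin (sf_cst _ _) Hs Hs'.
Qed.

Lemma span_zero B t s y : W y -> sv y s -> (forall b, B b -> b s y = 0) -> span B t -> t s y = 0.
Proof.
move=> Wy Hs HB; elim=> {t} [//|t /HB //|t t' _ -> _ ->|c t _ _ ->|t t' _ IH tt'].
- by rewrite addr0.
- by rewrite mulr0.
- by rewrite -tt'.
Qed.

Lemma span_trans B B' t : (forall b, B b -> span B' b) -> span B t -> span B' t.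
Proof.
move=> HB; elim=> {t} [|t /HB //|t t' _ IH _ IH'|c t Hc _ IH|t t' _ IH tt'].
- exact: span0.
- exact: spanD.
- exact: spanZ.
- exact: span_ext IH tt'.
Qed.

Lemma span_mono B B' t : (forall b, B b -> B' b) -> span B t -> span B' t.
Proof. by move=> H; apply: span_trans => b /H; exact: span_in. Qed.

Lemma span_opp B t : span B t -> span B (fun s y => - t s y).
Proof.
move=> H; have := spanZ (c := fun=> -1) (fun y _ => sf_cst y _) H.
by move=> /span_ext; apply => s y _ _; rewrite mulN1r.
Qed.

Lemma span_lie B B' (V : sect (TMC M)) t : (forall y, W y -> sv y V) ->
  (forall b, B b -> smoothing b) -> (forall b, B b -> span B' b) ->
  (forall b, B b -> span B' (fun s y => lie V (b s) y)) ->
  span B t -> span B' (fun s y => lie V (t s) y).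
Proof.
move=> HV Bs BB' HB; elim=> {t} [|t /HB //|t t' St IH St' IH'|c t Hc St IH|t t' St IH tt'].
- by apply: span_ext (span0 _) _ => s y _ _; rewrite /lie vec_act_cst.
- apply: span_ext (spanD IH IH') _ => s y Wy Hs.
  by rewrite lie_add //; [exact: (span_smoothing Bs St)|exact: (span_smoothing Bs St')].
- have Hc' y : W y -> sf y (lie V c) by move=> Wy; apply: sf_lie; [exact: HV|exact: Hc].
  have S1 := spanZ Hc' (span_trans BB' St); have S2 := spanZ Hc IH.
  apply: span_ext (spanD S1 S2) _ => s y Wy Hs.
  by rewrite lie_mul //; [exact: Hc|exact: (span_smoothing Bs St)].
- apply: span_ext IH _ => s y Wy Hs; apply: lie_near_eq.
  by apply: near2 (near_W Wy) (sv_nearP Hs) _ => z Wz Hz; exact: tt'.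
Qed.

End Span.

Section Words.
Variables (W : set M) (X : 'I_n -> sect (TMC M)) (isY : pred 'I_n) (K : nat).
Variable e : 'I_K -> sect E.
Hypothesis S : system W X isY e.

Local Notation oW := (sys_open S).

Definition Xw (w : seq 'I_n) f : M -> C := foldr (fun i g => lie (X i) g) f w.

(** The iterated derivative, along the word [w] in the fields of the frame, of the
    component of index [k] of a section. *)
Definition xs w k : op := fun s => Xw w (cfr e k s).

Lemma sf_Xw w f y : W y -> sf y f -> sf y (Xw w f).
Proof. by move=> Wy Hf; elim: w => //= i w IH; apply: sf_lie => //; exact: (sys_X S). Qed.

Lemma sys_Xb_near y : W y -> \forall z \near y, basis_of fullv (frtup X z).
Proof. by move=> Wy; apply: filterS (near_W oW Wy) => z; exact: (sys_Xb S). Qed.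

Lemma sys_eb_near y : W y -> \forall z \near y, basis_of fullv (frtup e z).
Proof. by move=> Wy; apply: filterS (near_W oW Wy) => z; exact: (sys_eb S). Qed.

Lemma sf_cfr_sys k s y : W y -> sv y s -> sf y (cfr e k s).
Proof.
move=> Wy; apply: sf_cfrE; last exact: sys_eb_near.
by move=> l; exact: (sys_e S).
Qed.

Lemma sf_cfrX k V y : W y -> sv y V -> sf y (cfr X k V).
Proof.
move=> Wy; apply: sf_cfrT; last exact: sys_Xb_near.
by move=> l; exact: (sys_X S).
Qed.

Lemma smoothing_xs w k : smoothing W (xs w k).
Proof. by move=> s y Wy Hs; apply: sf_Xw => //; exact: sf_cfr_sys. Qed.

Lemma lie_expand V f y : W y -> lie V f y = \sum_k cfr X k V y * lie (X k) f y.
Proof. by move=> Wy; rewrite /lie [in LHS](cfr_expand V (sys_Xb S Wy)) vec_act_sum. Qed.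

Lemma oplin_xs w k : oplin W (xs w k).
Proof.
elim: w => [|i w IH] s s' c y Wy Hs Hs'; first by rewrite /xs /= /cfr linearP.
rewrite /xs /= -/(xs w k s) -/(xs w k s').
have E1 : {near y, Xw w (cfr e k (fun z => c *: s z + s' z)) =1
   (fun z => c * xs w k s z + xs w k s' z)}.
  apply: near2 (near_W oW Wy) (filterI (sv_nearP Hs) (sv_nearP Hs')) _ => z Wz [sz sz'].
  exact: IH.
rewrite (lie_near_eq _ E1) lie_add //; last 2 first.
- by apply: sf_mul; [exact: sf_cst|exact: smoothing_xs].
- exact: smoothing_xs.
rewrite lie_mul //; [|exact: sf_cst|exact: smoothing_xs].
by rewrite {1}/lie vec_act_cst mul0r add0r.
Qed.

(** The field that is applied first, at the end of the word, belongs to the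
    distribution. *)
Definition endsY (w : seq 'I_n) := if w is i :: w' then isY (last i w') else false.

(** Iterated derivatives along sorted words shorter than [m]; when [b] is set, only
    those along words with a field of the distribution. Since these fields come
    last in the frame, a sorted word has one exactly when it ends with one. *)
Definition Bs (m : nat) (b : bool) : op -> Prop := fun t => exists w k,
  [/\ t = xs w k, sorted leo w, (size w < m)%N & b ==> has isY w].

Lemma Bs_le m m' b t : (m <= m')%N -> Bs m b t -> Bs m' b t.
Proof. by move=> mm' [w [k [-> s1 s2 s3]]]; exists w, k; split=> //; exact: leq_trans s2 mm'. Qed.

Lemma smoothing_Bs m b t : Bs m b t -> smoothing W t.
Proof. by move=> [w [k [-> _ _ _]]]; exact: smoothing_xs. Qed.

Lemma oplin_Bs m b t : Bs m b t -> oplin W t.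
Proof. by move=> [w [k [-> _ _ _]]]; exact: oplin_xs. Qed.

Lemma endsY_has w : endsY w -> has isY w.
Proof.
by case: w => //= i w Hw; apply/orP; case/lastP: w Hw => [|w j] /=; [left|
  rewrite last_rcons has_rcons => ->; right].
Qed.

Lemma has_endsY w : sorted leo w -> has isY w -> endsY w.
Proof.
case: w => // i w; elim/last_ind: w => [|w j IH] /=; first by rewrite orbF.
rewrite rcons_path last_rcons has_rcons => /andP[ps lj].
case/or3P => [Yi|//|Yw]; have Yl : isY (last i w) by apply: IH => //=; rewrite ?Yi ?Yw ?orbT.
  exact: (sys_up S) Yl lj.
exact: (sys_up S) Yl lj.
Qed.

Local Notation srt := (sort leo).

Lemma srt_sorted w : sorted leo (srt w). Proof. exact: sort_sorted leo_total w. Qed.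

Lemma srt_uniq w v : perm_eq w v -> sorted leo v -> srt w = v.
Proof.
move=> wv sv; apply: (sorted_eq leo_trans leo_anti) => //; first exact: srt_sorted.
by rewrite perm_sort.
Qed.

Lemma span_sorted w k m b : (size w < m)%N -> (b ==> has isY w) ->
  span W (Bs m b) (xs (srt w) k).
Proof.
move=> wm bw; apply: span_in; exists (srt w), k; split=> //; first exact: srt_sorted.
  by rewrite size_sort.
by rewrite (eq_has_r (mem_sort leo w)).
Qed.

Definition sort_stmt w := forall k b, (b ==> endsY w) ->
  exists t, span W (Bs (size w) b) t /\ forall s y, W y -> sv y s ->
    xs w k s y = xs (srt w) k s y + t s y.

Lemma sort_span w k b m : sort_stmt w -> (b ==> endsY w) -> (size w < m)%N ->
  span W (Bs m b) (xs w k).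
Proof.
move=> Sw bw wm; have [t [St Et]] := Sw k b bw.
have S1 : span W (Bs m b) (xs (srt w) k).
  apply: span_sorted => //; case: b bw {Sw St} => //=; exact: endsY_has.
have S2 : span W (Bs m b) t by apply: span_mono St => u; apply: Bs_le; exact: ltnW.
by apply: span_ext (spanD S1 S2) _ => s y Wy Hs; rewrite Et.
Qed.

(** A further derivative makes a sorted word longer by one, possibly unsorted: it
    is sorted again. The statement is relative to the sorting of the words of
    bounded length because it is used in the induction that proves it. *)
Lemma raise_aux m b i t : (forall w, (size w <= m)%N -> sort_stmt w) ->
  span W (Bs m b) t -> span W (Bs m.+1 b) (fun s y => lie (X i) (t s) y).
Proof.
move=> Sm; apply: (span_lie oW) => [y Wy|u|u|u]; first exact: (sys_X S).
- exact: smoothing_Bs.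
- by move=> Hu; apply: span_in; exact: Bs_le Hu.
move=> [w [k [-> sw wm bw]]].
apply: (@sort_span (i :: w) k b m.+1) => //; first exact: Sm.
case: b bw => //= bw; have := has_endsY sw bw.
by case: w {sw wm bw}.
Qed.

(** Commuting two adjacent fields produces their bracket, a combination of fields,
    hence a shorter word. Words that end with a field of the distribution go on doing
    so: if the two fields are the last ones and the word is not sorted, the first of
    them comes later in the frame and also belongs to the distribution, and
    involutivity keeps their bracket in it. *)
Lemma sort_word w : sort_stmt w.
Proof.
have [N] := ubnP (size w); elim: N w => // N IHN [|i w'] /=.
  by move=> _ k b bF; exists (fun _ _ => 0); split; [exact: span0|move=> s y _ _; rewrite addr0].
rewrite ltnS => w'N k b bw.
have Sm v : (size v <= size w')%N -> sort_stmt v by move=> vw'; apply: IHN; exact: leq_ltn_trans vw' w'N.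
have [->|w'0] := eqVneq w' [::].
  by exists (fun _ _ => 0); split; [exact: span0|move=> s y _ _; rewrite addr0].
have bw' : b ==> endsY w' by case: w' w'0 bw {w'N Sm}.
have [t' [St' Et']] := Sm w' (leqnn _) k b bw'.
have St1 := raise_aux i Sm St'.
have near_lie j (u u' : op) : (forall s y, W y -> sv y s -> u s y = u' s y) ->
    forall s y, W y -> sv y s -> lie (X j) (u s) y = lie (X j) (u' s) y.
  move=> uu' s y Wy Hs; apply: lie_near_eq.
  by apply: near2 (near_W oW Wy) (sv_nearP Hs) _ => z Wz Hz; exact: uu'.
have E1 s y : W y -> sv y s -> xs (i :: w') k s y =
    lie (X i) (xs (srt w') k s) y + lie (X i) (t' s) y.
  move=> Wy Hs; rewrite -[LHS]/(lie (X i) (xs w' k s) y).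
  rewrite (near_lie i _ (fun s y => xs (srt w') k s y + t' s y) Et' s y Wy Hs).
  rewrite lie_add //; first exact: smoothing_xs.
  by apply: (span_smoothing oW _ St') => // u; exact: smoothing_Bs.
case Ew : (srt w') => [|g v].
  have := size_sort leo w'; rewrite Ew /= => /esym/eqP.
  by rewrite size_eq0 (negPf w'0).
have sgv : sorted leo (g :: v) by rewrite -Ew; exact: srt_sorted.
have szv : (size v).+1 = size w' by have := size_sort leo w'; rewrite Ew.
have pw : perm_eq w' (g :: v) by rewrite -Ew perm_sym perm_sort.
(* The tail is sorted already: either [i] is in place in front of it, or it has to
   be moved past its first letter [g]. *)
have [ig|] := boolP (leo i g).
  exists (fun s y => lie (X i) (t' s) y); split=> // s y Wy Hs.
  rewrite -[LHS]/(xs (i :: w') k s y) E1 // Ew (@srt_uniq (i :: w') (i :: g :: v)) //; first by rewrite perm_cons.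
  by rewrite /= ig.
rewrite /leo -ltnNge => gi.
have bgv : b ==> endsY (g :: v).
  apply/implyP => bT; apply: has_endsY => //.
  by rewrite -(perm_has _ pw); apply: endsY_has; rewrite bT in bw'.
have biv : b ==> endsY (i :: v).
  case: b bgv {bw bw' St' St1} => //=; case: v sgv szv {Ew pw} => //= _ _ Yg.
  by apply: (sys_up S) Yg _; exact: ltnW.
have [t3 [St3 Et3]] := Sm (i :: v) (eq_leq szv) k b biv.
have St3' : span W (Bs (size w') b) t3 by move: St3; rewrite /= szv.
have St4 := raise_aux g Sm St3'.
(* The words produced by the bracket of the two fields. *)
pose tc : op := fun s y => \sum_l cfr X l (bracket (X i) (X g)) y * xs (l :: v) k s y.
have Stc : span W (Bs (size w').+1 b) tc.
  apply: span_sum => l.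
  have cl y : W y -> sf y (cfr X l (bracket (X i) (X g))).
    by move=> Wy; apply: sf_cfrX => //; apply: sv_bracket; exact: (sys_X S).
  have [blv|] := boolP (b ==> endsY (l :: v)).
    apply: spanZ => //; apply: sort_span => //=; last by rewrite szv.
    by apply: Sm; rewrite /= szv.
  rewrite negb_imply => /andP[bT Nl].
  have [Yi Yg Yl] : [/\ isY i, isY g & ~~ isY l].
    move: bgv biv Nl; rewrite bT /=; case: v {sgv Ew szv pw St3 Et3 tc} => //= j v ->.
    by move=> _ /negP.
  by apply: span_ext (span0 _ _) _ => s y Wy Hs; rewrite (sys_inv S) ?mul0r.
exists (fun s y => lie (X g) (t3 s) y + tc s y + lie (X i) (t' s) y); split.
  exact: spanD (spanD St4 Stc) St1.
move=> s y Wy Hs; rewrite -[LHS]/(xs (i :: w') k s y) E1 // Ew !addrA; congr (_ + _).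
have -> : lie (X i) (xs (g :: v) k s) y = lie (X g) (xs (i :: v) k s) y + tc s y.
  have Hf : sf y (xs v k s) by exact: smoothing_xs.
  have := lie_bracket (sys_X S i Wy) (sys_X S g Wy) Hf.
  rewrite lie_expand // -/(tc s y) => ->.
  by rewrite -[lie (X i) (lie (X g) _) y]/(lie (X i) (xs (g :: v) k s) y)
    -[lie (X g) (lie (X i) _) y]/(lie (X g) (xs (i :: v) k s) y) addrC subrK.
congr (_ + _).
rewrite (near_lie g _ (fun s y => xs (srt (i :: v)) k s y + t3 s y) Et3 s y Wy Hs).
rewrite lie_add //; last 2 first.
- exact: smoothing_xs.
- by apply: (span_smoothing oW _ St3) => // u; exact: smoothing_Bs.
congr (_ + _); rewrite -[LHS]/(xs (g :: srt (i :: v)) k s y).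
congr (xs _ k s y); apply/esym/srt_uniq.
  rewrite -cat1s perm_sym; apply: (@perm_trans _ (g :: i :: v)).
    by rewrite perm_cons perm_sort.
  apply: (@perm_trans _ (i :: g :: v)); first by rewrite (perm_catCA [:: g] [:: i] v).
  by rewrite perm_cons perm_sym.
rewrite /= path_min_sorted ?srt_sorted //; apply/allP => l; rewrite mem_sort inE.
case/predU1P => [->|lv]; first exact: ltnW.
by move: sgv => /= /(order_path_min leo_trans)/allP/(_ l lv).
Qed.

Lemma xs_span w k b m : (b ==> endsY w) -> (size w < m)%N -> span W (Bs m b) (xs w k).
Proof. by apply: sort_span; exact: sort_word. Qed.

(** Once all words can be sorted, derivation along any vector field raises the
    length bound by one and preserves the presence of the distribution. *)
Lemma span_raise m b (V : sect (TMC M)) t : (forall y, W y -> sv y V) ->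
  span W (Bs m b) t -> span W (Bs m.+1 b) (fun s y => lie V (t s) y).
Proof.
move=> HV St.
have H i : span W (Bs m.+1 b) (fun s y => cfr X i V y * lie (X i) (t s) y).
  apply: spanZ; first by move=> y Wy; apply: sf_cfrX => //; exact: HV.
  by apply: raise_aux St => w _; exact: sort_word.
by apply: span_ext (span_sum _ H) _ => s y Wy Hs; rewrite lie_expand.
Qed.

Lemma Bs_smoothing m b t : span W (Bs m b) t -> smoothing W t.
Proof. by apply: (span_smoothing oW) => u; exact: smoothing_Bs. Qed.

Lemma Bs_oplin m b t : span W (Bs m b) t -> oplin W t.
Proof. by apply: span_lin => u; exact: oplin_Bs. Qed.

Lemma span_le m m' b t : (m <= m')%N -> span W (Bs m b) t -> span W (Bs m' b) t.
Proof. by move=> mm'; apply: span_mono => u; exact: Bs_le. Qed.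

End Words.

Section Compare.
Variables (W : set M) (X X' : 'I_n -> sect (TMC M)) (isY isY' : pred 'I_n) (K K' : nat).
Variables (e : 'I_K -> sect E) (e' : 'I_K' -> sect E).
Hypotheses (S : system W X isY e) (S' : system W X' isY' e').

(** Change of frames, by induction on the word. *)
Lemma compare_systems w k :
  span W (Bs X isY e (size w).+1 false) (xs X' e' w k).
Proof.
elim: w => [|i w IH].
  have H l : span W (Bs X isY e 1 false) (fun s y => cfr e' k (e l) y * xs X e [::] l s y).
    apply: spanZ; first by move=> y Wy; apply: (sf_cfr_sys S') => //; exact: (sys_e S).
    by apply: span_in; exists [::], l.
  apply: span_ext (span_sum _ H) _ => s y Wy Hs.
  rewrite /xs /= [in RHS]/cfr [in RHS](cfr_expand s (sys_eb S Wy)) linear_sum /=.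
  by apply: eq_bigr => l _; rewrite linearZ mulrC.
by apply: (span_raise S) IH => y Wy; exact: (sys_X S').
Qed.

End Compare.

Lemma system_sub (W W' : set M) X isY K (e : 'I_K -> sect E) : open W' -> W' `<=` W ->
  system W X isY e -> system W' X isY e.
Proof.
move=> oW' WW' [H1 H2 H3 H4 H5 H6 H7]; split=> //.
- by move=> i y /WW'; exact: H2.
- by move=> y /WW'; exact: H3.
- by move=> i j y k Yi Yj /WW'; exact: H4.
- by move=> k y /WW'; exact: H6.
- by move=> y /WW'; exact: H7.
Qed.

(** The coordinate fields of a chart and the frame of a trivialization; no field is
    selected, so that the distribution is zero. *)
Lemma chart_system x : system (dom x `&` tdom E x) (dX x) pred0 (@fr _ _ _ E x).
Proof.
split=> //.
- by apply: openI; [exact: dom_open|exact: tdom_open].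
- by move=> i y [dy _]; exact: sv_dX.
- move=> y [dy _]; have dT : dim (TMC M y) = n := mul1n n.
  rewrite basisEfree subvf size_tuple dimvf dT leqnn !andbT; apply/freeP => c cE i.
  have := vec_act_sum y (index_enum _) xpredT c (fun k => dX x k y) (coordfun x i).
  have -> : \sum_(k < n) c k *: dX x k y = 0.
    by rewrite -[RHS]cE; apply: eq_bigr => k _; rewrite frtupE.
  rewrite /vec_act big1 => [|k _]; last by rewrite mxE mul0r.
  rewrite (bigD1 i) //= -/(vec_act _ _ _) -/(lie _ _ _).
  have Hl k : lie (dX x k) (coordfun x i) y = (i == k)%:R.
    by rewrite lie_dX ?dd_coord //; exact: sf_coord.
  rewrite Hl eqxx mulr1 big1 ?addr0 // => k ki.
  by rewrite -/(vec_act _ _ _) -/(lie _ _ _) Hl eq_sym (negPf ki) mulr0.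
- by move=> k y [_ ty]; exact: sv_fr.
- move=> y [_ ty]; have := frame_basis ty; congr (basis_of _ _).
  by congr tval; apply: eq_from_tnth => k; rewrite tnth_mktuple.
Qed.

End Systems.

(** * The PBW operators of products of sections *)

Section PBWOperators.
Variables (R : realType) (n : nat) (M : manifold R n).
Local Notation C := (R[i]).
Implicit Types (f g : M -> C) (x y z : M).
Variables (Q E : vbundle M).
Variable j : forall x, 'Hom(Q x, TMC M x).
Variable nabQ : sect Q -> forall x, 'Hom(TMC M x, Q x).
Variable nabE : sect E -> forall x, 'Hom(TMC M x, E x).
Hypotheses (sj : smooth_hom setT j) (hQ : is_TMC_connection nabQ)
  (hE : is_TMC_connection nabE).

Lemma nearI x (P1 P2 : set M) : (\forall z \near x, P1 z) -> (\forall z \near x, P2 z) ->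
  \forall z \near x, P1 z /\ P2 z.
Proof. by move=> H1 H2; apply: near2 H1 H2 _ => z ? ?; split. Qed.

Local Notation covQ := (covQ j nabQ).
Local Notation covE := (covE j nabE).

Lemma sv_j y (Z : sect Q) : sv y Z -> sv y (fun z => j z (Z z) : TMC M z).
Proof.
by have /(smooth_homP _ (localb_vbundle Q) (localb_TMC M) openT) := sj; exact.
Qed.

Lemma sv_covE y Z s : sv y Z -> sv y s -> sv y (covE Z s).
Proof. by move=> HZ Hs; apply: (conn_smooth (localb_TMC M) hE Hs); exact: sv_j. Qed.

Lemma sv_covQ y Z V : sv y Z -> sv y V -> sv y (covQ Z V).
Proof. by move=> HZ Hs; apply: (conn_smooth (localb_TMC M) hQ Hs); exact: sv_j. Qed.

Lemma covE_near y Z Z' s s' : sv y s -> sv y s' -> (\forall z \near y, s z = s' z) ->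
  Z y = Z' y -> covE Z s y = covE Z' s' y.
Proof. by move=> Hs Hs' ss' ZZ'; rewrite /Defs.covE ZZ' (conn_near_eq hE Hs Hs' ss'). Qed.

Lemma covQ_near y Z Z' s s' : sv y s -> sv y s' -> (\forall z \near y, s z = s' z) ->
  Z y = Z' y -> covQ Z s y = covQ Z' s' y.
Proof. by move=> Hs Hs' ss' ZZ'; rewrite /Defs.covQ ZZ' (conn_near_eq hQ Hs Hs' ss'). Qed.

Lemma covE_Zlin y (c : M -> C) Z Z' s :
  covE (fun z => c z *: Z z + Z' z : Q z) s y = c y *: covE Z s y + covE Z' s y.
Proof. by rewrite /Defs.covE !linearP. Qed.

Lemma covQ_Zlin y (c : M -> C) Z Z' s :
  covQ (fun z => c z *: Z z + Z' z : Q z) s y = c y *: covQ Z s y + covQ Z' s y.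
Proof. by rewrite /Defs.covQ !linearP. Qed.

Definition jfield (Z : sect Q) : sect (TMC M) := fun z => j z (Z z).

Lemma covE_lin y Z c s s' : sf y c -> sv y s -> sv y s' ->
  covE Z (fun z => c z *: s z + s' z : E z) y =
  lie (jfield Z) c y *: s y + c y *: covE Z s y + covE Z s' y.
Proof.
move=> Hc Hs Hs'; rewrite /Defs.covE (conn_add hE (svE_scale Hc Hs) Hs') lfunE /=.
by rewrite (conn_scale hE _ Hc Hs).
Qed.

Lemma covQ_lin y Z c s s' : sf y c -> sv y s -> sv y s' ->
  covQ Z (fun z => c z *: s z + s' z : Q z) y =
  lie (jfield Z) c y *: s y + c y *: covQ Z s y + covQ Z s' y.
Proof.
move=> Hc Hs Hs'; rewrite /Defs.covQ (conn_add hQ (svE_scale Hc Hs) Hs') lfunE /=.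
by rewrite (conn_scale hQ _ Hc Hs).
Qed.

Definition upd m (Z : 'I_m -> sect Q) (k : 'I_m) (V : sect Q) : 'I_m -> sect Q :=
  fun l => if l == k then V else Z l.

(** The operator attached to a product of sections of [Q]: the recursion that
    defines the PBW map, but at the level of honest differential operators, where
    no choice of representatives interferes. *)
Fixpoint Top (m : nat) : ('I_m -> sect Q) -> sect E -> sect E :=
  match m with
  | 0 => fun _ s => s
  | m'.+1 => fun Z s x => m'.+1%:R^-1 *: \sum_(i < m'.+1)
      (covE (Z i) (Top (fun l => Z (lift i l)) s) x
       - \sum_(k < m') Top (upd (fun l => Z (lift i l)) k (covQ (Z i) (Z (lift i k)))) s x)
  end.

Lemma TopS m (Z : 'I_m.+1 -> sect Q) s x : Top Z s x = m.+1%:R^-1 *: \sum_(i < m.+1)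
      (covE (Z i) (Top (fun l => Z (lift i l)) s) x
       - \sum_(k < m) Top (upd (fun l => Z (lift i l)) k (covQ (Z i) (Z (lift i k)))) s x).
Proof. by []. Qed.

Lemma updE m (Z : 'I_m -> sect Q) k V : upd Z k V k = V.
Proof. by rewrite /upd eqxx. Qed.

Lemma sv_upd y m (Z : 'I_m -> sect Q) k V : (forall i, sv y (Z i)) -> sv y V ->
  forall i, sv y (upd Z k V i).
Proof. by move=> HZ HV i; rewrite /upd; case: ifP. Qed.

Lemma sv_Top y m (Z : 'I_m -> sect Q) s : (forall i, sv y (Z i)) -> sv y s -> sv y (Top Z s).
Proof.
elim: m Z => // m IH Z HZ Hs; apply: svE_scale; first exact: sf_cst.
apply: svE_sum => i _; apply: svE_add; first by apply: sv_covE => //; exact: IH.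
apply: svE_opp; apply: svE_sum => k _; apply: IH => //; apply: sv_upd => //.
exact: sv_covQ.
Qed.

(** By induction on the recursion, since connections are local. *)
Lemma Top_near y m (Z Z' : 'I_m -> sect Q) s s' :
  (forall i, sv y (Z i)) -> (forall i, sv y (Z' i)) -> sv y s -> sv y s' ->
  (forall i, \forall z \near y, Z i z = Z' i z) -> (\forall z \near y, s z = s' z) ->
  Top Z s y = Top Z' s' y.
Proof.
elim: m y Z Z' => [|m IH] y Z Z' HZ HZ' Hs Hs' ZZ' ss'; first exact: (nbhs_singleton ss').
rewrite !TopS; congr (_ *: _); apply: eq_bigr => i _; congr (_ - _).
  apply: covE_near; [exact: sv_Top|exact: sv_Top| |exact: (nbhs_singleton (ZZ' i))].
  have N1 : \forall z \near y, forall i, sv z (Z i) /\ sv z (Z' i).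
    apply: filter_forall => k; exact: nearI (sv_nearP (HZ k)) (sv_nearP (HZ' k)).
  have N2 : \forall z \near y, forall i, \forall w \near z, Z i w = Z' i w.
    by apply: filter_forall => k; exact: near_near.
  have N3 := nearI (nearI (sv_nearP Hs) (sv_nearP Hs')) (near_near ss').
  apply: near2 (nearI N1 N2) N3 _ => z [H1 H2] [[H3 H4] H5].
  by apply: IH => // k; [case: (H1 (lift i k))|case: (H1 (lift i k))].
apply: eq_bigr => k _; apply: IH => //.
- by apply: sv_upd => //; exact: sv_covQ.
- by apply: sv_upd => //; exact: sv_covQ.
move=> l; rewrite /upd; case: ifP => // _.
have N1 := nearI (nearI (sv_nearP (HZ (lift i k))) (sv_nearP (HZ' (lift i k))))
  (near_near (ZZ' (lift i k))).
by apply: near2 N1 (ZZ' i) _ => z [[H1 H2] H3] H4; exact: covQ_near.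
Qed.

Lemma Top_slin y m (Z : 'I_m -> sect Q) c s s' :
  (forall i, sv y (Z i)) -> sv y s -> sv y s' ->
  Top Z (fun z => c *: s z + s' z : E z) y = c *: Top Z s y + Top Z s' y.
Proof.
elim: m y Z => // m IH y Z HZ Hs Hs'.
rewrite !TopS scalerA mulrC -scalerA -scalerDr; congr (_ *: _).
rewrite scaler_sumr -big_split; apply: eq_bigr => i _ /=.
have E1 : covE (Z i) (Top (fun l => Z (lift i l)) (fun z => c *: s z + s' z : E z)) y =
   c *: covE (Z i) (Top (fun l => Z (lift i l)) s) y + covE (Z i) (Top (fun l => Z (lift i l)) s') y.
  have S1 : sv y (Top (fun l => Z (lift i l)) s) by exact: sv_Top.
  have S2 : sv y (Top (fun l => Z (lift i l)) s') by exact: sv_Top.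
  have Hc := sf_cst y c.
  rewrite (covE_near (s' := fun z => c *: Top (fun l => Z (lift i l)) s z +
     Top (fun l => Z (lift i l)) s' z : E z) (Z' := Z i)) //.
  - by rewrite covE_lin // {1}/lie vec_act_cst scale0r add0r.
  - by apply: sv_Top => //; exact: svE_lin.
  - exact: svE_lin.
  have N1 : \forall z \near y, forall i, sv z (Z i).
    by apply: filter_forall => k; exact: sv_nearP.
  apply: near2 N1 (nearI (sv_nearP Hs) (sv_nearP Hs')) _ => z H1 [H2 H3].
  exact: IH.
rewrite E1 scalerBr scaler_sumr.
rewrite (eq_bigr (fun k => c *: Top (upd (fun l => Z (lift i l)) k (covQ (Z i) (Z (lift i k)))) s y
  + Top (upd (fun l => Z (lift i l)) k (covQ (Z i) (Z (lift i k)))) s' y)); last first.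
  by move=> k _; apply: IH => //; apply: sv_upd => //; exact: sv_covQ.
rewrite big_split /=; move: (covE _ _ y) (covE _ _ y) (\sum_k _) (\sum_k _) => a b d d'.
by rewrite opprD !addrA; congr (_ - _); rewrite addrAC.
Qed.

Lemma sv_lin_near y c (W W' : sect Q) : sf y c -> sv y W -> sv y W' ->
  \forall z \near y, [/\ sf z c, sv z W & sv z W'].
Proof.
move=> Hc HW HW'; apply: near2 (sf_near Hc) (nearI (sv_nearP HW) (sv_nearP HW')) _.
by move=> z H1 [H2 H3].
Qed.

(** Linearity over the smooth functions in each factor. Differentiating the
    coefficient [c] produces two extra terms in the recursion, one when the
    covariant derivative falls on the operator of the remaining product and one
    when it falls on the factor, and they cancel. *)
Lemma Top_upd_lin y m (Z : 'I_m -> sect Q) k c W W' s :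
  (forall i, sv y (Z i)) -> sf y c -> sv y W -> sv y W' -> sv y s ->
  Top (upd Z k (fun z => c z *: W z + W' z : Q z)) s y =
  c y *: Top (upd Z k W) s y + Top (upd Z k W') s y.
Proof.
elim: m y Z k c W W' => [|m IH] y Z k c W W' HZ Hc HW HW' Hs; first by case: k.
rewrite !TopS scalerA mulrC -scalerA -scalerDr; congr (_ *: _).
rewrite scaler_sumr -big_split; apply: eq_bigr => i _ /=.
pose ZL := fun l => Z (lift i l).
have HZL l : sv y (ZL l) by exact: HZ.
have HcW : sv y (fun z => c z *: W z + W' z : Q z) by exact: svE_lin.
have [k' ->|->] := unliftP i k; last first.
  have EL V : (fun l => upd Z i V (lift i l)) = ZL.
    by apply/funext => l; rewrite /upd eq_sym (negPf (neq_lift i l)).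
  have EU V l : upd Z i V (lift i l) = ZL l by rewrite -[LHS]/((fun l => upd Z i V (lift i l)) l) EL.
  rewrite !EL !updE covE_Zlin scalerBr addrACA -opprD; congr (_ - _).
  rewrite scaler_sumr -big_split; apply: eq_bigr => l _ /=; rewrite !EU.
  have -> : covQ (fun z => c z *: W z + W' z : Q z) (ZL l) =
    (fun z => c z *: covQ W (ZL l) z + covQ W' (ZL l) z : Q z).
    by apply: functional_extensionality_dep => z; exact: covQ_Zlin.
  by apply: IH => //; exact: sv_covQ.
have EL V : (fun l => upd Z (lift i k') V (lift i l)) = upd ZL k' V.
  by apply/funext => l; rewrite /upd (inj_eq lift_inj).
have EU V l : upd Z (lift i k') V (lift i l) = upd ZL k' V l.
  by rewrite -[LHS]/((fun l => upd Z (lift i k') V (lift i l)) l) EL.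
have Ei V : upd Z (lift i k') V i = Z i by rewrite /upd (negPf (neq_lift i k')).
rewrite !EL !Ei.
have SL V : sv y V -> sv y (Top (upd ZL k' V) s).
  by move=> HV; apply: sv_Top => //; exact: sv_upd.
have -> : covE (Z i) (Top (upd ZL k' (fun z => c z *: W z + W' z : Q z)) s) y =
   lie (jfield (Z i)) c y *: Top (upd ZL k' W) s y + c y *: covE (Z i) (Top (upd ZL k' W) s) y
   + covE (Z i) (Top (upd ZL k' W') s) y.
  rewrite -covE_lin //; [|exact: SL|exact: SL].
  apply: covE_near => //; [exact: SL|apply: svE_lin => //; exact: SL|].
  have N1 : \forall z \near y, forall i, sv z (Z i).
    by apply: filter_forall => l; exact: sv_nearP.
  apply: near2 (nearI N1 (sv_nearP Hs)) (sv_lin_near Hc HW HW') _ => z [H1 H2] [H3 H4 H5].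
  by apply: IH => // l; exact: H1.
pose u V l := Top (upd (upd ZL k' V) l (covQ (Z i) (upd ZL k' V l))) s y.
have Sl V : \sum_(l < m) Top (upd (upd ZL k' V) l (covQ (Z i) (upd Z (lift i k') V (lift i l)))) s y
   = u V k' + \sum_(l < m | l != k') u V l.
  by rewrite (bigD1 k') //= EU; congr (_ + _); apply: eq_bigr => l _; rewrite EU.
rewrite !Sl.
have Hl l : l != k' -> u (fun z => c z *: W z + W' z : Q z) l = c y *: u W l + u W' l.
  move=> lk; have comm V V' : upd (upd ZL k' V) l V' = upd (upd ZL l V') k' V.
    apply/funext => l'; rewrite /upd; case: (eqVneq l' l) => // ->.
    by rewrite (negPf lk).
  have El V : upd ZL k' V l = ZL l by rewrite /upd (negPf lk).
  rewrite /u !comm !El; apply: IH => //; apply: sv_upd => //; exact: sv_covQ.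
(* The derivative of [c] that comes from differentiating the factor of index [k']. *)
have Hk : u (fun z => c z *: W z + W' z : Q z) k' =
   lie (jfield (Z i)) c y *: Top (upd ZL k' W) s y + (c y *: u W k' + u W' k').
  have upd2 V V' : upd (upd ZL k' V) k' V' = upd ZL k' V'.
    by apply/funext => l'; rewrite /upd; case: (l' == k').
  rewrite /u !upd2 !updE.
  have Hlc : sf y (lie (jfield (Z i)) c) by apply: sf_lie => //; exact: sv_j.
  have S1 : sv y (covQ (Z i) W) by exact: sv_covQ.
  have S2 : sv y (covQ (Z i) W') by exact: sv_covQ.
  rewrite -IH // -IH //; last exact: svE_lin.
  apply: Top_near => //.
  - by apply: sv_upd => //; exact: sv_covQ.
  - by apply: sv_upd => //; apply: svE_lin => //; exact: svE_lin.
  - move=> l; rewrite /upd; case: ifP => // _; last exact: nearW.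
    apply: filterS (sv_lin_near Hc HW HW') => z [H1 H2 H3].
    by rewrite covQ_lin // -addrA.
  exact: nearW.
rewrite Hk (eq_bigr _ Hl) big_split /= -scaler_sumr.
move: (lie _ _ y *: _) (covE _ _ y) (covE _ _ y) (u W k') (u W' k') (\sum_(l | _) _) (\sum_(l | _) _).
move=> a b b' d d' f f'; rewrite scalerBr scalerDr -(addrA a) -[a + (_ *: d + d') + _]addrA opprD.
by rewrite [LHS]addrACA subrr add0r [c y *: d + d' + _]addrACA opprD addrACA.
Qed.

Lemma Top_upd0 y m (Z : 'I_m -> sect Q) k s : (forall i, sv y (Z i)) -> sv y s ->
  Top (upd Z k (fun z => 0 : Q z)) s y = 0.
Proof.
move=> HZ Hs; have H0 := svE_0 Q y.
have := Top_upd_lin k HZ (sf_cst y (-1)) H0 H0 Hs.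
have -> : (fun z => (-1 : C) *: (0 : Q z) + 0 : Q z) = (fun z => 0 : Q z).
  by apply: functional_extensionality_dep => z; rewrite scaler0 addr0.
by rewrite scaleN1r addNr.
Qed.

Lemma Top_upd_sum y m (Z : 'I_m -> sect Q) k (I : Type) (r : seq I) (c : I -> M -> C)
    (W : I -> sect Q) s : (forall i, sv y (Z i)) -> (forall i, sf y (c i)) ->
  (forall i, sv y (W i)) -> sv y s ->
  Top (upd Z k (fun z => \sum_(i <- r) c i z *: W i z : Q z)) s y =
  \sum_(i <- r) c i y *: Top (upd Z k (W i)) s y.
Proof.
move=> HZ Hc HW Hs; elim: r => [|i r IH].
  have -> : (fun z => \sum_(i <- [::]) c i z *: W i z : Q z) = (fun z => 0 : Q z).
    by apply: functional_extensionality_dep => z; rewrite big_nil.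
  by rewrite Top_upd0 // big_nil.
have -> : (fun z => \sum_(i <- i :: r) c i z *: W i z : Q z) =
   (fun z => c i z *: W i z + (\sum_(i <- r) c i z *: W i z) : Q z).
  by apply: functional_extensionality_dep => z; rewrite big_cons.
rewrite Top_upd_lin //; last by apply: svE_sum => l _; exact: svE_scale.
by rewrite IH big_cons.
Qed.

(** The recursion treats all factors alike. *)
Lemma Top_perm m (Z : 'I_m -> sect Q) (p : 'I_m -> 'I_m) : injective p ->
  Top (fun l => Z (p l)) = Top Z.
Proof.
elim: m Z p => // m IH Z p ip; apply/funext => s; apply: functional_extensionality_dep => x.
rewrite !TopS; congr (_ *: _); rewrite [RHS](reindex_inj ip); apply: eq_bigr => i _ /=.
have [p' p'E] : exists p' : 'I_m -> 'I_m, forall l, p (lift i l) = lift (p i) (p' l).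
  suff H l : exists k, p (lift i l) = lift (p i) k.
    by exists (fun l => sval (cid (H l))) => l; case: (cid (H l)).
  have := neq_lift i l; rewrite -(inj_eq ip) => /unlift_some [k -> _].
  by exists k.
have ip' : injective p'.
  by move=> k l kl; apply: (@lift_inj _ i); apply: ip; rewrite !p'E kl.
have EL : (fun l => Z (p (lift i l))) = (fun l => Z (lift (p i) (p' l))).
  by apply/funext => l; rewrite p'E.
rewrite EL (IH (fun l => Z (lift (p i) l)) p' ip'); congr (_ - _).
rewrite [RHS](reindex_inj ip'); apply: eq_bigr => k _ /=.
rewrite -(IH (upd (fun l => Z (lift (p i) l)) (p' k) _) p' ip') p'E; congr (Top _ s x); apply/funext => l.
by rewrite /upd (inj_eq ip').
Qed.

(** Constant extension of a vector in the trivialization around its base point. *)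
Definition ext x (v : Q x) : sect Q :=
  fun y => \sum_i coord (frame Q x x) i v *: tnth (frame Q x y) i.

Lemma sv_ext x (v : Q x) y : tdom Q x y -> sv y (ext v).
Proof.
move=> ty; apply: svE_sum => i _; apply: svE_scale; first exact: sf_cst.
exact: sv_fr.
Qed.

Lemma ext_self x (v : Q x) : ext v x = v.
Proof. by rewrite [RHS](frame_expand v (mem_tdom Q x)). Qed.

(** A local frame of [Q] that extends the basis of the fibre used to identify
    the symmetric algebra with polynomials. *)
Definition vb x : 'I_(\dim {:Q x}) -> sect Q := fun i => ext (vbasis {:Q x})`_i.

Lemma sv_vb x (i : 'I_(\dim {:Q x})) : sv x (vb i).
Proof. by apply: sv_ext; exact: mem_tdom. Qed.

Lemma vb_expand x (Z : sect Q) : sv x Z -> exists c : 'I_(\dim {:Q x}) -> M -> C,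
  [/\ forall i, sf x (c i), \forall z \near x, Z z = \sum_i c i z *: vb i z &
    forall i, c i x = coord (vbasis {:Q x}) i (Z x)].
Proof.
move=> HZ.
pose B (k : 'I_(rk Q x)) i := coord (vbasis {:Q x}) i (tnth (frame Q x x) k).
exists (fun i z => \sum_k coord (frame Q x z) k (Z z) * B k i); split.
- move=> i; apply: sf_sum => k _; apply: sf_mul; last exact: sf_cst.
  by have /(svE_chart _ (mem_tdom Q x)) := HZ; exact.
- apply: filterS (near_tdom (mem_tdom Q x)) => z tz; rewrite {1}(frame_expand (Z z) tz).
  under [RHS]eq_bigr do rewrite scaler_suml.
  rewrite exchange_big; apply: eq_bigr => k _ /=.
  under eq_bigr do rewrite -scalerA.
  rewrite -scaler_sumr; congr (_ *: _); rewrite /vb /ext.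
  under eq_bigr do rewrite scaler_sumr.
  rewrite exchange_big /=.
  transitivity (\sum_l coord (frame Q x x) l (tnth (frame Q x x) k) *: tnth (frame Q x z) l).
    have /andP [_ fx] := frame_basis (mem_tdom Q x).
    rewrite (bigD1 k) //= (tnth_nth 0 (frame Q x x)) coord_free // eqxx scale1r.
    rewrite big1 ?addr0 // => l lk.
    by rewrite coord_free // eq_sym (negPf lk) scale0r.
  apply: eq_bigr => l _; rewrite [X in coord _ _ X](coord_vbasis (memvf _)) linear_sum scaler_suml /=.
  by apply: eq_bigr => i _; rewrite linearZ /= scalerA.
move=> i; rewrite [in RHS](frame_expand (Z x) (mem_tdom Q x)) linear_sum /=.
by apply: eq_bigr => k _; rewrite linearZ.
Qed.

End PBWOperators.

(** * The PBW operators of the symmetric algebra *)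

Section MultinomWords.
Variable q : nat.
Implicit Types (a : multinom q) (w : seq 'I_q).

(** The sorted word of the variables of a monomial. *)
Definition mword a : seq 'I_q := flatten [seq nseq (a i) i | i <- enum 'I_q].

Definition mnw w : multinom q := Multinom [tuple count_mem i w | i < q].

Lemma mnwE w i : mnw w i = count_mem i w.
Proof. exact: mnmE. Qed.

Lemma count_mword a i : count_mem i (mword a) = a i.
Proof.
rewrite /mword count_flatten -map_comp sumnE big_map (bigD1_seq i) ?enum_uniq ?mem_enum //=.
rewrite count_nseq /= eqxx mul1n big1 ?addn0 // => k /negPf ki.
by rewrite count_nseq /= ki mul0n.
Qed.

Lemma mnw_mword a : mnw (mword a) = a.
Proof. by apply/mnmP => i; rewrite mnwE count_mword. Qed.

Lemma perm_mword w : perm_eq w (mword (mnw w)).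
Proof. by apply/allP => i _ /=; rewrite count_mword mnwE. Qed.

Lemma sorted_mword a : sorted (@leo q) (mword a).
Proof.
have Hs : pairwise (@leo q) (enum 'I_q).
  rewrite -(sorted_pairwise (@leo_trans q)).
  have -> : @leo q = relpre val leq by [].
  by rewrite -sorted_map val_enum_ord iota_sorted.
rewrite (sorted_pairwise (@leo_trans q)) /mword.
elim: (enum 'I_q) Hs => //= i s IH /andP [ai ps].
rewrite pairwise_cat IH // andbT; apply/andP; split.
  apply/allrelP => k l /nseqP [-> _] /flatten_mapP [m ms /nseqP [-> _]].
  by move/allP: ai => /(_ m ms).
elim: (a i) => //= m ->; rewrite andbT; apply/allP => k /nseqP [-> _].
exact: leqnn.
Qed.

Lemma mword_mnw w : sorted (@leo q) w -> mword (mnw w) = w.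
Proof.
move=> sw; apply: (sorted_eq (@leo_trans q) (@leo_anti q)) => //; first exact: sorted_mword.
by rewrite perm_sym perm_mword.
Qed.

Lemma size_mword a : size (mword a) = mdeg a.
Proof.
rewrite /mword size_flatten sumnE big_map big_map mdegE big_enum /=.
by apply: eq_bigr => i _; rewrite size_nseq.
Qed.

Lemma mdeg_mnw w : mdeg (mnw w) = size w.
Proof. by rewrite -size_mword; apply/esym/perm_size; exact: perm_mword. Qed.

Lemma mpolyX_mnw (R : nzRingType) w : mpolyX R (mnw w) = \prod_(i <- w) mpolyX R (mnm1 i).
Proof.
elim: w => [|i w IH].
  have E0 : mnw [::] = @mnm0 q by apply/mnmP => i; rewrite mnwE.
  by rewrite big_nil E0 mpolyX0.
rewrite big_cons -IH -mpolyXD; congr mpolyX; apply/mnmP => k.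
by rewrite mnmDE !mnwE mnm1E /= eq_sym.
Qed.

End MultinomWords.

Lemma mpoly_lin_bound (R : nzRingType) (V : lmodType R) q (p : mpoly q R) d
    (c : multinom q -> V) : (msize p <= d)%N ->
  \sum_(a <- msupp p) mcoeff a p *: c a = \sum_(a : bmultinom q d) mcoeff a p *: c a.
Proof.
move=> pd; pose I : subFinType _ := bmultinom q d.
rewrite (ssrcomplements.big_mksub I) /=; first last.
- by move=> x /msize_mdeg_lt /leq_trans; apply.
- exact: msupp_uniq.
by rewrite big_rmcond //= => i; move/memN_msupp_eq0 ->; rewrite scale0r.
Qed.

Section SymmetricAlgebra.
Variables (R : realType) (n : nat) (M : manifold R n).
Local Notation C := (R[i]).
Implicit Types (f g : M -> C) (x y z : M).
Variables (Q E : vbundle M).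
Variable j : forall x, 'Hom(Q x, TMC M x).
Variable nabQ : sect Q -> forall x, 'Hom(TMC M x, Q x).
Variable nabE : sect E -> forall x, 'Hom(TMC M x, E x).
Hypotheses (sj : smooth_hom setT j) (hQ : is_TMC_connection nabQ)
  (hE : is_TMC_connection nabE).

Local Notation Top := (Top j nabQ nabE).

Section Point.
Variable x : M.
Local Notation q := (\dim {:Q x}).

Definition Tw (w : seq 'I_q) (s : sect E) : E x :=
  Top (fun i : 'I_(size w) => vb (tnth (in_tuple w) i)) s x.

(** The operator at [x] attached to an element of the symmetric algebra: it is
    prescribed on the monomials in the basis of the fibre, by means of the frame
    [vb]. *)
Definition nu (p : sym_fiber Q x) (s : sect E) : E x :=
  \sum_(a <- msupp p) mcoeff a p *: Tw (mword a) s.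

Lemma nuE d (p : sym_fiber Q x) s : (msize p <= d)%N ->
  nu p s = \sum_(a : bmultinom q d) mcoeff a p *: Tw (mword a) s.
Proof. by move=> pd; rewrite /nu (mpoly_lin_bound _ pd). Qed.

Lemma nu_lin c (p p' : sym_fiber Q x) s : nu (c *: p + p') s = c *: nu p s + nu p' s.
Proof.
pose d := maxn (msize (c *: p + p')) (maxn (msize p) (msize p')).
have d1 : (msize (c *: p + p') <= d)%N by rewrite leq_maxl.
have d2 : (msize p <= d)%N by rewrite leq_max leq_max leqnn orbT.
have d3 : (msize p' <= d)%N by rewrite leq_max leq_max leqnn !orbT.
rewrite (nuE s d1) (nuE s d2) (nuE s d3) scaler_sumr -big_split.
by apply: eq_bigr => a _ /=; rewrite mcoeffD mcoeffZ scalerDl scalerA.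
Qed.

Lemma nu_sum (I : Type) (r : seq I) (P : pred I) c (p : I -> sym_fiber Q x) s :
  nu (\sum_(i <- r | P i) c i *: p i) s = \sum_(i <- r | P i) c i *: nu (p i) s.
Proof.
elim: r => [|i r IH]; first by rewrite !big_nil /nu msupp0 big_nil.
by rewrite !big_cons; case: ifP => // _; rewrite nu_lin IH.
Qed.

Lemma nu_X a s : nu (mpolyX C a) s = Tw (mword a) s.
Proof. by rewrite /nu msuppX big_seq1 mcoeffX eqxx scale1r. Qed.

Lemma nu_0 s : nu (0 : sym_fiber Q x) s = 0.
Proof. by rewrite /nu msupp0 big_nil. Qed.

Lemma nu_slin p c s s' : sv x s -> sv x s' ->
  nu p (fun z => c *: s z + s' z : E z) = c *: nu p s + nu p s'.
Proof.
move=> Hs Hs'; rewrite /nu scaler_sumr -big_split; apply: eq_bigr => a _ /=.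
by rewrite /Tw (Top_slin sj hQ hE) // ?scalerDr ?scalerA 1?mulrC // => i; exact: sv_vb.
Qed.

Definition seqZ m (l : seq (sect Q)) : 'I_m -> sect Q := fun i => nth (fun z => 0 : Q z) l i.

Lemma Tw_perm w w' s : perm_eq w w' -> Tw w s = Tw w' s.
Proof.
move=> ww'; have ss' := perm_size ww'.
have : perm_eq (in_tuple w) (tcast (esym ss') (in_tuple w')) by rewrite val_tcast.
move=> /tuple_permP [p pE].
have E1 : (fun i : 'I_(size w) => vb (tnth (in_tuple w) i)) =
   (fun i => (fun l => vb (tnth (tcast (esym ss') (in_tuple w')) l)) (p i)).
  apply/funext => i; congr vb.
  have -> : in_tuple w = [tuple tnth (tcast (esym ss') (in_tuple w')) (p i) | i < size w].
    exact: val_inj.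
  by rewrite tnth_mktuple.
rewrite /Tw E1 (Top_perm j nabQ nabE (fun l => vb (tnth (tcast (esym ss') (in_tuple w')) l)) (@perm_inj _ p)).
by case: _ / (esym ss').
Qed.

Lemma Top_seqZ (w : seq 'I_q) s m : size w = m -> Top (@seqZ m [seq vb i | i <- w]) s x = Tw w s.
Proof.
move=> <-; rewrite /Tw; congr (Top _ s x); apply/funext => i.
have x0 := tnth (in_tuple w) i.
rewrite (tnth_nth x0).
exact: (@nth_map _ x0 _ (fun z => 0 : Q z) (fun i : 'I_q => vb i) i w (ltn_ord i)).
Qed.

Lemma sv_nth_vb (w : seq 'I_q) i : sv x (nth (fun z => 0 : Q z) [seq vb i | i <- w] i).
Proof. by elim: w i => [|a w IH] [|i] //=; [exact: svE_0|exact: svE_0|exact: sv_vb]. Qed.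

(** The sections in [zs] are expanded one after the other in the frame [vb]; by
    multilinearity this reduces the product to monomials. The word [w] records the
    frame sections chosen so far. *)
Lemma nu_expand m zs (w : seq 'I_q) s : (size w + size zs = m)%N -> (forall i, sv x (nth (fun z => 0 : Q z) zs i)) ->
  sv x s -> Top (@seqZ m ([seq vb i | i <- w] ++ zs)) s x =
  nu (\prod_(i <- w) mpolyX C (mnm1 i) * \prod_(Z <- zs) sym_in (Z x)) s.
Proof.
elim: zs w => [|Z zs IH] w sz Hzs Hs.
  rewrite cats0 big_nil mulr1 -mpolyX_mnw nu_X Top_seqZ; last by rewrite -sz addn0.
  exact/Tw_perm/perm_mword.
have HZ : sv x Z := Hzs 0%N.
have [c [Hc cE cx]] := vb_expand HZ.
have km : (size w < m)%N by rewrite -sz /= addnS ltnS leq_addr.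
pose k := Ordinal km.
pose l0 := [seq vb i | i <- w] ++ Z :: zs.
have sl0 i : sv x (@seqZ m l0 i).
  by rewrite /seqZ nth_cat size_map; case: ltnP => H; [exact: sv_nth_vb|exact: Hzs].
have upd_l0 V : upd (@seqZ m l0) k V = @seqZ m ([seq vb i | i <- w] ++ V :: zs).
  apply/funext => i; rewrite /upd /seqZ !nth_cat !size_map -val_eqE /=.
  case: ltngtP => [//|wi|->]; last by rewrite subnn.
  by case E1: (i - size w)%N => [|r] //; move: wi; rewrite -subn_gt0 E1.
have -> : Top (@seqZ m l0) s x = Top (upd (@seqZ m l0) k (fun z => \sum_i c i z *: vb i z : Q z)) s x.
  apply: (Top_near sj hQ hE) => //.
  - by apply: sv_upd => //; apply: svE_sum => i _; apply: svE_scale => //; exact: sv_vb.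
  - move=> i; rewrite /upd; case: eqVneq => [->|_]; last exact: nearW.
    rewrite /seqZ nth_cat size_map ltnn subnn /=; exact: cE.
  exact: nearW.
rewrite (Top_upd_sum sj hQ hE) //; last by move=> i; exact: sv_vb.
rewrite big_cons /sym_in mulr_suml mulr_sumr.
rewrite (eq_bigr (fun i => coord (vbasis {:Q x}) i (Z x) *:
  (\prod_(i <- rcons w i) mpolyX C (mnm1 i) * \prod_(Z <- zs) sym_in (Z x)))); last first.
  move=> i _; rewrite -scalerAl -scalerAr; congr (_ *: _).
  by rewrite mulrA -cats1 big_cat big_seq1.
rewrite nu_sum; apply: eq_bigr => i _; rewrite cx; congr (_ *: _).
rewrite -IH //; last first.
- by move=> r; exact: (Hzs r.+1).
- by rewrite size_rcons addSnnS.
by rewrite upd_l0 map_rcons cat_rcons.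
Qed.

(** Although defined by one particular frame, [nu] agrees with the recursion for
    all products of sections of [Q]. *)
Lemma nu_prod m (Z : 'I_m -> sect Q) s : (forall i, sv x (Z i)) -> sv x s ->
  nu (\prod_(i < m) sym_in (Z i x)) s = Top Z s x.
Proof.
move=> HZ Hs; pose zs := [seq Z i | i <- enum 'I_m].
have sz : (size (@nil 'I_q) + size zs)%N = m by rewrite size_map size_enum_ord.
have zsE : seqZ zs = Z.
  apply/funext => i; rewrite /seqZ (nth_map i) ?size_enum_ord //.
  by rewrite nth_ord_enum.
rewrite -[in RHS]zsE; have := nu_expand sz _ Hs; rewrite cat0s => ->.
  by rewrite big_nil mul1r big_map big_enum.
move=> i; have [im|mi] := ltnP i m; first by have := HZ (Ordinal im); rewrite -{1}zsE.
rewrite (nth_default _ (_ : (size zs <= i)%N)); first exact: svE_0.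
by rewrite size_map size_enum_ord.
Qed.

End Point.
End SymmetricAlgebra.

(** * Order and leading terms of the PBW operators *)

Section LeadingTerm.
Variables (R : realType) (n : nat) (M : manifold R n).
Local Notation C := (R[i]).
Implicit Types (f g : M -> C) (x y z : M).
Variables (Q E : vbundle M).
Variable j : forall x, 'Hom(Q x, TMC M x).
Variable nabQ : sect Q -> forall x, 'Hom(TMC M x, Q x).
Variable nabE : sect E -> forall x, 'Hom(TMC M x, E x).
Hypotheses (sj : smooth_hom setT j) (hQ : is_TMC_connection nabQ)
  (hE : is_TMC_connection nabE).
Variables (W : set M) (X : 'I_n -> sect (TMC M)) (isY : pred 'I_n) (K : nat).
Variable e : 'I_K -> sect E.
Hypothesis S : system W X isY e.

Local Notation Top := (Top j nabQ nabE).
Local Notation covQ := (covQ j nabQ).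
Local Notation covE := (covE j nabE).
Local Notation B := (Bs X isY e).
Local Notation oW := (sys_open S).

(** The Leibniz rule, applied to the expansion in the frame. *)
Lemma cfr_covE k Z s y : W y -> sv y Z -> sv y s ->
  cfr e k (covE Z s) y = lie (jfield j Z) (cfr e k s) y +
    \sum_l cfr e k (covE Z (e l)) y * cfr e l s y.
Proof.
move=> Wy HZ Hs.
have Hc l : sf y (cfr e l s) by exact: (sf_cfr_sys S).
have He l : sv y (e l) by exact: (sys_e S).
rewrite {1}/cfr; have -> : covE Z s y = \sum_l (lie (jfield j Z) (cfr e l s) y *: e l y + cfr e l s y *: covE Z (e l) y).
  have E1 : \forall z \near y, s z = \sum_l cfr e l s z *: e l z.
    by apply: filterS (near_W oW Wy) => z Wz; exact: cfr_expand (sys_eb S Wz).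
  rewrite (covE_near j hE (Z' := Z) Hs _ E1) //; last by apply: svE_sum => l _; exact: svE_scale.
  rewrite /Defs.covE (conn_sum hE) => [|l]; last exact: svE_scale.
  by apply: eq_bigr => l _; rewrite (conn_scale hE).
rewrite big_split linearD /=; congr (_ + _); first exact: cfr_eq (sys_eb S Wy).
by rewrite linear_sum; apply: eq_bigr => l _; rewrite linearZ mulrC.
Qed.

Lemma cfr_TopS k m (Z : 'I_m.+1 -> sect Q) s y :
  cfr e k (Top Z s) y = m.+1%:R^-1 * \sum_(i < m.+1)
   (cfr e k (covE (Z i) (Top (fun l => Z (lift i l)) s)) y -
    \sum_(l < m) cfr e k (Top (upd (fun l => Z (lift i l)) l (covQ (Z i) (Z (lift i l)))) s) y).
Proof.
rewrite {1}/cfr TopS linearZ linear_sum; congr (_ * _); apply: eq_bigr => i _.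
by rewrite linearB linear_sum.
Qed.

Lemma near_lie_op (V : sect (TMC M)) (t t' : op E) :
  (forall s y, W y -> sv y s -> t s y = t' s y) ->
  forall s y, W y -> sv y s -> lie V (t s) y = lie V (t' s) y.
Proof.
move=> tt' s y Wy Hs; apply: lie_near_eq.
by apply: near2 (near_W oW Wy) (sv_nearP Hs) _ => z Wz Hz; exact: tt'.
Qed.

Lemma sf_cfr_covE k Z l : (forall y, W y -> sv y Z) ->
  forall y, W y -> sf y (cfr e k (covE Z (e l))).
Proof.
move=> HZ y Wy; apply: (sf_cfr_sys S) => //.
by apply: (sv_covE sj hE); [exact: HZ|exact: (sys_e S)].
Qed.

(** By [cfr_covE], the order is raised by the derivation of the components only. *)
Lemma covE_span k Z m (T : sect E -> sect E) : (forall y, W y -> sv y Z) ->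
  (forall s y, W y -> sv y s -> sv y (T s)) ->
  (forall l, span W (B m false) (fun s => cfr e l (T s))) ->
  span W (B m.+1 false) (fun s => cfr e k (covE Z (T s))).
Proof.
move=> HZ HT St.
have S1 : span W (B m.+1 false) (fun s y => lie (jfield j Z) (cfr e k (T s)) y).
  by apply: (span_raise S) (St k) => y Wy; apply: (sv_j sj); exact: HZ.
have S2 l : span W (B m.+1 false) (fun s y => cfr e k (covE Z (e l)) y * cfr e l (T s) y).
  by apply: spanZ; [exact: sf_cfr_covE|exact: span_le (St l)].
apply: span_ext (spanD S1 (span_sum _ S2)) _ => s y Wy Hs.
by rewrite cfr_covE //; [exact: HZ|exact: HT].
Qed.

(** By induction on the recursion: only covariant derivatives raise the order, each
    by one. *)
Lemma Top_span k m (Z : 'I_m -> sect Q) : (forall i y, W y -> sv y (Z i)) ->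
  span W (B m.+1 false) (fun s => cfr e k (Top Z s)).
Proof.
elim: m k Z => [|m IH] k Z HZ; first by apply: span_in; exists [::], k.
have H1 i : span W (B m.+2 false)
    (fun s y => cfr e k (covE (Z i) (Top (fun l => Z (lift i l)) s)) y).
  apply: covE_span => [|s y Wy Hs|l]; first exact: HZ.
    by apply: (sv_Top sj hQ hE) => // r; exact: HZ.
  by apply: IH => r; exact: HZ.
have H2 i l : span W (B m.+2 false) (fun s y =>
    cfr e k (Top (upd (fun l => Z (lift i l)) l (covQ (Z i) (Z (lift i l)))) s) y).
  apply: (@span_le _ _ _ _ _ _ _ _ _ m.+1) => //; apply: IH => r y Wy.
  by apply: sv_upd => [r'|]; [exact: HZ|apply: (sv_covQ sj hQ); exact: HZ].
have H3 := spanZ (c := fun=> m.+1%:R^-1) (fun y _ => sf_cst y _)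
  (span_sum (index_enum _) (fun i => spanD (H1 i) (span_opp (span_sum (index_enum _) (H2 i))))).
apply: span_ext H3 _ => s y Wy Hs; rewrite cfr_TopS; congr (_ * _).
Qed.

Section Frame.
Variables (q : nat) (eQ : 'I_q -> sect Q) (up : 'I_q -> 'I_n).
Hypothesis eQ_sm : forall i y, W y -> sv y (eQ i).
Hypothesis eQ_X : forall i y, W y -> j y (eQ i y) = X (up i) y.

Lemma perm_lift m (i : 'I_m.+1) :
  perm_eq (i :: [seq lift i k | k <- enum 'I_m]) (enum 'I_m.+1).
Proof.
apply: uniq_perm.
- rewrite /= map_inj_uniq ?enum_uniq ?andbT; last exact: lift_inj.
  by apply/mapP => -[k _ /eqP]; rewrite (negPf (neq_lift i k)).
- exact: enum_uniq.
move=> k; rewrite mem_enum inE; apply/orP.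
have [l ->|->] := unliftP i k; [right|by left].
by apply/mapP; exists l => //; rewrite mem_enum.
Qed.

(** Every summand of the recursion contributes the same word of vector fields up to
    shorter words, after sorting; the average over the factors therefore has
    leading coefficient one. *)
Lemma Top_lead m (w : 'I_m -> 'I_q) k : exists t, span W (B m false) t /\
  forall s y, W y -> sv y s -> cfr e k (Top (fun i => eQ (w i)) s) y =
    xs X e (sort (@leo n) [seq up (w i) | i <- enum 'I_m]) k s y + t s y.
Proof.
elim: m w k => [|m IH] w k.
  exists (fun _ _ => 0); split; first exact: span0.
  by move=> s y _ _; rewrite addr0; case: (enum 'I_0) => [|[]//].
pose wd := [seq up (w i) | i <- enum 'I_m.+1].
pose Zi (i : 'I_m.+1) := fun l : 'I_m => eQ (w (lift i l)).
have HZ i l y : W y -> sv y (Zi i l) by move=> Wy; exact: eQ_sm.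
have key i : exists t, span W (B m.+1 false) t /\ forall s y, W y -> sv y s ->
    cfr e k (covE (eQ (w i)) (Top (Zi i) s)) y = xs X e (sort (@leo n) wd) k s y + t s y.
  have [t [St Et]] := IH (fun l => w (lift i l)) k.
  pose wi := [seq up (w (lift i l)) | l <- enum 'I_m].
  have swi : size (up (w i) :: sort (@leo n) wi) = m.+1.
    by rewrite /= size_sort size_map size_enum_ord.
  have [t2 [St2 Et2]] := sort_word S (w := up (w i) :: sort (@leo n) wi) k (b := false) isT.
  rewrite swi in St2.
  have srtE : sort (@leo n) (up (w i) :: sort (@leo n) wi) = sort (@leo n) wd.
    apply: srt_uniq; last exact: srt_sorted.
    rewrite perm_sym perm_sort perm_sym; apply: (@perm_trans _ (up (w i) :: wi)).
      by rewrite perm_cons perm_sort.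
    have := perm_map (fun l => up (w l)) (perm_lift i).
    by rewrite /= -map_comp.
  have S1 : span W (B m.+1 false) (fun s y => lie (X (up (w i))) (t s) y).
    by apply: (span_raise S) St => y; exact: (sys_X S).
  have S2 l : span W (B m.+1 false) (fun s y => cfr e k (covE (eQ (w i)) (e l)) y *
      cfr e l (Top (Zi i) s) y).
    apply: spanZ; first by apply: sf_cfr_covE => y Wy; exact: eQ_sm.
    by apply: Top_span => r y; exact: HZ.
  exists (fun s y => t2 s y + lie (X (up (w i))) (t s) y +
     \sum_l cfr e k (covE (eQ (w i)) (e l)) y * cfr e l (Top (Zi i) s) y); split.
    exact: spanD (spanD St2 S1) (span_sum _ S2).
  move=> s y Wy Hs.
  have HT : sv y (Top (Zi i) s) by apply: (sv_Top sj hQ hE) => // l; exact: HZ.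
  rewrite cfr_covE //; last exact: eQ_sm.
  rewrite addrA; congr (_ + _).
  have -> : lie (jfield j (eQ (w i))) (cfr e k (Top (Zi i) s)) y =
      lie (X (up (w i))) (cfr e k (Top (Zi i) s)) y by rewrite /lie /jfield eQ_X.
  rewrite (near_lie_op (X (up (w i))) (t := fun s => cfr e k (Top (Zi i) s)) Et) //.
  rewrite lie_add; last 2 first.
  - exact: (smoothing_xs S).
  - exact: (Bs_smoothing S St).
  by rewrite addrA; congr (_ + _); rewrite -srtE -Et2.
have [t Ht] : exists t : 'I_m.+1 -> op E, forall i, span W (B m.+1 false) (t i) /\
    forall s y, W y -> sv y s -> cfr e k (covE (eQ (w i)) (Top (Zi i) s)) y =
      xs X e (sort (@leo n) wd) k s y + t i s y.
  by exists (fun i => sval (cid (key i))) => i; case: (cid (key i)).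
have H2 i l : span W (B m.+1 false) (fun s y =>
    cfr e k (Top (upd (Zi i) l (covQ (eQ (w i)) (Zi i l))) s) y).
  apply: Top_span => r y Wy.
  by apply: sv_upd => [r'|]; [exact: HZ|apply: (sv_covQ sj hQ); [exact: eQ_sm|exact: HZ]].
(* The same leading word for each of the [m.+1] factors, and lower order terms. *)
exists (fun s y => m.+1%:R^-1 * \sum_i (t i s y - \sum_l
   cfr e k (Top (upd (Zi i) l (covQ (eQ (w i)) (Zi i l))) s) y)); split.
  apply: (spanZ (c := fun=> m.+1%:R^-1)); first by move=> y _; exact: sf_cst.
  by apply: span_sum => i; apply: spanD (Ht i).1 _; apply: span_opp; exact: span_sum.
move=> s y Wy Hs; rewrite cfr_TopS.
under eq_bigr do rewrite (Ht _).2 // -addrA.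
rewrite big_split /= sumr_const card_ord mulrDr; congr (_ + _).
by rewrite mulrnAr -mulrnAl -(mulr_natr (m.+1%:R^-1)) mulVf ?mul1r // pnatr_eq0.
Qed.

End Frame.
End LeadingTerm.

(** * Jets and iterated derivatives *)

Section Jets.
Variables (R : realType) (n : nat) (M : manifold R n).
Local Notation C := (R[i]).
Implicit Types (f g : M -> C) (x y z : M).
Variable E : vbundle M.

Lemma mpartial_word (a : multinom n) (F : 'rV[R]_n -> C) :
  mpartial a F = foldr (@partial R n) F (mword a).
Proof.
rewrite /mpartial /mword; elim: (enum 'I_n) => //= i s IH.
by rewrite foldr_cat -IH; elim: (a i) => //= m ->.
Qed.

Lemma fold_dd x w f y : dom x y ->
  foldr (@partial R n) (f \o psi x) w (phi x y) = foldr (dd x) f w y.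
Proof.
move=> dy; have oD : open (phi x @` dom x) by exact: phi_dom_open.
suff H t : (phi x @` dom x) t -> foldr (@partial R n) (f \o psi x) w t =
    (foldr (dd x) f w \o psi x) t.
  by rewrite H /= ?phiK //; exists y.
elim: w t => //= i w IH t Dt.
have -> : partial i (foldr (@partial R n) (f \o psi x) w) t =
    partial i (foldr (dd x) f w \o psi x) t.
  by apply: (partial_open_eq _ oD Dt) => t' /set_mem; exact: IH.
by case: Dt => z dz <-; rewrite /dd /= phiK.
Qed.

Lemma Xw_dd x w f y : dom x y -> sf y f -> Xw (dX x) w f y = foldr (dd x) f w y.
Proof.
elim: w y => // i w IH y dy Hf /=.
have Hw z : dom x z -> sf z f -> sf z (foldr (dd x) f w).
  by move=> dz Hz; elim: (w) => //= k v; exact: sf_dd.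
rewrite -lie_dX //; last exact: Hw.
by apply: lie_near_eq; apply: near2 (near_dom dy) (sf_near Hf) _ => z; exact: IH.
Qed.

Lemma cfr_fr x k (s : sect E) z :
  cfr (@fr _ _ _ E x) k s z = coord (frame E x z) k (s z).
Proof.
rewrite /cfr; congr (coord _ k (s z)); apply: eq_from_tnth => l.
by rewrite tnth_mktuple.
Qed.

Local Notation chart x := (chart_system E x).

Lemma chart_dom x : (dom x `&` tdom E x) x.
Proof. by split; [exact: mem_dom|exact: mem_tdom]. Qed.

(** Jets are defined with coordinates and trivializations, hence their entries are
    iterated derivatives along sorted words for the system of a chart. *)
Lemma jetE r x (s : sect E) : sv x s -> jet r x s =
  [ffun a : bmultinom n r.+1 => \sum_k xs (dX x) (@fr _ _ _ E x) (mword a) k s x *: fr k x].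
Proof.
move=> Hs; apply/ffunP => a; rewrite !ffunE; apply: eq_bigr => k _; congr (_ *: _).
have d := mem_dom x.
rewrite mpartial_word -[X in foldr _ X]/((fun y => coord (frame E x y) k (s y)) \o psi x).
rewrite fold_dd //.
have Hc := sf_cfr_sys (chart x) k (chart_dom x) Hs.
rewrite /xs Xw_dd //.
by have -> // : cfr (@fr _ _ _ E x) k s = (fun z => coord (frame E x z) k (s z))
  by apply/funext => z; rewrite cfr_fr.
Qed.

Lemma jet_lin r x c (s s' : sect E) : sv x s -> sv x s' ->
  jet r x (fun z => c *: s z + s' z : E z) = c *: jet r x s + jet r x s'.
Proof.
move=> Hs Hs'; rewrite !jetE //; last exact: svE_lin (sf_cst _ _) Hs Hs'.
apply/ffunP => a; rewrite !ffunE scaler_sumr -big_split; apply: eq_bigr => k _ /=.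
by rewrite (oplin_xs (chart x)) ?scalerDl ?scalerA //; exact: chart_dom.
Qed.

Lemma jet_0 r x : jet r x (fun z => 0 : E z) = 0.
Proof.
have H0 := svE_0 E x; have := jet_lin r (-1) H0 H0.
rewrite scaleN1r addNr => <-; congr (jet r x _).
by apply: functional_extensionality_dep => z; rewrite scaler0 addr0.
Qed.

Lemma jet_sum r x (I : Type) (l : seq I) (P : pred I) c (s : I -> sect E) :
  (forall i, sv x (s i)) ->
  jet r x (fun z => \sum_(i <- l | P i) c i *: s i z : E z) = \sum_(i <- l | P i) c i *: jet r x (s i).
Proof.
move=> Hs; elim: l => [|i l IH].
  rewrite big_nil -[RHS](jet_0 r x); congr (jet r x _).
  by apply: functional_extensionality_dep => z; rewrite big_nil.
rewrite big_cons; case: ifP => Pi; last first.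
  rewrite -IH; congr (jet r x _).
  by apply: functional_extensionality_dep => z; rewrite big_cons Pi.
rewrite -IH -jet_lin //; last first.
  by apply: svE_sum => k _; apply: svE_scale => //; exact: sf_cst.
congr (jet r x _).
by apply: functional_extensionality_dep => z; rewrite big_cons Pi.
Qed.

Lemma jet_eq0P r x (s : sect E) : sv x s -> jet r x s = 0 <->
  forall w k, sorted (@leo n) w -> (size w <= r)%N -> xs (dX x) (@fr _ _ _ E x) w k s x = 0.
Proof.
move=> Hs; rewrite jetE //; split=> [J w k sw wr|H]; last first.
  apply/ffunP => a; rewrite !ffunE big1 // => k _.
  rewrite H ?scale0r //; first exact: sorted_mword.
  by rewrite size_mword -ltnS; exact: bmdeg.
have ad : (mdeg (mnw w) < r.+1)%N by rewrite mdeg_mnw ltnS.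
move/ffunP: J => /(_ (BMultinom ad)); rewrite !ffunE /= mword_mnw // => J.
have b := sys_eb (chart x) (chart_dom x).
by rewrite -(cfr_eq (fun k => xs (dX x) (@fr _ _ _ E x) w k s x) k b) J linear0.
Qed.

(** Two systems determine each other's iterated derivatives, so that any of them can
    replace the coordinates that define jets. *)
Lemma jet_eq0_sys r x W X isY K (e : 'I_K -> sect E) (s : sect E) :
  system W X isY e -> W x -> sv x s -> jet r x s = 0 <->
  forall w k, sorted (@leo n) w -> (size w <= r)%N -> xs X e w k s x = 0.
Proof.
move=> S Wx Hs.
pose V := W `&` (dom x `&` tdom E x).
have oV : open V by apply: openI; [exact: sys_open S|exact: sys_open (chart x)].
have Vx : V x by split=> //; exact: chart_dom.
have S1 := system_sub oV (@subIsetl _ _ _) S.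
have S2 := system_sub oV (@subIsetr _ _ _) (chart x).
rewrite (jet_eq0P r Hs); split=> H w k sw wr.
  apply: (span_zero Vx Hs _ (compare_systems S2 S1 w k)) => b [v [l [-> sv' vr _]]].
  by apply: H => //; rewrite -ltnS (leq_trans vr).
apply: (span_zero Vx Hs _ (compare_systems S1 S2 w k)) => b [v [l [-> sv' vr _]]].
by apply: H => //; rewrite -ltnS (leq_trans vr).
Qed.

Lemma jet_eq_sys r x W X isY K (e : 'I_K -> sect E) (s s' : sect E) t :
  system W X isY e -> W x -> sv x s -> sv x s' -> jet r x s = jet r x s' ->
  span W (Bs X isY e r.+1 false) t -> t s x = t s' x.
Proof.
move=> S Wx Hs Hs' J St.
have Hd : sv x (fun z => (-1) *: s' z + s z : E z) by exact: svE_lin (sf_cst _ _) Hs' Hs.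
have J0 : jet r x (fun z => (-1) *: s' z + s z : E z) = 0.
  by rewrite jet_lin // J scaleN1r addNr.
have := Bs_oplin S St (-1) Wx Hs' Hs.
rewrite (span_zero Wx Hd _ St); last first.
  move=> b [v [l [-> sv' vr _]]].
  exact: ((jet_eq0_sys r S Wx Hd).1 J0 v l sv' vr).
by move=> /eqP; rewrite mulN1r eq_sym addrC subr_eq0 => /eqP.
Qed.

Section Realize.
Variables (r : nat) (x : M).

(** Normalized monomials in the coordinates, so that their derivatives at [x] are
    Kronecker symbols. *)
Definition mono (b : multinom n) : M -> C :=
  fun y => \prod_k ((coordfun x k y - coordfun x k x) ^+ b k * (b k)`!%:R^-1).

Lemma sf_mono1 k m y : dom x y ->
  sf y (fun y => (coordfun x k y - coordfun x k x) ^+ m * m`!%:R^-1).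
Proof.
move=> dy; apply: sf_mul; last exact: sf_cst.
apply: (@sf_ext _ _ _ _ (fun y => \prod_(i < m) (coordfun x k y - coordfun x k x))).
  by apply: nearW => z; rewrite prodr_const card_ord.
by apply: sf_prod => i _; apply: sf_add; [exact: sf_coord|exact: sf_cst].
Qed.

Lemma sf_mono b y : dom x y -> sf y (mono b).
Proof. by move=> dy; apply: sf_prod => k _; exact: sf_mono1. Qed.

Lemma dd_mono1 i k m y : dom x y ->
  dd x i (fun y => (coordfun x k y - coordfun x k x) ^+ m * m`!%:R^-1) y =
  if (k == i) && (m != 0)%N then
    (coordfun x k y - coordfun x k x) ^+ m.-1 * m.-1`!%:R^-1 else 0.
Proof.
move=> dy.
have Hu z : dom x z -> sf z (fun y => coordfun x k y - coordfun x k x).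
  by move=> dz; apply: sf_add; [exact: sf_coord|exact: sf_cst].
have Hp p z : dom x z -> sf z (fun y => (coordfun x k y - coordfun x k x) ^+ p).
  move=> dz; apply: (@sf_ext _ _ _ _ (fun y => \prod_(i < p) (coordfun x k y - coordfun x k x))).
    by apply: nearW => t; rewrite prodr_const card_ord.
  by apply: sf_prod => l _; exact: Hu.
have Du : dd x i (fun y => coordfun x k y - coordfun x k x) y = (k == i)%:R.
  rewrite (dd_add i dy (@sf_coord _ _ M x y k dy) (sf_cst y (- coordfun x k x))).
  by rewrite dd_cst addr0 dd_coord.
have Dp p : dd x i (fun y => (coordfun x k y - coordfun x k x) ^+ p) y =
    (k == i)%:R * p%:R * (coordfun x k y - coordfun x k x) ^+ p.-1.
  elim: p => [|p IH]; first by rewrite dd_cst mulr0 mul0r.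
  have -> : (fun y => (coordfun x k y - coordfun x k x) ^+ p.+1) =
     (fun y => (coordfun x k y - coordfun x k x) * (coordfun x k y - coordfun x k x) ^+ p).
    by apply/funext => z; rewrite exprS.
  rewrite dd_mul ?IH ?Du //; [|exact: Hu|exact: Hp].
  case: p {IH} => [|p] /=; first by rewrite !expr0; ring.
  by rewrite exprS -[p.+2]addn1 natrD; ring.
rewrite (dd_mul i dy (Hp m y dy) (sf_cst y _)) dd_cst mulr0 addr0 Dp.
case: (k == i); last by rewrite !mul0r.
case: m => [|m] /=; first by rewrite mulr0 !mul0r.
rewrite mul1r mulrAC [in RHS]mulrC; congr (_ * _).
have f0 : (m`!)%:R != 0 :> C by rewrite pnatr_eq0 -lt0n fact_gt0.
have m0 : (m.+1)%:R != 0 :> C by rewrite pnatr_eq0.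
by rewrite factS natrM invfM mulrA mulfV // mul1r.
Qed.

Lemma dd_prod0 i (I : Type) (l : seq I) (P : pred I) (F : I -> M -> C) y : dom x y ->
  (forall k, P k -> sf y (F k)) -> (forall k, P k -> dd x i (F k) y = 0) ->
  dd x i (fun z => \prod_(k <- l | P k) F k z) y = 0.
Proof.
move=> dy HF DF; elim: l => [|k l IH].
  rewrite -[RHS](dd_cst x y i 1); apply: dd_near_eq => //.
  by apply: nearW => z; rewrite big_nil.
case Pk: (P k).
  have -> : dd x i (fun z => \prod_(j <- k :: l | P j) F j z) y =
    dd x i (fun z => F k z * \prod_(j <- l | P j) F j z) y.
    by apply: dd_near_eq => //; apply: nearW => z; rewrite big_cons Pk.
  rewrite dd_mul ?DF ?IH ?mul0r ?mulr0 ?addr0 //; first exact: HF.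
  exact: sf_prod.
rewrite -[RHS]IH; apply: dd_near_eq => //.
by apply: nearW => z; rewrite big_cons Pk.
Qed.

Lemma dd_mono i b y : dom x y ->
  dd x i (mono b) y = if b i != 0%N then mono (mnm_sub b (mnm1 i)) y else 0.
Proof.
move=> dy.
have E1 c z : mono c z = (coordfun x i z - coordfun x i x) ^+ c i * (c i)`!%:R^-1 *
    \prod_(k | k != i) ((coordfun x k z - coordfun x k x) ^+ c k * (c k)`!%:R^-1).
  by rewrite /mono (bigD1 i).
rewrite (_ : mono b = fun z => (coordfun x i z - coordfun x i x) ^+ b i * (b i)`!%:R^-1 *
    \prod_(k | k != i) ((coordfun x k z - coordfun x k x) ^+ b k * (b k)`!%:R^-1)); last first.
  by apply/funext => z; rewrite E1.
rewrite dd_mul //; [|exact: sf_mono1|by apply: sf_prod => k _; exact: sf_mono1].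
rewrite dd_prod0 // ?mulr0 ?addr0; [|by move=> k _; exact: sf_mono1|]; last first.
  by move=> k ki; rewrite dd_mono1 // (negPf ki).
rewrite dd_mono1 // eqxx /=; case: ifP => // bi; last by rewrite mul0r.
rewrite E1 mnmBE mnm1E eqxx subn1; congr (_ * _).
by apply: eq_bigr => k ki; rewrite mnmBE mnm1E eq_sym (negPf ki) subn0.
Qed.

Lemma fold_mono w b y : dom x y -> foldr (dd x) (mono b) w y =
  if [forall i, (count_mem i w <= b i)%N] then mono (mnm_sub b (mnw w)) y else 0.
Proof.
elim: w y => [|i w IH] y dy /=.
  have -> : [forall i : 'I_n, (0 <= b i)%N] by apply/forallP.
  by congr mono; apply/mnmP => k; rewrite mnmBE mnwE subn0.
pose c := [forall k, (count_mem k w <= b k)%N].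
have -> : dd x i (foldr (dd x) (mono b) w) y =
   dd x i (fun z => (if c then mono (mnm_sub b (mnw w)) z else 0)) y.
  by apply: dd_near_eq => //; apply: filterS (near_dom dy) => z dz; rewrite IH.
have -> : [forall k, ((i == k) + count_mem k w <= b k)%N] =
    c && ((mnm_sub b (mnw w)) i != 0%N).
  rewrite mnmBE mnwE -lt0n subn_gt0; apply/forallP/andP => [H|[/forallP H Hi] k].
    split; first by apply/forallP => k; apply: leq_trans (H k); exact: leq_addl.
    by have := H i; rewrite eqxx.
  by case: eqVneq => [<-|_]; [rewrite add1n|rewrite add0n].
case: c => /=; last by rewrite dd_cst.
rewrite dd_mono //; case: ifP => // _; congr mono; apply/mnmP => k.
by rewrite !mnmBE !mnwE mnm1E /= -subnDA addnC.
Qed.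

Lemma mono_at b : mono b x = (b == @mnm0 n)%:R.
Proof.
rewrite /mono; case: eqP => [->|b0].
  by rewrite big1 // => k _; rewrite mnm0E expr0 fact0 invr1 mulr1.
have [k bk] : exists k, b k != 0%N.
  apply: contrapT => H; apply: b0; apply/mnmP => k; rewrite mnm0E; apply/eqP.
  by apply/negP => /negP bk; apply: H; exists k.
by rewrite (bigD1 k) //= subrr expr0n (negPf bk) !mul0r.
Qed.

Lemma fold_mono_at a b : foldr (dd x) (mono b) (mword a) x = (a == b)%:R.
Proof.
rewrite fold_mono; last exact: mem_dom.
have -> : [forall i, (count_mem i (mword a) <= b i)%N] = [forall i, (a i <= b i)%N].
  by apply: eq_forallb => i; rewrite count_mword.
rewrite mnw_mword mono_at; case: (eqVneq a b) => [->|ab].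
  have -> : [forall i, (b i <= b i)%N] by apply/forallP.
  by rewrite (_ : (mnm_sub b b == mnm0)) //; apply/eqP/mnmP => i; rewrite mnmBE mnm0E subnn.
case: ifP => // /forallP H; case: eqP => // /mnmP E0; case/eqP: ab; apply/mnmP => i.
by have := E0 i; rewrite mnmBE mnm0E => /eqP; rewrite subn_eq0 => bi; apply/eqP; rewrite eqn_leq H bi.
Qed.

(** The section that is polynomial in the chart and the frame around [x], with a
    prescribed jet. *)
Definition realize (v : Jet E r x) : sect E := fun y =>
  \sum_(b : bmultinom n r.+1) \sum_k (coord (frame E x x) k (v b) * mono b y) *: fr k y.

Lemma sv_realize v y : dom x y -> tdom E x y -> sv y (realize v).
Proof.
move=> dy ty; apply: svE_sum => b _; apply: svE_sum => k _; apply: svE_scale.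
  by apply: sf_mul; [exact: sf_cst|exact: sf_mono].
exact: sv_fr.
Qed.

Lemma sv_realize_self v : sv x (realize v).
Proof. by apply: sv_realize; [exact: mem_dom|exact: mem_tdom]. Qed.

Lemma realize_lin c u v : realize (c *: u + v) = fun y => c *: realize u y + realize v y : E y.
Proof.
apply: functional_extensionality_dep => y; rewrite /realize scaler_sumr -big_split.
apply: eq_bigr => b _ /=; rewrite scaler_sumr -big_split; apply: eq_bigr => k _ /=.
by rewrite !ffunE linearP mulrDl scalerDl scalerA mulrA.
Qed.

Lemma fold_dd_sum w (I : Type) (l : seq I) c (F : I -> M -> C) y : dom x y ->
  (forall i z, dom x z -> sf z (F i)) ->
  foldr (dd x) (fun z => \sum_(i <- l) c i * F i z) w y =
  \sum_(i <- l) c i * foldr (dd x) (F i) w y.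
Proof.
move=> dy HF; elim: w y dy => // i w IH y dy /=.
have Hw k z : dom x z -> sf z (foldr (dd x) (F k) w).
  by move=> dz; elim: (w) => [|i' v IHv] /=; [exact: HF|exact: sf_dd].
have -> : dd x i (foldr (dd x) (fun z => \sum_(i <- l) c i * F i z) w) y =
   dd x i (fun z => \sum_(k <- l) c k * foldr (dd x) (F k) w z) y.
  by apply: dd_near_eq => //; apply: filterS (near_dom dy) => z dz; rewrite IH.
elim: l {IH} => [|k l IHl].
  rewrite big_nil -[RHS](dd_cst x y i 0); apply: dd_near_eq => //.
  by apply: nearW => z; rewrite big_nil.
rewrite big_cons -IHl.
have -> : dd x i (fun z => \sum_(k <- k :: l) c k * foldr (dd x) (F k) w z) y =
  dd x i (fun z => c k * foldr (dd x) (F k) w z + \sum_(k <- l) c k * foldr (dd x) (F k) w z) y.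
  by apply: dd_near_eq => //; apply: nearW => z; rewrite big_cons.
have H1 : sf y (fun z => c k * foldr (dd x) (F k) w z).
  by apply: sf_mul; [exact: sf_cst|exact: Hw].
rewrite dd_add //; last by apply: sf_sum => k' _; apply: sf_mul; [exact: sf_cst|exact: Hw].
congr (_ + _); rewrite dd_mul ?dd_cst ?mul0r ?add0r //; [exact: sf_cst|exact: Hw].
Qed.

Lemma jet_realize v : jet r x (realize v) = v.
Proof.
rewrite jetE; last exact: sv_realize_self.
apply/ffunP => a; rewrite ffunE [in RHS](frame_expand (v a) (mem_tdom E x)).
apply: eq_bigr => k _; congr (_ *: _).
have d := mem_dom x.
have E1 : {near x, cfr (@fr _ _ _ E x) k (realize v) =1
    (fun z => \sum_(b : bmultinom n r.+1) coord (frame E x x) k (v b) * mono b z)}.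
  apply: filterS (near_tdom (mem_tdom E x)) => z tz; rewrite cfr_fr /realize linear_sum.
  apply: eq_bigr => b _; rewrite linear_sum /=.
  have /andP [_ fz] := frame_basis tz.
  have cf l : coord (frame E x z) k (fr l z) = (k == l)%:R.
    by rewrite /fr (tnth_nth 0) coord_free // eq_sym.
  under eq_bigr do rewrite linearZ /= cf.
  rewrite (bigD1 k) //= eqxx mulr1 big1 ?addr0 // => l lk.
  by rewrite eq_sym (negPf lk) mulr0.
have Hc := sf_cfr_sys (chart x) k (chart_dom x) (sv_realize_self v).
have near_fold w f g : {near x, f =1 g} -> foldr (dd x) f w x = foldr (dd x) g w x.
  move=> fg; suff : {near x, foldr (dd x) f w =1 foldr (dd x) g w} by move/nbhs_singleton.
  elim: w => //= i w IH; apply: near2 (near_near IH) (near_dom d) _ => z Hz dz.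
  exact: dd_near_eq.
rewrite /xs Xw_dd // (near_fold _ _ _ E1) fold_dd_sum //; last first.
  by move=> b z dz; exact: sf_mono.
rewrite (bigD1 a) //= fold_mono_at eqxx mulr1 big1 ?addr0 // => b ba.
by rewrite fold_mono_at eq_sym (negPf (_ : bmnm b != bmnm a)) ?mulr0.
Qed.

End Realize.
End Jets.

(** * Adapted frames *)

Section Adapted.
Variables (R : realType) (n : nat) (M : manifold R n).
Local Notation C := (R[i]).
Implicit Types (f g : M -> C) (x y z : M).
Variable P : forall x : M, {vspace TMC M x}.
Variables (Q : vbundle M) (proj : forall x : M, 'Hom(TMC M x, Q x)).
Variables (E : vbundle M) (dE : sect E -> forall x : M, 'Hom(Pbundle P x, E x)).
Variable j : forall x : M, 'Hom(Q x, TMC M x).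

(** The lifts of the frame of [Q] come first and the frame of [P] last, so that
    sorted words have the directions of [P] at the end; the frame of [E] is closed. *)
Record adapted (x0 : M) (W : set M) (X : 'I_n -> sect (TMC M)) (K : nat)
    (e : 'I_K -> sect E) : Prop := Adapted {
  ad_sys : system W X (fun i : 'I_n => (\dim {:Q x0} <= i)%N) e;
  ad_q : (\dim {:Q x0} <= n)%N;
  ad_X : forall (k : 'I_(\dim {:Q x0})) y, W y -> X (widen_ord ad_q k) y = j y (vb k y);
  ad_P : forall (i : 'I_n) y, W y -> (\dim {:Q x0} <= i)%N -> X i y \in P y;
  ad_Pc : forall y v (i : 'I_n), W y -> v \in P y -> (i < \dim {:Q x0})%N ->
    coord (frtup X y) i v = 0;
  ad_e : forall k y, W y -> dE (e k) y = 0;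
  ad_x : W x0;
  ad_t : forall y, W y -> tdom Q x0 y }.

Hypotheses (subP : is_subbundle P) (invP : involutive P).
Hypotheses (hQ : is_quotient P proj) (hj : is_splitting proj j) (hE : locally_free dE).

(** The coordinates of [vb] in a trivialization are constant, hence independence
    propagates from the base point. *)
Lemma vb_basis x0 y : tdom Q x0 y -> basis_of fullv (frtup (@vb _ _ _ Q x0) y).
Proof.
move=> ty; have dQ z : tdom Q x0 z -> \dim {:Q z} = rk Q x0.
  by move=> tz; rewrite -(vector.size_basis (frame_basis tz)).
have dQy : \dim {:Q y} = \dim {:Q x0} by rewrite !dQ //; exact: mem_tdom.
rewrite basisEfree subvf size_tuple dQy leqnn !andbT.
apply/freeP => c; under eq_bigr do rewrite frtupE.
move=> c0 k; have /andP [_ /freeP fx] := vbasisP {:Q x0}.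
apply: fx.
have /andP [_ /freeP fy] := frame_basis ty.
rewrite (frame_expand (\sum_i _) (mem_tdom Q x0)) big1 // => l _.
rewrite linear_sum /=; suff -> : \sum_i coord (frame Q x0 x0) l (c i *: (vbasis {:Q x0})`_i) = 0.
  by rewrite scale0r.
have H : \sum_l (\sum_i coord (frame Q x0 x0) l (c i *: (vbasis {:Q x0})`_i)) *: (frame Q x0 y)`_l = 0.
  rewrite -[RHS]c0; under [LHS]eq_bigr do rewrite scaler_suml.
  rewrite exchange_big; apply: eq_bigr => i _ /=; rewrite /vb /ext scaler_sumr.
  by apply: eq_bigr => m _; rewrite linearZ scalerA (tnth_nth 0).
exact: (fy _ H).
Qed.

(** The splitting identifies the tangent bundle with the sum of [Q] and [P]; the
    frames of the two summands are put side by side. Involutivity says that a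
    bracket of two fields of [P] has no component along the lifts. *)
Lemma adapted_exists x0 : exists W X K (e : 'I_K -> sect E), adapted x0 W X e.
Proof.
have [U1 [oU1 U1x [p [eP [eP_sm eP_bas]]]]] := subP x0.
have [U2 [oU2 U2x [K [e [e_sm e_bas]]]]] := hE x0.
pose q := \dim {:Q x0}.
pose Wb := U1 `&` U2; pose W := tdom Q x0 `&` Wb.
have oW : open W by apply: openI; [exact: tdom_open|exact: openI].
pose Xs (y : M) : seq 'rV[C]_n :=
  [seq j y (vb k y) | k <- enum 'I_q] ++ [seq eP k y | k <- enum 'I_p].
pose X (i : 'I_n) : sect (TMC M) := fun y => nth 0 (Xs y) i.
have qpn : (q + p)%N = n.
  have dimT : \dim {: TMC M x0} = n by rewrite dimvf; exact: mul1n.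
  have := limg_ker_dim (proj x0) fullv; rewrite dimT capfv.
  have [-> ->] := (hQ.2 x0).
  by rewrite (vector.size_basis (eP_bas x0 U1x)) card_ord addnC.
have qn : (q <= n)%N by rewrite -qpn leq_addr.
have szX y : size (Xs y) = n.
  by rewrite /Xs size_cat (size_map _ (enum 'I_q)) (size_map _ (enum 'I_p)) !size_enum_ord.
have X1 (i : 'I_n) (iq : (i < q)%N) : X i = jfield j (vb (Ordinal iq)).
  apply: functional_extensionality_dep => y; rewrite /X /Xs nth_cat size_map size_enum_ord iq.
  rewrite (nth_map (Ordinal iq)) ?size_enum_ord //.
  by rewrite (nth_ord_enum (Ordinal iq) (Ordinal iq)).
have X2 (i : 'I_n) : (q <= i)%N -> exists k, X i = eP k.
  move=> qi; have ip : (i - q < p)%N by rewrite ltn_subLR // qpn.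
  exists (Ordinal ip); apply: functional_extensionality_dep => y.
  rewrite /X /Xs nth_cat size_map size_enum_ord ltnNge qi /=.
  rewrite (nth_map (Ordinal ip)) ?size_enum_ord //.
  by rewrite (nth_ord_enum (Ordinal ip) (Ordinal ip)).
have projj y (v : Q y) : proj y (j y v) = v.
  by have := hj.2 y => /lfunP/(_ v); rewrite comp_lfunE id_lfunE.
have memP y v : (v \in P y) = (proj y v == 0) by rewrite -(hQ.2 y).2 memv_ker.
have Xs_bas y : W y -> basis_of fullv (Xs y).
  move=> [ty [U1y U2y]].
  have b1 : basis_of (limg (j y)) [seq j y (vb k y) | k <- enum 'I_q].
    rewrite (map_comp (j y) (fun k => vb k y)); apply: limg_basis_of.
      apply/eqP; rewrite -subv0; apply/subvP => v /memv_capP [_].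
      by rewrite memv_ker memv0 => /eqP jv; rewrite -(projj y v) jv linear0.
    exact: vb_basis.
  have b2 := eP_bas y U1y.
  have dir : directv (limg (j y) + P y).
    apply/directv_addP/eqP; rewrite -subv0; apply/subvP => v /memv_capP [/memv_imgP [u _ ->]].
    by rewrite memP projj memv0 => /eqP ->; rewrite linear0.
  have -> : fullv = (limg (j y) + P y)%VS.
    apply/eqP; rewrite eqEsubv subvf andbT; apply/subvP => v _.
    have -> : v = j y (proj y v) + (v - j y (proj y v)) by rewrite addrC subrK.
    apply: memv_add; first exact: memv_img (memvf _).
    by rewrite memP linearB /= projj subrr.
  exact: cat_basis.
have X_bas y : W y -> basis_of fullv (frtup X y).
  move=> Wy; have := Xs_bas y Wy; congr basis_of.
  apply: (@eq_from_nth _ 0); rewrite szX ?size_tuple // => i im.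
  by rewrite (frtupE X y (Ordinal im)).
have X_P (i : 'I_n) y : W y -> (q <= i)%N -> X i y \in P y.
  move=> [_ [U1y _]] /X2 [k ->]; apply: (basis_mem (eP_bas y U1y)).
  by apply/mapP; exists k => //; rewrite mem_enum.
have Pc y v (i : 'I_n) : W y -> v \in P y -> (i < q)%N -> coord (frtup X y) i v = 0.
  move=> Wy; rewrite memP => /eqP pv iq.
  have vE : v = \sum_k coord (frtup X y) k v *: X k y.
    exact: (cfr_expand (e := X) (fun=> v) (X_bas y Wy)).
  have : \sum_(k < q) coord (frtup X y) (widen_ord qn k) v *: vb k y = 0.
    rewrite -[RHS]pv [in RHS]vE linear_sum /= (bigID (fun k : 'I_n => (k < q)%N)) /=.
    rewrite [X in _ = _ + X]big1 ?addr0; last first.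
      move=> k; rewrite -leqNgt => qk; have := X_P k y Wy qk; rewrite memP linearZ /= => /eqP ->.
      by rewrite scaler0.
    rewrite (big_ord_narrow qn); apply: eq_bigr => k _; rewrite linearZ /=; congr (_ *: _).
    have kq : (widen_ord qn k < q)%N by exact: ltn_ord k.
    by rewrite (X1 _ kq) projj; congr (vb _ y); exact: val_inj.
  have /andP [_ /freeP fv] := vb_basis Wy.1 => H0.
  have := fv (fun k => coord (frtup X y) (widen_ord qn k) v).
  under eq_bigr do rewrite frtupE.
  move=> /(_ H0 (Ordinal iq)) <-; congr (coord _ _ v); exact: val_inj.
have X_sm i y : W y -> sv y (X i).
  move=> [ty [U1y U2y]]; have [iq|qi] := ltnP i q.
    by rewrite (X1 _ iq); apply: (sv_j hj.1); exact: sv_ext.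
  by have [k ->] := X2 i qi; exists U1.
exists W, X, K, e; apply: (@Adapted x0 W X K e _ qn) => //.
- split=> //.
  + move=> i k y l Yi Yk Wy; rewrite -ltnNge => lq; apply: Pc => //.
    have oXs i' : sm W (X i' : sect (TMC M)).
      by apply: (localb_TMC M).2 => // z; exact: X_sm.
    by apply: (invP oW (oXs i) (oXs k)) => // z Wz; exact: X_P.
  + by move=> i k qi ik; exact: leq_trans qi ik.
  + by move=> k y [_ [_ U2y]]; exists U2; split=> //; exact: (e_sm k).1.
  by move=> y [_ [_ U2y]]; exact: e_bas.
- move=> k y Wy; have kq : (widen_ord qn k < q)%N by exact: ltn_ord k.
  by rewrite (X1 _ kq) /jfield; congr (j y (vb _ y)); exact: val_inj.
- by move=> k y [_ [_ U2y]]; exact: (e_sm k).2.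
- by split=> //; exact: mem_tdom.
by move=> y [ty _].
Qed.

End Adapted.

(** * Operators on jets and the fibres of the reduced jet bundle *)

Lemma linfunE (K : fieldType) (aT rT : vectType K) (f : aT -> rT) : linear f ->
  forall v, linfun f v = f v.
Proof.
move=> lf v; pose LL := GRing.isLinear.Build _ _ _ _ f lf.
pose LH : {linear aT -> rT} := HB.pack f LL.
exact: (lfunE LH v).
Qed.

Section JetBundle.
Variables (R : realType) (n : nat) (M : manifold R n).
Local Notation C := (R[i]).
Implicit Types (f g : M -> C) (x y z : M).

(** Bundles whose smooth sections form a sheaf of modules over smooth functions. *)
Record goodb (F : bundle M) : Prop := Goodb {
  gb_loc : localb F;
  gb_near : forall y (s t : sect F), (\forall z \near y, s z = t z) -> sv y s -> sv y t;
  gb_0 : forall y, sv y (fun z => 0 : F z);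
  gb_lin : forall y c (s t : sect F), sf y c -> sv y s -> sv y t ->
    sv y (fun z => c z *: s z + t z : F z) }.

Lemma goodb_vbundle (E : vbundle M) : goodb E.
Proof.
split; [exact: localb_vbundle|exact: svE_near_eq|exact: svE_0|].
by move=> y c s t; exact: svE_lin.
Qed.

Lemma goodb_trivial : goodb (trivial_line M).
Proof.
split; [exact: localb_trivial| |by move=> y; exact: sf_cst|].
  by move=> y s t; exact: sf_ext.
by move=> y c s t Hc Hs Ht; apply: sf_add => //; exact: sf_mul.
Qed.

Lemma gb_sum (F : bundle M) y (I : Type) (l : seq I) (c : I -> M -> C) (s : I -> sect F) :
  goodb F -> (forall i, sf y (c i)) -> (forall i, sv y (s i)) ->
  sv y (fun z => \sum_(i <- l) c i z *: s i z : F z).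
Proof.
move=> gF Hc Hs; elim: l => [|i l IH].
  by apply: gb_near (gb_0 gF y) => //; apply: nearW => z; rewrite big_nil.
apply: (gb_near gF) (gb_lin gF (Hc i) (Hs i) IH).
by apply: nearW => z; rewrite big_cons.
Qed.

Variable E : vbundle M.

Lemma svJP r y (sigma : sect (Jet E r)) : sv y sigma <-> exists V, [/\ open V, V y &
   exists (m : nat) (f : 'I_m -> M -> C) (s : 'I_m -> sect E),
        (forall i, smooth_fun V (f i) /\ sm V (s i)) /\
        (forall z, V z -> sigma z = \sum_(i < m) f i z *: jet r z (s i))].
Proof.
split=> [[U [oU Uy H]]|[V [oV Vy H]]]; first by have [V [oV Vy _ H']] := H y Uy; exists V.
by exists V; split=> // x Vx; exists V; split.
Qed.

Lemma sv_jet r y (s : sect E) : sv y s -> sv y (fun z => jet r z s : Jet E r z).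
Proof.
move=> [U [oU Uy Hs]]; apply/svJP; exists U; split=> //; exists 1%N, (fun _ _ => 1), (fun=> s).
split=> [_|z _]; last by rewrite big_ord1 scale1r.
by split=> // x; exact: smooth_cst.
Qed.

Lemma sv_jet_sum r y (I : finType) (c : I -> M -> C) (s : I -> sect E) :
  (forall i, sf y (c i)) -> (forall i, sv y (s i)) ->
  sv y (fun z => \sum_i c i z *: jet r z (s i) : Jet E r z).
Proof.
move=> Hc Hs.
have N : \forall z \near y, forall i, sf z (c i) /\ sv z (s i).
  by apply: filter_forall => i; apply: nearI; [exact: sf_near|exact: sv_nearP].
have [V [oV Vy HV]] := nearP N.
apply/svJP; exists V; split=> //.
exists #|I|, (fun i => c (enum_val i)), (fun i => s (enum_val i)); split.
  move=> i; split; first by apply/smooth_funP => // z Vz; have [] := HV z Vz (enum_val i).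
  by apply: (localb_vbundle E).2 => // z Vz; have [] := HV z Vz (enum_val i).
move=> z _; rewrite [LHS](reindex (@enum_val I I)) //.
by apply: onW_bij; exact: enum_val_bij.
Qed.

Lemma sm_Jet_sub r U W (s : sect (Jet E r)) : open W -> W `<=` U -> sm U s -> sm W s.
Proof.
move=> oW WU Hs x Wx; have [V [oV Vx VU [m [f [t [H1 H2]]]]]] := Hs x (WU _ Wx).
have oVW := openI oV oW.
exists (V `&` W); split=> //.
exists m, f, t; split=> [i|y [Vy _]]; last exact: H2.
split; first exact: smooth_fun_sub (@subIsetl _ V W) (H1 i).1.
exact: ((localb_vbundle E).1 _ _ _ oVW (@subIsetl _ V W) (H1 i).2).
Qed.

Lemma localb_Jet r : localb (Jet E r).
Proof.
split=> [U W s oW WU|U s oU H x Ux]; first exact: sm_Jet_sub.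
have [V [oV Vx Hs]] := H x Ux.
have Hs' := sm_Jet_sub (openI oU oV) (@subIsetr _ U V) Hs.
have [W [oW Wx WUV HW]] := Hs' x (conj Ux Vx); exists W; split=> //.
by move=> z /WUV [].
Qed.

(** Jets of sections generate the jet bundle. *)
Lemma smooth_homJ (F : bundle M) r U (A : forall x, 'Hom(Jet E r x, F x)) : goodb F -> open U ->
  smooth_hom U A <-> forall y (s : sect E), U y -> sv y s ->
    sv y (fun z => A z (jet r z s) : F z).
Proof.
move=> gF oU; have lF := gb_loc gF; rewrite (smooth_homP _ (localb_Jet r) lF oU); split=> H y s Uy Hs.
  by apply: (H y (fun z => jet r z s)) => //; exact: sv_jet.
have /svJP [V [oV Vy [m [f [t [H1 H2]]]]]] := Hs.
have S1 : sv y (fun z => \sum_(i < m) f i z *: A z (jet r z (t i)) : F z).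
  apply: gb_sum => // i; first exact: sf_open oV (H1 i).1 Vy.
  by apply: H => //; exact: sv_open oV (H1 i).2 Vy.
apply: (gb_near gF) S1; apply: filterS (open_nbhs_nbhs (conj oV Vy)) => z Vz.
rewrite H2 // linear_sum; apply: eq_bigr => i _.
by rewrite linearZ.
Qed.

(** The jet is realized by a section; the choice is immaterial for operators that
    only depend on jets. *)
Definition opJ (F : bundle M) r x (t : sect E -> F x) : 'Hom(Jet E r x, F x) :=
  linfun (fun v : Jet E r x => t (realize v)).

Lemma opJE (F : bundle M) r x (t : sect E -> F x) :
  (forall c s s', sv x s -> sv x s' -> t (fun z => c *: s z + s' z : E z) = c *: t s + t s') ->
  (forall s s', sv x s -> sv x s' -> jet r x s = jet r x s' -> t s = t s') ->
  forall s, sv x s -> opJ r t (jet r x s) = t s.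
Proof.
move=> tlin tjet s Hs; rewrite /opJ linfunE.
  by apply: tjet => //; [exact: sv_realize_self|rewrite jet_realize].
move=> c u v; rewrite realize_lin tlin //; exact: sv_realize_self.
Qed.

End JetBundle.

Section TildeChar.
Variables (R : realType) (n : nat) (M : manifold R n).
Local Notation C := (R[i]).
Implicit Types (f g : M -> C) (x y z : M).
Variable P : forall x : M, {vspace TMC M x}.
Variables (Q E : vbundle M) (dE : sect E -> forall x : M, 'Hom(Pbundle P x, E x)).
Variable j : forall x : M, 'Hom(Q x, TMC M x).
Hypothesis conE : is_connection (F := Pbundle P) (fun x v => vsval v) dE.
Variables (x0 : M) (W : set M) (X : 'I_n -> sect (TMC M)) (K : nat) (e : 'I_K -> sect E).
Hypothesis ad : adapted dE j x0 W X e.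

Local Notation S := (ad_sys ad).
Local Notation q := (\dim {:Q x0}).
Local Notation isY := (fun i : 'I_n => (q <= i)%N).
Local Notation B := (Bs X isY e).

Lemma svT_near_eq y (V V' : sect (TMC M)) : (\forall z \near y, V z = V' z) -> sv y V -> sv y V'.
Proof.
move=> VV' /(svT_chart _ (mem_dom y)) H; apply/(svT_chart _ (mem_dom y)) => i.
by apply: sf_ext (H i); apply: filterS VV' => z E0; rewrite /lie E0.
Qed.

Lemma localb_P : localb (Pbundle P).
Proof. by apply: localb_sub; exact: localb_TMC. Qed.

Lemma sv_contract y (Y : sect (Pbundle P)) s : sv y Y -> sv y s -> sv y (contract dE Y s).
Proof. by move=> HY Hs; apply: (conn_smooth localb_P conE). Qed.

Lemma Xw_near_eq y w f g : {near y, f =1 g} -> {near y, Xw X w f =1 Xw X w g}.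
Proof.
move=> fg; elim: w => //= i w IH; apply: filterS (near_near IH) => z Hz.
exact: lie_near_eq.
Qed.

Lemma Xw_eq y w f g : {near y, f =1 g} -> Xw X w f y = Xw X w g y.
Proof. by move=> /(@Xw_near_eq y w f g) H; exact: (nbhs_singleton H). Qed.

(** The frame is closed, hence only the components are differentiated. *)
Lemma cfr_contract k (Y : sect (Pbundle P)) s y : W y -> sv y s ->
  cfr e k (contract dE Y s) y = lie (fun z => vsval (Y z) : TMC M z) (cfr e k s) y.
Proof.
move=> Wy Hs.
have Hc l : sf y (cfr e l s) by exact: (sf_cfr_sys S).
have He l : sv y (e l) by exact: (sys_e S).
have E1 : \forall z \near y, s z = \sum_l cfr e l s z *: e l z.
  by apply: filterS (near_W (sys_open S) Wy) => z Wz; exact: cfr_expand (sys_eb S Wz).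
rewrite {1}/cfr /contract (conn_near_eq conE Hs _ E1); last first.
  by apply: svE_sum => l _; exact: svE_scale.
rewrite (conn_sum conE) => [|l]; last exact: svE_scale.
under eq_bigr do rewrite (conn_scale conE) // (ad_e ad) // lfunE /= scaler0 addr0.
exact: cfr_eq (sys_eb S Wy).
Qed.

Lemma Xw_rcons w i f : Xw X (rcons w i) f = Xw X w (lie (X i) f).
Proof. by rewrite /Xw foldr_rcons. Qed.

Lemma opJ_span r y t s : W y -> span W (B r.+1 false) t -> sv y s ->
  opJ (F := trivial_line M) r (fun s => t s y) (jet r y s) = t s y.
Proof.
move=> Wy St; apply: opJE => [c u v Hu Hv|u v Hu Hv J].
  exact: (Bs_oplin S St).
exact: jet_eq_sys S Wy Hu Hv J St.
Qed.

Lemma smooth_opJ r t : span W (B r.+1 false) t ->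
  smooth_hom W (fun y => opJ (F := trivial_line M) r (fun s => t s y)).
Proof.
move=> St; apply/(smooth_homJ _ (goodb_trivial M) (sys_open S)) => y s Wy Hs.
apply: (@sf_ext _ _ _ _ (t s)); last exact: (Bs_smoothing S St).
by apply: near2 (near_W (sys_open S) Wy) (sv_nearP Hs) _ => z Wz Hz; rewrite opJ_span.
Qed.

(** If [w] contains a direction of the distribution and is sorted it ends with one,
    say along [Y], and the iterated derivative is an operator of the form
    [Phi o iota_Y o d_P] since the frame of [E] is closed. Conversely an operator of
    this form is a combination of iterated derivatives along words that end in
    the distribution, hence, after sorting, of those in the statement. *)
Lemma tilde_condP r y (s : sect E) : W y -> sv y s ->
  tilde_cond dE (jet r y s) <-> forall w k, sorted (@leo n) w -> has isY w ->
    (size w <= r)%N -> xs X e w k s y = 0.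
Proof.
case: r => [|r] Wy Hs; first by split=> // _ [|i w] k.
have oW := sys_open S.
split=> [Ht w k sw Yw wr|H].
  have := has_endsY S sw Yw; case/lastP: w sw Yw wr => // w i sw _; rewrite size_rcons ltnS => wr Yi.
  have {}Yi : (q <= i)%N.
    by move: Yi; rewrite /endsY; case: (w) => //= l v; rewrite last_rcons.
  pose Y : sect (Pbundle P) := fun z => vsproj (P z) (X i z).
  have YE z : W z -> vsval (Y z) = X i z.
    by move=> Wz; rewrite vsprojK //; exact: (ad_P ad).
  have sY : sm W Y.
    apply: localb_P.2 => // z Wz; apply: (@svT_near_eq z (X i)); last exact: (sys_X S).
    by apply: filterS (near_W oW Wz) => t Wt; rewrite YE.
  have Sw : span W (B r.+1 false) (xs X e w k) by apply: (xs_span S).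
  have Swi : span W (B r.+2 false) (xs X e (rcons w i) k).
    by apply: (xs_span S) => //; rewrite size_rcons ltnS.
  have := Ht W Y (fun z => opJ (F := trivial_line M) r (fun s => xs X e w k s z))
    (fun z => opJ (F := trivial_line M) r.+1 (fun s => xs X e (rcons w i) k s z))
    oW Wy sY (smooth_opJ Sw).
  rewrite (opJ_span Wy Swi Hs); apply; split; first exact: smooth_opJ.
  move=> V u z oV VW Vz smu; have Hu : sv z u by exists V.
  have Wz := VW z Vz; have HY : sv z Y by exists W.
  rewrite opJ_span // opJ_span //; last exact: sv_contract.
  rewrite /xs Xw_rcons; apply: Xw_eq.
  apply: near2 (near_W oW Wz) (sv_nearP Hu) _ => t Wt Ht'.
  by rewrite cfr_contract // /lie YE.
(* The jet of order [r] of the contraction with [Y] vanishes. *)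
move=> U Y Phi A oU Uy sY sPhi [sA opA].
have Hs' := Hs; have [V [oV Vy smV]] := Hs'.
have smVU : sm (V `&` U) s.
  exact: ((localb_vbundle E).1 _ _ _ (openI oV oU) (@subIsetl _ V U) smV).
rewrite (opA (V `&` U) s y (openI oV oU) (@subIsetr _ V U) (conj Vy Uy) smVU).
have HY : sv y Y by exists U.
suff -> : jet r y (contract dE Y s) = 0 by rewrite linear0.
pose W' := W `&` U; have oW' : open W' by exact: openI.
have S' := system_sub oW' (@subIsetl _ W U) S.
have W'y : W' y by [].
apply/(jet_eq0_sys r S' W'y); first exact: sv_contract.
move=> w k sw wr.
pose Yv : sect (TMC M) := fun z => vsval (Y z).
have HYv z : W' z -> sv z Yv by move=> [_ Uz]; exists U.
pose t0 : op E := fun s z => lie Yv (cfr e k s) z.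
have St0 : span W' (B 2 true) t0.
  have Si i : span W' (B 2 true) (fun s z => cfr X i Yv z * lie (X i) (cfr e k s) z).
    have [iq|qi] := ltnP i q.
      apply: span_ext (span0 _ _) _ => u z [Wz Uz] _.
      by rewrite /cfr (ad_Pc ad Wz (subvsP (Y z)) iq) mul0r.
    apply: spanZ.
      by move=> z W'z; apply: (sf_cfrX S') => //; exact: HYv.
    apply: span_in; exists [:: i], k; split=> //=.
    by rewrite qi.
  apply: span_ext (span_sum _ Si) _ => u z W'z Hu.
  by rewrite /t0 (lie_expand S').
have Stw v : span W' (B (size v + 2) true) (fun s => Xw X v (t0 s)).
  elim: v => // i v IH; rewrite addSn; apply: (span_raise S') IH => z Wz.
  exact: (sys_X S').
have E1 : xs X e w k (contract dE Y s) y = Xw X w (t0 s) y.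
  apply: Xw_eq.
  apply: near2 (near_W oW' W'y) (sv_nearP Hs) _ => z [Wz Uz] Hz.
  exact: cfr_contract.
rewrite E1; apply: (span_zero W'y Hs _ (Stw w)) => b [v [l [-> sv' vr Yv']]].
by apply: H => //; move: vr; rewrite addn2 !ltnS => /leq_trans; apply; rewrite ltnS.
Qed.

Lemma mem_tildeP r y (s : sect E) : W y -> sv y s ->
  jet r y s \in tilde_jet dE r y <-> forall w k, sorted (@leo n) w -> has isY w ->
    (size w <= r)%N -> xs X e w k s y = 0.
Proof. by move=> Wy Hs; rewrite mem_tilde_jet; exact: tilde_condP. Qed.

(** The span of the iterated derivatives with a direction of the distribution is
    stable under further derivations, by [span_raise]; this is what makes it more
    useful than its generators. *)
Lemma tilde_zero r y s t : W y -> sv y s -> jet r y s \in tilde_jet dE r y ->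
  span W (B r.+1 true) t -> t s y = 0.
Proof.
move=> Wy Hs /(mem_tildeP r Wy Hs) H St.
by apply: (span_zero Wy Hs _ St) => b [v [l [-> sv' vr Yv]]]; exact: H.
Qed.

End TildeChar.

(** * A frame of differential operators and its dual *)

Section DualFrame.
Variables (R : realType) (n : nat) (M : manifold R n).
Local Notation C := (R[i]).
Implicit Types (f g : M -> C) (x y z : M).
Variable P : forall x : M, {vspace TMC M x}.
Variables (Q E : vbundle M) (dE : sect E -> forall x : M, 'Hom(Pbundle P x, E x)).
Variable j : forall x : M, 'Hom(Q x, TMC M x).
Variable nabQ : sect Q -> forall x, 'Hom(TMC M x, Q x).
Variable nabE : sect E -> forall x, 'Hom(TMC M x, E x).
Hypothesis conE : is_connection (F := Pbundle P) (fun x v => vsval v) dE.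
Hypotheses (sj : smooth_hom setT j) (hQ : is_TMC_connection nabQ)
  (hE : is_TMC_connection nabE).
Variables (x0 : M) (W : set M) (X : 'I_n -> sect (TMC M)) (K : nat) (e : 'I_K -> sect E).
Hypothesis ad : adapted dE j x0 W X e.

Local Notation Top := (Top j nabQ nabE).
Local Notation S := (ad_sys ad).
Local Notation oW := (sys_open S).
Local Notation q := (\dim {:Q x0}).
Local Notation isY := (fun i : 'I_n => (q <= i)%N).
Local Notation B := (Bs X isY e).
Local Notation up := (widen_ord (ad_q ad)).

(** The exponents of the lifts of the frame of [Q] in a monomial. *)
Definition dn (a : multinom n) : multinom q := Multinom [tuple a (up i) | i < q].

Lemma dnE a i : dn a i = a (up i).
Proof. exact: mnmE. Qed.

(** The monomials without any direction of the distribution. *)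
Definition horizontal (a : multinom n) := ~~ has isY (mword a).

(** The monomials in the frame of [Q], seen as monomials in the adapted frame. *)
Definition upm (b : multinom q) : multinom n :=
  mnw (map up (mword b)).

Lemma up_inj : injective up.
Proof. by move=> i k /(congr1 val) /= /val_inj. Qed.

Lemma sorted_up (w : seq 'I_q) : sorted (@leo q) w -> sorted (@leo n) (map up w).
Proof. by rewrite sorted_map. Qed.

Lemma mword_upm b : mword (upm b) = map up (mword b).
Proof. by apply: mword_mnw; apply: sorted_up; exact: sorted_mword. Qed.

Lemma horizontal_upm b : horizontal (upm b).
Proof.
rewrite /horizontal mword_upm has_map; apply/hasPn => i _ /=.
by rewrite -ltnNge; exact: ltn_ord.
Qed.

Lemma dn_upm b : dn (upm b) = b.
Proof.
apply/mnmP => i; rewrite dnE mnwE count_map -(count_mword b i).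
by apply: eq_count => k /=; rewrite (inj_eq up_inj).
Qed.

Lemma mdeg_upm b : mdeg (upm b) = mdeg b.
Proof. by rewrite -size_mword mword_upm size_map size_mword. Qed.

Lemma horizontal_mword a : horizontal a -> mword a = map up (mword (dn a)).
Proof.
move=> /hasPn Ha; apply: (sorted_eq (@leo_trans n) (@leo_anti n)).
- exact: sorted_mword.
- by apply: sorted_up; exact: sorted_mword.
apply/allP => i _ /=; apply/eqP; rewrite count_map.
have [iq|qi] := ltnP i q.
  have [i0 ->] : exists i0, i = up i0 by exists (Ordinal iq); exact: val_inj.
  rewrite count_mword -dnE -count_mword; apply: eq_count => k /=.
  by rewrite (inj_eq up_inj).
have -> : count_mem i (mword a) = 0%N.
  by apply/eqP; rewrite -leqn0 leqNgt -has_count; apply/negP => /hasP [k /Ha +] /eqP E0; rewrite E0 qi.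
apply/esym/eqP; rewrite -leqn0 leqNgt -has_count; apply/negP => /hasP [k _ /eqP E0].
by move: qi; rewrite -E0 leqNgt /= ltn_ord.
Qed.

Lemma upm_dn a : horizontal a -> upm (dn a) = a.
Proof. by move=> Ha; rewrite /upm -horizontal_mword // mnw_mword. Qed.

(** The PBW operator of a monomial in the frame of [Q], near the base point. *)
Definition Tb (b : multinom q) (s : sect E) : sect E :=
  Top (fun i : 'I_(size (mword b)) => vb (tnth (in_tuple (mword b)) i)) s.

Lemma sv_vbW (i : 'I_q) y : W y -> sv y (vb i).
Proof. by move=> Wy; apply: sv_ext; exact: (ad_t ad). Qed.

Lemma Tb_span b k : span W (B (mdeg b).+1 false) (fun s => cfr e k (Tb b s)).
Proof.
rewrite -(size_mword b).
exact: (Top_span sj hQ hE S k (fun i y Wy => @sv_vbW (tnth (in_tuple (mword b)) i) y Wy)).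
Qed.

Lemma Tb_lead b k : exists t, span W (B (mdeg b) false) t /\
  forall s y, W y -> sv y s -> cfr e k (Tb b s) y = xs X e (map up (mword b)) k s y + t s y.
Proof.
have [t [St Et]] := Top_lead sj hQ hE S (up := up) sv_vbW
  (fun i y Wy => esym (ad_X ad i Wy)) (tnth (in_tuple (mword b))) k.
exists t; split; first by rewrite -size_mword.
move=> s y Wy Hs; rewrite Et //; congr (xs _ _ _ k s y + _).
have -> : [seq up (tnth (in_tuple (mword b)) i) | i <- enum 'I_(size (mword b))] = map up (mword b).
  rewrite (map_comp up (tnth (in_tuple (mword b)))); congr map.
  by rewrite -[RHS](map_tnth_enum (in_tuple (mword b))).
by apply: srt_uniq => //; apply: sorted_up; exact: sorted_mword.
Qed.

(** A frame of the differential operators of order at most [r]: PBW operators for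
    the horizontal monomials, plain iterated derivatives for the others. It puts
    the PBW operators and the equations of [\tilde J^r] in a single frame. *)
Definition Ob (a : multinom n) (k : 'I_K) : op E := fun s =>
  if horizontal a then cfr e k (Tb (dn a) s) else xs X e (mword a) k s.

(** Unitriangularity with respect to the iterated derivatives along sorted words. *)
Lemma Ob_lead a k : exists t, span W (B (mdeg a) false) t /\
  forall s y, W y -> sv y s -> Ob a k s y = xs X e (mword a) k s y + t s y.
Proof.
rewrite /Ob; case Ha: (horizontal a); last first.
  exists (fun _ _ => 0); split; first exact: span0.
  by move=> s y _ _; rewrite addr0.
have [t [St Et]] := Tb_lead (dn a) k.
exists t; split; first by rewrite -(upm_dn Ha) mdeg_upm.
by move=> s y Wy Hs; rewrite Et // -horizontal_mword.
Qed.

Lemma Ob_span a k r : (mdeg a <= r)%N -> span W (B r.+1 false) (Ob a k).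
Proof.
move=> ar; have [t [St Et]] := Ob_lead a k.
have S1 : span W (B r.+1 false) (xs X e (mword a) k).
  by apply: (xs_span S) => //; rewrite size_mword ltnS.
have S2 : span W (B r.+1 false) t by apply: span_le St; exact: leq_trans ar _.
by apply: span_ext (spanD S1 S2) _ => s y Wy Hs; rewrite Et.
Qed.

Definition OB m : op E -> Prop := fun t => exists a k, (mdeg a < m)%N /\ t = Ob a k.

(** Unitriangular systems can be inverted, by induction on the length. *)
Lemma B_spanO m t : B m false t -> span W (OB m) t.
Proof.
elim/ltn_ind: m t => m IH t [w [k [-> sw wm _]]].
have [t' [St' Et']] := Ob_lead (mnw w) k.
have S1 : span W (OB m) t'.
  apply: (span_trans _ St') => u Hu; rewrite mdeg_mnw in Hu.
  apply: span_mono (IH _ wm u Hu) => v [a [l [al ->]]].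
  by exists a, l; split=> //; exact: ltn_trans al wm.
have S2 : span W (OB m) (Ob (mnw w) k).
  by apply: span_in; exists (mnw w), k; rewrite mdeg_mnw.
apply: span_ext (spanD S2 (span_opp S1)) _ => s y Wy Hs.
by rewrite Et' // mword_mnw // addrK.
Qed.

Lemma Ob_jet0 r y s : W y -> sv y s ->
  (forall (a : bmultinom n r.+1) k, Ob (bmnm a) k s y = 0) -> jet r y s = 0.
Proof.
move=> Wy Hs H; apply/(jet_eq0_sys r S Wy Hs) => w k sw wr.
have Bw : B r.+1 false (xs X e w k) by exists w, k; split.
apply: (span_zero Wy Hs _ (B_spanO Bw)) => b [a [l [ar ->]]].
exact: (H (BMultinom ar) l).
Qed.

Section Order.
Variable r : nat.
Local Notation I := (bmultinom n r.+1 * 'I_K)%type.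

Lemma Ob_spanr (i : I) : span W (B r.+1 false) (Ob (bmnm i.1) i.2).
Proof. by apply: Ob_span; rewrite -ltnS; exact: bmdeg. Qed.

(** The members of the frame as linear forms on jets. *)
Definition phiO y (i : I) : 'Hom(Jet E r y, trivial_line M y) :=
  opJ (F := trivial_line M) r (fun s => Ob (bmnm i.1) i.2 s y).

Lemma phiOE y i s : W y -> sv y s -> phiO y i (jet r y s) = Ob (bmnm i.1) i.2 s y.
Proof. by move=> Wy Hs; exact: (opJ_span ad Wy (Ob_spanr i) Hs). Qed.

Lemma phiO_inj y (v : Jet E r y) : W y -> (forall i, phiO y i v = 0) -> v = 0.
Proof.
move=> Wy H; rewrite -(jet_realize v).
apply: Ob_jet0 => // [|a k]; first exact: sv_realize_self.
rewrite -(phiOE (a, k) Wy (sv_realize_self v)) jet_realize; exact: H.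
Qed.

(** At [x0] the operators form a basis of the dual of the jet space. Their values
    on sections [p i] whose jets form a basis thus make an invertible matrix at
    [x0], and nearby by continuity; the inverse matrix yields the dual frame, which
    is smooth. *)
Lemma dual_frame : exists (V : set M) (L : I -> sect (Jet E r)),
  [/\ open V, V x0, V `<=` W, forall i y, V y -> sv y (L i) &
    forall y, V y -> (forall i i', phiO y i' (L i y) = (i == i')%:R) /\
      forall v : Jet E r y, v = \sum_i (phiO y i v : C) *: L i y].
Proof.
have x0W := ad_x ad.
pose jv (i : I) : Jet E r x0 := [ffun a => if a == i.1 then e i.2 x0 else 0].
pose p (i : I) := realize (jv i).
pose N := #|{: I}|.
pose Bm y : 'M[C]_N := \matrix_(i, i') Ob (bmnm (enum_val i').1) (enum_val i').2 (p (enum_val i)) y.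
pose W0 := W `&` (dom x0 `&` tdom E x0).
have oW0 : open W0.
  by apply: openI; [exact: oW|apply: openI; [exact: dom_open|exact: tdom_open]].
have W0x : W0 x0 by split=> //; split; [exact: mem_dom|exact: mem_tdom].
have sp i y : W0 y -> sv y (p i) by move=> [_ [dy ty]]; exact: sv_realize.
have sB i i' y : W0 y -> sf y (fun z => Bm z i i').
  move=> W0y; apply: (@sf_ext _ _ _ _ (Ob (bmnm (enum_val i').1) (enum_val i').2 (p (enum_val i)))).
    by apply: nearW => z; rewrite mxE.
  by apply: (Bs_smoothing S (Ob_spanr _)); [exact: W0y.1|exact: sp].
(* A combination of the [p i] that is killed by all the operators has zero jet. *)
have uB : Bm x0 \in unitmx.
  rewrite -row_free_unit -kermx_eq0; apply/rowV0P => w /sub_kermxP wB.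
  pose s : sect E := fun z => \sum_(i : I) w 0 (enum_rank i) *: p i z.
  have Hs : sv x0 s.
    by apply: svE_sum => i _; apply: svE_scale; [exact: sf_cst|exact: sp].
  have js : jet r x0 s = \sum_i w 0 (enum_rank i) *: jv i.
    rewrite jet_sum => [|i]; last exact: sp.
    by apply: eq_bigr => i _; rewrite jet_realize.
  have j0 : jet r x0 s = 0.
    apply: phiO_inj => // i; rewrite js linear_sum.
    move/rowP: wB => /(_ (enum_rank i)); rewrite !mxE => E0; rewrite -[RHS]E0.
    rewrite [RHS](reindex (@enum_rank I)) /=; last by apply: onW_bij; exact: enum_rank_bij.
    apply: eq_bigr => l _; rewrite linearZ mxE !enum_rankK /=; congr (_ * _).
    by rewrite -(jet_realize (jv l)) phiOE //; exact: sp.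
  apply/rowP => m; rewrite mxE -(enum_valK m); case: (enum_val m) => a k.
  have : \sum_l w 0 (enum_rank ((a, l) : I)) *: e l x0 = 0.
    have /ffunP/(_ a) := etrans (esym js) j0; rewrite sum_ffunE ffunE => E0.
    rewrite -[RHS]E0 (eq_bigr (fun i : I => if i.1 == a then w 0 (enum_rank i) *: e i.2 x0 else 0)); last first.
      by move=> i _; rewrite !ffunE eq_sym; case: ifP => // _; rewrite scaler0.
    rewrite -big_mkcond /= (reindex_onto (fun l => (a, l) : I) snd) /=; last first.
      by move=> [a' l] /= /eqP ->.
    by apply: eq_bigl => l; rewrite !eqxx.
  move=> E0; have be := sys_eb S x0W.
  by rewrite -(cfr_eq (fun l => w 0 (enum_rank ((a, l) : I))) k be) E0 linear0.
have [V [oV Vx VH]] := nearP (nearI (near_W oW0 W0x) (unitmx_near (fun i i' => sB i i' x0 W0x) uB)).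
pose L (i : I) : sect (Jet E r) := fun y =>
  \sum_(i' : I) invmx (Bm y) (enum_rank i) (enum_rank i') *: jet r y (p i').
have dual y : V y -> forall i i', phiO y i' (L i y) = (i == i')%:R.
  move=> /VH [W0y uy] i i'; rewrite linear_sum.
  have := mulVmx uy => /matrixP/(_ (enum_rank i) (enum_rank i')); rewrite !mxE.
  rewrite (inj_eq (@enum_rank_inj _)) => E0; rewrite -[RHS]E0.
  rewrite [RHS](reindex (@enum_rank I)) /=; last by apply: onW_bij; exact: enum_rank_bij.
  apply: eq_bigr => l _; rewrite linearZ [in RHS]mxE !enum_rankK /=; congr (_ * _).
  by rewrite phiOE //; [exact: W0y.1|exact: sp].
exists V, L; split=> //.
- by move=> y /VH [[]].
- move=> i y /VH [W0y uy]; apply: sv_jet_sum => i'; last exact: sp.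
  by apply: sf_invmx => // m m'; exact: sB.
move=> y Vy; split=> [|v]; first exact: dual.
apply/eqP; rewrite -subr_eq0; apply/eqP/phiO_inj; first by have [[]] := VH y Vy.
move=> i; rewrite linearB linear_sum /= (bigD1 i) //= linearZ /= dual // eqxx.
rewrite big1 => [|i' i'i]; last by rewrite linearZ /= dual // (negPf i'i) [_ *: _]mulr0.
by rewrite addr0 [_ *: _]mulr1 subrr.
Qed.

(** The reduced jets are cut out by the members of the frame that are not PBW
    operators, so that the part of the dual frame indexed by horizontal monomials is
    a frame of [\tilde J^r]. *)
Lemma dual_horizontal y (v : Jet E r y) : W y ->
  v \in tilde_jet dE r y <-> forall i, ~~ horizontal (bmnm i.1) -> phiO y i v = 0.
Proof.
move=> Wy; rewrite -{1}(jet_realize v) (mem_tildeP conE ad r Wy (sv_realize_self v)).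
split=> [H [a k] /= Ha|H w k sw Yw wr].
  rewrite -(jet_realize v) phiOE //; last exact: sv_realize_self.
  rewrite /Ob /= (negPf Ha) H //; first exact: sorted_mword.
    by move: Ha; rewrite negbK.
  by rewrite size_mword -ltnS; exact: bmdeg.
have ad' : (mdeg (mnw w) < r.+1)%N by rewrite mdeg_mnw ltnS.
have Hw : ~~ horizontal (mnw w) by rewrite /horizontal mword_mnw // Yw.
have := H (BMultinom ad', k) Hw; rewrite -{1}(jet_realize v) phiOE //; last exact: sv_realize_self.
by rewrite /Ob /= (negPf Hw) mword_mnw.
Qed.

End Order.

End DualFrame.

(** * Smooth sections of the symmetric algebra *)

Lemma bsum_ext (V : nmodType) q d0 d (c : multinom q -> V) : (d0 <= d)%N ->
  (forall a, (d0 <= mdeg a)%N -> c a = 0) ->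
  \sum_(a : bmultinom q d) c a = \sum_(a : bmultinom q d0) c a.
Proof.
move=> d0d c0; rewrite (bigID (fun a : bmultinom q d => (mdeg a < d0)%N)) /=.
rewrite [X in _ + X]big1 ?addr0 => [|a]; last by rewrite -leqNgt; exact: c0.
pose I : subFinType _ := bmultinom q d0; pose J : subFinType _ := bmultinom q d.
have H (a : multinom q) : (mdeg a < d0)%N -> (mdeg a < d)%N by move=> /leq_trans; apply.
by rewrite (@ssrcomplements.big_sub_widen V 0 +%R (multinom q) _ _ I J xpredT c H).
Qed.

Section SymBounds.
Variables (R : realType) (n : nat) (M : manifold R n).
Local Notation C := (R[i]).
Variable Q : vbundle M.

Lemma msize_sym_in (x : M) (v : Q x) : (msize (sym_in v) <= 2)%N.
Proof.
rewrite /sym_in; apply: leq_trans (msize_sum _ _ _) _.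
apply/bigmax_leqP_seq => i _ _; apply: leq_trans (msizeZ_le _ _) _.
by rewrite msizeX mdeg1.
Qed.

Lemma msize_sym_prod (x : M) (I : Type) (l : seq I) (P : pred I) (v : I -> Q x) :
  (msize (\prod_(i <- l | P i) sym_in (v i) : sym_fiber Q x) <= (count P l).+1)%N.
Proof.
elim: l => [|i l IH]; first by rewrite big_nil -mpolyC1 msizeC oner_eq0.
rewrite big_cons /=; case: ifP => Pi; last by rewrite add0n.
set p := \prod_(_ <- _ | _) _ in IH *.
have [->|v0] := eqVneq (sym_in (v i)) 0; first by rewrite mul0r msize0.
have [->|p0] := eqVneq p 0; first by rewrite mulr0 msize0.
rewrite msizeM // add1n; have := msize_sym_in (v i).
by move: IH; case: (msize p) => [|m]; case: (msize _) => [|[|[|k]]] //=; rewrite ?add0n ?addSn ?add0n //=; move=> *; lia.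
Qed.

Lemma msize_lin (q : nat) d c (p p' : mpoly q C) : (msize p <= d)%N -> (msize p' <= d)%N ->
  (msize (c *: p + p') <= d)%N.
Proof.
move=> pd pd'; apply: leq_trans (msizeD_le _ _) _; rewrite geq_max pd' andbT.
exact: leq_trans (msizeZ_le _ _) pd.
Qed.

Lemma msize_sum_le (q : nat) d (I : Type) (l : seq I) (c : I -> C) (p : I -> mpoly q C) :
  (forall i, (msize (p i) <= d)%N) -> (msize (\sum_(i <- l) c i *: p i) <= d)%N.
Proof.
move=> H; elim: l => [|i l IH]; first by rewrite big_nil msize0.
by rewrite big_cons; exact: msize_lin.
Qed.

(** The degree is bounded near each point, as the number of factors is. *)
Lemma sym_smooth_near U (G : sym_sheaf Q) x : fsec_smooth U G -> U x -> exists V r,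
  [/\ open V, V x, V `<=` U & forall y, V y -> (msize (G y) <= r.+1)%N].
Proof.
move=> HG Ux; have [V [oV Vx VU [m [f [d [Z [_ GE]]]]]]] := HG x Ux.
exists V, (\max_(i < m) d i); split=> // y Vy; rewrite GE //.
apply: msize_sum_le => i; have := msize_sym_prod (index_enum 'I_(d i)) xpredT (fun k => Z i k y).
move=> /leq_trans; apply; rewrite count_predT ltnS.
have -> : size (index_enum 'I_(d i)) = d i by rewrite -[RHS]card_ord cardT enumT.
exact: leq_bigmax.
Qed.

Lemma sym_smooth_sub U V (G : sym_sheaf Q) : open V -> V `<=` U -> fsec_smooth U G -> fsec_smooth V G.
Proof.
move=> oV VU HG x Vx; have [W [oW Wx WU [m [f [d [Z [H1 H2]]]]]]] := HG x (VU _ Vx).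
have oWV := openI oW oV.
exists (W `&` V); split=> //; exists m, f, d, Z; split=> [i|y [Wy _]]; last exact: H2.
split; first exact: smooth_fun_sub (@subIsetl _ W V) (H1 i).1.
by move=> k; exact: ((localb_vbundle Q).1 _ _ _ oWV (@subIsetl _ W V) ((H1 i).2 k)).
Qed.

Lemma sum_split (V : nmodType) m m' (a : 'I_m -> V) (b : 'I_m' -> V) :
  \sum_(i < m) a i + \sum_(i < m') b i =
  \sum_(i < m + m') (match fintype.split i with inl k => a k | inr k => b k end).
Proof.
rewrite big_split_ord /=; congr (_ + _); apply: eq_bigr => i _.
  by rewrite (unsplitK (inl _ i)).
by rewrite (unsplitK (inr _ i)).
Qed.

Lemma sym_smooth_lin U f (G H : sym_sheaf Q) : open U -> smooth_fun U f ->
  fsec_smooth U G -> fsec_smooth U H ->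
  fsec_smooth U (fsec_add (fsec_scale f G) H).
Proof.
move=> oU sf_ HG HH x Ux.
have [V [oV Vx VU [m [g [d [Z [H1 H2]]]]]]] := HG x Ux.
have [W [oW Wx WU [m' [g' [d' [Z' [H1' H2']]]]]]] := HH x Ux.
have oVW := openI oV oW.
exists (V `&` W); split=> //; first by move=> y [/VU].
exists (m + m')%N, (fun i => match fintype.split i with inl k => fun y => f y * g k y | inr k => g' k end),
  (fun i => match fintype.split i with inl k => d k | inr k => d' k end),
  (fun i => match fintype.split i with inl k => Z k | inr k => Z' k end); split.
  move=> i; case: (fintype.split i) => k; split.
  - apply/smooth_funP => // y [Vy Wy]; apply: sf_mul; first exact: sf_open oU sf_ (VU _ Vy).
    exact: sf_open oV (H1 k).1 Vy.
  - by move=> l; exact: ((localb_vbundle Q).1 _ _ _ oVW (@subIsetl _ V W) ((H1 k).2 l)).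
  - exact: smooth_fun_sub (@subIsetr _ V W) (H1' k).1.
  - by move=> l; exact: ((localb_vbundle Q).1 _ _ _ oVW (@subIsetr _ V W) ((H1' k).2 l)).
move=> y [Vy Wy]; rewrite /= H2 // H2' // scaler_sumr sum_split; apply: eq_bigr => i _.
by case: (fintype.split i) => k //; rewrite scalerA.
Qed.

Lemma sym_smooth_0 U : open U -> fsec_smooth U ((fun x => 0 : sym_fiber Q x) : sym_sheaf Q).
Proof.
move=> oU x Ux; exists U; split=> //.
exists 0%N, (fun _ _ => 0), (fun=> 0%N), (fun _ _ _ => 0); split.
  by case=> -[].
by move=> y _; rewrite [RHS]big_ord0.
Qed.

Lemma sym_smooth_prod U m (Z : 'I_m -> sect Q) : open U -> (forall i, sm U (Z i)) ->
  fsec_smooth U (sym_prod Z pred0).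
Proof.
move=> oU HZ x Ux; exists U; split=> //.
exists 1%N, (fun _ _ => 1), (fun=> m), (fun _ => fun k => nth (fun z => 0 : Q z) [seq Z i | i <- enum 'I_m] k); split.
  move=> i; split; first by move=> x1; exact: smooth_cst.
  move=> k; have [km|mk] := ltnP k m.
    by rewrite (nth_map (Ordinal km)) ?size_enum_ord //; exact: HZ.
  have sz : size [seq Z i | i <- enum 'I_m] = m by rewrite size_map size_enum_ord.
  rewrite nth_default ?sz //.
  by apply: (localb_vbundle Q).2 => // y _; exact: svE_0.
move=> y _; rewrite big_ord1 scale1r; apply: eq_bigr => k _.
by rewrite (nth_map k) ?size_enum_ord // nth_ord_enum.
Qed.

End SymBounds.

(** * Germs and the fibres of the direct limit *)

Section Construction.
Variables (R : realType) (n : nat) (M : manifold R n).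
Local Notation C := (R[i]).
Implicit Types (f g : M -> C) (x y z : M).
Variable P : forall x : M, {vspace TMC M x}.
Variables (Q : vbundle M) (proj : forall x : M, 'Hom(TMC M x, Q x)).
Variables (E : vbundle M) (dE : sect E -> forall x : M, 'Hom(Pbundle P x, E x)).
Variable j : forall x : M, 'Hom(Q x, TMC M x).
Variable nabQ : sect Q -> forall x, 'Hom(TMC M x, Q x).
Variable nabE : sect E -> forall x, 'Hom(TMC M x, E x).
Hypotheses (subP : is_subbundle P) (invP : involutive P) (quQ : is_quotient P proj)
  (spj : is_splitting proj j) (freeE : locally_free dE).
Hypothesis conE : is_connection (F := Pbundle P) (fun x v => vsval v) dE.
Hypotheses (hQ : is_TMC_connection nabQ) (hE : is_TMC_connection nabE).

Local Notation Top := (Top j nabQ nabE).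
Local Notation covE := (covE j nabE).
Local Notation nu := (nu j nabQ nabE).
Let sj := spj.1.
Local Notation ad_ex := (adapted_exists subP invP quQ spj freeE).

Definition tl r x (s : sect E) : Prop := jet r x s \in tilde_jet dE r x.

Lemma tl_le r N x s : (r <= N)%N -> sv x s -> tl N x s -> tl r x s.
Proof.
move=> rN Hs; have [W [X [K [e ad]]]] := ad_ex x.
move=> /(mem_tildeP conE ad N (ad_x ad) Hs) H.
apply/(mem_tildeP conE ad r (ad_x ad) Hs) => w k sw Yw wr.
by apply: H => //; exact: leq_trans wr rN.
Qed.

Lemma truncate_jet r N x (s : sect E) : (r <= N)%N -> truncate r (jet N x s) = jet r x s.
Proof.
move=> rN; apply/ffunP => a; rewrite !ffunE.
have aN : (mdeg (bmnm a) < N.+1)%N by apply: leq_trans (bmdeg a) _.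
by rewrite (insubT (fun m : multinom n => (mdeg m < N.+1)%N) aN) /= ffunE.
Qed.

Lemma jet_eq_sub r x (s s' : sect E) : sv x s -> sv x s' ->
  jet r x (fun z => (-1) *: s' z + s z : E z) = 0 <-> jet r x s = jet r x s'.
Proof.
move=> Hs Hs'; rewrite jet_lin // scaleN1r addrC.
by split=> [/subr0_eq|->]; rewrite ?subrr.
Qed.

Lemma nu_X_Tb x (b : multinom (\dim {:Q x})) s : nu (mpolyX C b) s = Tb j nabQ nabE b s x.
Proof. by rewrite nu_X. Qed.

Lemma nu_jet r x (p : sym_fiber Q x) s s' : (msize p <= r.+1)%N -> sv x s -> sv x s' ->
  jet r x s = jet r x s' -> nu p s = nu p s'.
Proof.
move=> pr Hs Hs' J; have [W [X [K [e ad]]]] := ad_ex x.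
rewrite !(nuE j nabQ nabE _ pr); apply: eq_bigr => a _; congr (_ *: _).
have ar := bmdeg a.
have Wx := ad_x ad; have be := sys_eb (ad_sys ad) Wx.
rewrite -[LHS]/(Tb j nabQ nabE a s x) -[RHS]/(Tb j nabQ nabE a s' x).
rewrite (cfr_expand (Tb j nabQ nabE a s) be) (cfr_expand (Tb j nabQ nabE a s') be).
apply: eq_bigr => k _; congr (_ *: _).
have St := span_le ar (Tb_span sj hQ hE ad a k).
exact: (jet_eq_sys (ad_sys ad) Wx Hs Hs' J St).
Qed.

Definition nuJ r x (p : sym_fiber Q x) : 'Hom(Jet E r x, E x) := opJ (F := E) r (nu p).

Lemma nuJE r x (p : sym_fiber Q x) s : (msize p <= r.+1)%N -> sv x s ->
  nuJ r p (jet r x s) = nu p s.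
Proof.
move=> pr Hs; apply: opJE => // [c u v Hu Hv|u v Hu Hv J]; first exact: (nu_slin sj hQ hE).
exact: nu_jet pr Hu Hv J.
Qed.

(** The PBW operators together with the equations of [\tilde J^r] form a frame of
    the operators of order at most [r]. *)
Lemma tilde_inj r x s : sv x s -> tl r x s ->
  (forall b : multinom (\dim {:Q x}), (mdeg b <= r)%N -> nu (mpolyX C b) s = 0) -> jet r x s = 0.
Proof.
move=> Hs Ht H; have [W [X [K [e ad]]]] := ad_ex x; have Wx := ad_x ad.
apply: (@Ob_jet0 _ _ _ _ _ _ _ _ _ _ sj hQ hE _ _ _ _ _ ad r x s Wx Hs) => a k; rewrite /Ob; case: ifP => Ha.
  rewrite /cfr -nu_X_Tb H ?linear0 // -(mdeg_upm ad) upm_dn // -ltnS; exact: bmdeg.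
move: Ht => /(mem_tildeP conE ad r Wx Hs); apply; first exact: sorted_mword.
  by move: Ha => /negbFE.
by rewrite size_mword -ltnS; exact: bmdeg.
Qed.

(** Dual frames allow any prescribed values; those of the equations of
    [\tilde J^r] are set to zero. *)
Lemma tilde_surj r x (u : multinom (\dim {:Q x}) -> E x) : exists s,
  [/\ sv x s, tl r x s & forall b, (mdeg b <= r)%N -> nu (mpolyX C b) s = u b].
Proof.
have [W [X [K [e ad]]]] := ad_ex x; have Wx := ad_x ad.
have [V [L [oV Vx VW sL HL]]] := dual_frame sj hQ hE ad r.
have [dual _] := HL x Vx.
have be := sys_eb (ad_sys ad) Wx.
pose c (i : bmultinom n r.+1 * 'I_K) : C :=
  if @horizontal _ _ _ Q x (bmnm i.1) then coord (frtup e x) i.2 (u (dn ad (bmnm i.1))) else 0.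
pose v : Jet E r x := \sum_i c i *: L i x.
have phiv i : phiO nabQ nabE ad x i v = c i.
  rewrite linear_sum (bigD1 i) //= linearZ /= dual eqxx [_ *: _]mulr1 big1 ?addr0 // => i' i'i.
  by rewrite linearZ /= dual (negPf i'i) [_ *: _]mulr0.
have Hs := sv_realize_self v.
exists (realize v); split=> //.
  rewrite /tl jet_realize; apply/(dual_horizontal conE sj hQ hE ad) => // i Hi.
  by rewrite phiv /c (negPf Hi).
move=> b br.
have ar : (mdeg (upm ad b) < r.+1)%N by rewrite mdeg_upm.
have := cfr_expand (Tb j nabQ nabE b (realize v)) be.
rewrite -nu_X_Tb => ->; rewrite [RHS](coord_expand (u b) be).
apply: eq_bigr => k _; congr (_ *: _).
have := phiv (BMultinom ar, k); rewrite -{1}(jet_realize v) (phiOE sj hQ hE) //.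
by rewrite /Ob /c /= horizontal_upm dn_upm.
Qed.

(** The PBW operators of higher degree can be given the value zero, which lifts any
    reduced jet. *)
Lemma tilde_lift r N x s : (r <= N)%N -> sv x s -> tl r x s -> exists s',
  [/\ sv x s', tl N x s' & jet r x s' = jet r x s].
Proof.
move=> rN Hs Ht.
have [s' [Hs' Ht' H]] := @tilde_surj N x (fun b => if (mdeg b <= r)%N then nu (mpolyX C b) s else 0).
exists s'; split=> //; apply/jet_eq_sub => //.
have Hd : sv x (fun z => (-1) *: s z + s' z : E z) by exact: svE_lin (sf_cst _ _) Hs Hs'.
apply: tilde_inj => //.
  by rewrite /tl jet_lin //; apply: memvD; [exact: memvZ|exact: tl_le rN Hs' Ht'].
move=> b br; rewrite (nu_slin sj hQ hE) // H ?br ?scaleN1r ?addNr //.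
exact: leq_trans br rN.
Qed.

Section Rep.
Variable F : bundle M.
Local Notation tDF := (tildeD dE F).

(** The action of an element of the direct limit on germs of sections with jet in
    the reduced jet space. Working with operators on germs avoids the transition
    maps of the limit. *)
Definition act x (a : tDF x) (s : sect E) : F x :=
  projT2 a (vsproj (tilde_jet dE (projT1 a) x) (jet (projT1 a) x s)).

(** The integer [N] bounds the order of [a], and operators are only compared on
    reduced jets of order [N]. *)
Definition Rep x (a : tDF x) N (t : sect E -> F x) : Prop :=
  (projT1 a <= N)%N /\ forall s, sv x s -> tl N x s -> act a s = t s.

Definition RepE x (a : tDF x) (t : sect E -> F x) : Prop := exists N, Rep a N t.

Lemma Rep_le x (a : tDF x) N N' t : (N <= N')%N -> Rep a N t -> Rep a N' t.
Proof.
move=> NN' [aN H]; split; first exact: leq_trans aN NN'.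
by move=> s Hs Ht; apply: H => //; exact: tl_le NN' Hs Ht.
Qed.

Lemma Rep_act x (a : tDF x) : Rep a (projT1 a) (act a).
Proof. by split. Qed.

Lemma Rep_ext x (a : tDF x) N t t' : Rep a N t ->
  (forall s, sv x s -> tl N x s -> t s = t' s) -> Rep a N t'.
Proof. by move=> [aN H] tt'; split=> // s Hs Ht; rewrite H // tt'. Qed.

Lemma RepE_ext x (a : tDF x) t t' : RepE a t -> (forall s, sv x s -> t s = t' s) -> RepE a t'.
Proof. by move=> [N H] tt'; exists N; apply: Rep_ext H _ => s Hs _; exact: tt'. Qed.

Lemma tilde_projE r N x (v : tildeJ dE N x) : (r <= N)%N ->
  tilde_proj dE r N x v = vsproj (tilde_jet dE r x) (truncate r (vsval v)).
Proof.
move=> rN; apply: linfunE => c u w; rewrite -linearP; congr vsproj.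
apply/ffunP => a; rewrite !ffunE.
have aN : (mdeg (bmnm a) < N.+1)%N by apply: leq_trans (bmdeg a) _.
rewrite (insubT (fun m : multinom n => (mdeg m < N.+1)%N) aN) /=.
by rewrite !ffunE.
Qed.

Lemma tD_lift_act x (a : tDF x) N s : (projT1 a <= N)%N -> sv x s -> tl N x s ->
  tD_lift N a (vsproj (tilde_jet dE N x) (jet N x s)) = act a s.
Proof.
move=> aN Hs Ht; rewrite /tD_lift comp_lfunE tilde_projE // vsprojK //.
by rewrite truncate_jet.
Qed.

(** Equality in the limit, tested on germs: the projections between the spaces of
    reduced jets are truncations of jets. *)
Lemma tD_eqP x (a b : tDF x) : tD_eq a b <-> exists N t, Rep a N t /\ Rep b N t.
Proof.
split=> [[N [aN bN E1]]|[N [t [[aN Ha] [bN Hb]]]]].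
  exists N, (act a); split; first exact: Rep_le (Rep_act a).
  by split=> // s Hs Ht; rewrite -!(@tD_lift_act _ _ N) // E1.
exists N; split=> //; apply/lfunP => v; rewrite -(vsvalK v) -(jet_realize (vsval v)).
have Ht : tl N x (realize (vsval v)) by rewrite /tl jet_realize; exact: subvsP.
have Hs := sv_realize_self (vsval v).
by rewrite !tD_lift_act // Ha // Hb.
Qed.

Lemma tD_eqE x (a b : tDF x) t : RepE a t -> RepE b t -> tD_eq a b.
Proof.
move=> [N Ha] [N' Hb]; apply/tD_eqP; exists (maxn N N'), t.
by split; [apply: Rep_le Ha; exact: leq_maxl|apply: Rep_le Hb; exact: leq_maxr].
Qed.

Lemma RepE_eq x (a b : tDF x) t : tD_eq a b -> RepE a t -> RepE b t.
Proof.
move=> /tD_eqP [N [t' [Ha Hb]]] [N' Ha']; exists (maxn N N').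
apply: Rep_ext (Rep_le (leq_maxl N N') Hb) _ => s Hs Ht.
by rewrite -(Rep_le (leq_maxl N N') Ha).2 // (Rep_le (leq_maxr N N') Ha').2.
Qed.

Lemma tD_eq_sym x (a b : tDF x) : tD_eq a b -> tD_eq b a.
Proof. by move=> [N [H1 H2 H3]]; exists N. Qed.

Lemma tD_eq_refl x (a : tDF x) : tD_eq a a.
Proof. by exists (projT1 a). Qed.

(** Both operators depend on [r]-jets only, and a reduced jet of order [r] lifts to
    reduced jets of all higher orders. *)
Lemma RepE_unique x (a : tDF x) t t' r s : RepE a t -> RepE a t' ->
  (forall s s', sv x s -> sv x s' -> jet r x s = jet r x s' -> t s = t s') ->
  (forall s s', sv x s -> sv x s' -> jet r x s = jet r x s' -> t' s = t' s') ->
  sv x s -> tl r x s -> t s = t' s.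
Proof.
move=> [N Ha] [N' Ha'] tj tj' Hs Ht; pose m := maxn r (maxn N N').
have [s' [Hs' Ht' J]] := tilde_lift (leq_maxl r (maxn N N')) Hs Ht.
rewrite -(tj _ _ Hs' Hs J) -(tj' _ _ Hs' Hs J).
have m1 : (N <= m)%N by rewrite !leq_max leqnn orbT.
have m2 : (N' <= m)%N by rewrite !leq_max leqnn !orbT.
by rewrite -(Rep_le m1 Ha).2 // -(Rep_le m2 Ha').2.
Qed.

Lemma RepE_add x (a b : tDF x) t t' : RepE a t -> RepE b t' ->
  RepE (tD_add a b) (fun s => t s + t' s).
Proof.
move=> [N Ha] [N' Hb]; pose m := maxn (projT1 a) (projT1 b).
exists (maxn m (maxn N N')); split; first exact: leq_maxl.
move=> s Hs Ht.
have tm : tl m x s by apply: tl_le Hs Ht; exact: leq_maxl.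
have m1 : (N <= maxn m (maxn N N'))%N by rewrite !leq_max leqnn orbT.
have m2 : (N' <= maxn m (maxn N N'))%N by rewrite !leq_max leqnn !orbT.
rewrite -(Rep_le m1 Ha).2 // -(Rep_le m2 Hb).2 //.
rewrite {1}/act /tD_add /= lfunE /= !tD_lift_act //; first exact: leq_maxr.
exact: leq_maxl.
Qed.

Lemma RepE_scale x (a : tDF x) c t : RepE a t -> RepE (tD_scale c a) (fun s => c *: t s).
Proof.
move=> [N [aN H]]; exists N; split=> // s Hs Ht.
by rewrite /act /tD_scale /= lfunE /= -H.
Qed.

Lemma RepE_zero x : RepE (tD_zero dE F x) (fun _ => 0).
Proof. by exists 0%N; split=> // s _ _; rewrite /act /= lfunE. Qed.

Lemma RepE_big x m (a : 'I_m -> tDF x) (t : 'I_m -> sect E -> F x) :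
  (forall i, RepE (a i) (t i)) ->
  RepE (\big[@tD_add _ _ _ P E dE F x/tD_zero dE F x]_(i < m) a i) (fun s => \sum_i t i s).
Proof.
move=> H; elim: (index_enum _) => [|i l IH].
  by rewrite big_nil; apply: RepE_ext (RepE_zero x) _ => s _; rewrite big_nil.
rewrite big_cons.
by apply: RepE_ext (RepE_add (H i) IH) _ => s _; rewrite big_cons.
Qed.

Lemma tilde_restrictE r x (A : 'Hom(Jet E r x, F x)) (v : tildeJ dE r x) :
  tilde_restrict dE A v = A (vsval v).
Proof. by apply: linfunE => c u w; rewrite !linearP. Qed.

Lemma Rep_restrict r x (A : 'Hom(Jet E r x, F x)) t :
  (forall s, sv x s -> A (jet r x s) = t s) -> Rep (tD (tilde_restrict dE A)) r t.
Proof.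
move=> H; split=> // s Hs Ht; rewrite /act /= tilde_restrictE vsprojK //.
exact: H.
Qed.

Lemma class_RepE U (T : sect E -> sect F) (a : forall x, tDF x) x : open U -> U x ->
  is_class_of U T a -> RepE (a x) (fun s => T s x).
Proof.
move=> oU Ux [r [A [[_ opA] H]]]; apply: RepE_eq (tD_eq_sym (H x Ux)) _.
exists r; apply: Rep_restrict => s [V [oV Vx Hs]].
apply: (opA (V `&` U)) => //; first exact: openI.
exact: ((localb_vbundle E).1 _ _ _ (openI oV oU) (@subIsetl _ V U) Hs).
Qed.

Lemma smooth_restrict r U (A : forall x, 'Hom(Jet E r x, F x)) : smooth_hom U A ->
  smooth_hom U (fun x => tilde_restrict dE (A x)).
Proof.
move=> sA V s oV VU Hs.
have := sA V (fun z => vsval (s z)) oV VU Hs.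
by congr (sm _ _); apply: functional_extensionality_dep => z; rewrite tilde_restrictE.
Qed.

End Rep.

Lemma RepE_post (F F' : bundle M) x (a : tildeD dE F x) (A : 'Hom(F x, F' x)) t : RepE a t ->
  RepE (tD_postcomp A a) (fun s => A (t s)).
Proof.
move=> [N [aN H]]; exists N; split=> // s Hs Ht.
by rewrite /act /tD_postcomp /= comp_lfunE -H.
Qed.

(** * Existence of the recursive map *)

Local Notation covQ := (covQ j nabQ).

Section Operators.
Variable F : bundle M.
Hypothesis gF : goodb F.

(** Differential operators of order at most [r] on germs of sections: they preserve
    smoothness, are linear over the constants, and depend on jets only. *)
Definition is_dop r U (T : sect E -> sect F) : Prop := forall y, U y ->
  [/\ forall s, sv y s -> sv y (T s),
      forall c s s', sv y s -> sv y s' ->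
        T (fun z => c *: s z + s' z : E z) y = c *: T s y + T s' y &
      forall s s', sv y s -> sv y s' -> jet r y s = jet r y s' -> T s y = T s' y].

Lemma dop_jetE r U T y s : is_dop r U T -> U y -> sv y s ->
  opJ (F := F) r (fun s => T s y) (jet r y s) = T s y.
Proof. by move=> HT Uy Hs; have [_ H1 H2] := HT y Uy; exact: opJE. Qed.

Lemma dop_operator r U T : open U -> is_dop r U T ->
  is_operator_of U (fun y => opJ (F := F) r (fun s => T s y)) T.
Proof.
move=> oU HT; split=> [|V s y oV VU Vy smV].
  apply/(smooth_homJ _ gF oU) => y s Uy Hs; have [H1 _ _] := HT y Uy.
  apply: (gb_near gF) (H1 s Hs).
  apply: near2 (open_nbhs_nbhs (conj oU Uy)) (sv_nearP Hs) _ => z Uz Hz.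
  by rewrite (dop_jetE HT).
by apply: dop_jetE HT _ _; [exact: VU|exists V].
Qed.

Lemma dop_restrict r U T y : is_dop r U T -> U y ->
  Rep (tD (tilde_restrict dE (opJ (F := F) r (fun s => T s y)))) r (fun s => T s y).
Proof. by move=> HT Uy; apply: Rep_restrict => s Hs; exact: dop_jetE HT Uy Hs. Qed.

Lemma dop_class r U T (a : forall x, tildeD dE F x) : open U -> is_dop r U T ->
  (forall y, U y -> RepE (a y) (fun s => T s y)) -> is_class_of U T a.
Proof.
move=> oU HT Ha; exists r, (fun y => opJ (F := F) r (fun s => T s y)).
split; first exact: dop_operator.
move=> y Uy; apply: tD_eqE (Ha y Uy) _; exists r; exact: (@dop_restrict r U T y HT Uy).
Qed.

Lemma dop_order r U T (a : forall x, tildeD dE F x) : open U -> is_dop r U T ->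
  (forall y, U y -> RepE (a y) (fun s => T s y)) -> tD_order_le r U a.
Proof.
move=> oU HT Ha; exists (fun y => tilde_restrict dE (opJ (F := F) r (fun s => T s y))).
split; first exact: smooth_restrict (dop_operator oU HT).1.
move=> y Uy; apply: tD_eqE (Ha y Uy) _; exists r; exact: (@dop_restrict r U T y HT Uy).
Qed.

End Operators.

Lemma sv_nu U (G : sym_sheaf Q) s y : fsec_smooth U G -> U y -> sv y s ->
  sv y (fun z => nu (G z) s : E z).
Proof.
move=> HG Uy Hs; have [V [oV Vy VU [m [f [d [Z [H1 H2]]]]]]] := HG y Uy.
have sZ i k z : V z -> sv z (Z i k) by move=> Vz; exists V; split=> //; exact: (H1 i).2.
apply: (@svE_near_eq _ _ _ _ _ (fun z => \sum_(i < m) f i z *: Top (fun k : 'I_(d i) => Z i k) s z : E z)).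
  apply: near2 (open_nbhs_nbhs (conj oV Vy)) (sv_nearP Hs) _ => z Vz Hz.
  rewrite H2 // (nu_sum j nabQ nabE); apply: eq_bigr => i _; congr (_ *: _).
  by rewrite (nu_prod sj hQ hE (Z := fun k : 'I_(d i) => Z i k)) // => k; exact: sZ.
apply: svE_sum => i _; apply: svE_scale; first exact: sf_open oV (H1 i).1 Vy.
by apply: (sv_Top sj hQ hE) => // k; exact: sZ.
Qed.

Lemma dop_nu r U (G : sym_sheaf Q) : fsec_smooth U G ->
  (forall y, U y -> (msize (G y) <= r.+1)%N) -> is_dop (F := E) r U (fun s y => nu (G y) s).
Proof.
move=> HG Gr y Uy; split=> [s Hs|c s s' Hs Hs'|s s' Hs Hs' J].
- exact: sv_nu HG Uy Hs.
- exact: (nu_slin sj hQ hE).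
- exact: (nu_jet (Gr y Uy) Hs Hs' J).
Qed.

(** The degree of [G x] may jump with [x], and with it the order of the
    representative; only the class in the direct limit matters. *)
Definition N0 (U : set M) (G : sym_sheaf Q) : tildeD_sheaf dE E :=
  fun x => tD (tilde_restrict dE (nuJ (msize (G x)) (G x))).

Lemma RepE_N0 U G x : RepE (N0 U G x) (nu (G x)).
Proof.
exists (msize (G x)); apply: Rep_restrict => s Hs.
exact: nuJE.
Qed.

Lemma N0_morphism : is_morphism N0.
Proof.
split=> [U G oU HG y Uy|U V G H oU oV VU HG HH GH y Vy|U f G H oU sf_ HG HH y Uy].
- have [V [r [oV Vy VU Vr]]] := sym_smooth_near HG Uy.
  exists V, r; split=> //; apply: dop_order (dop_nu (sym_smooth_sub oV VU HG) Vr) _ => //.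
    exact: goodb_vbundle.
  by move=> z _; exact: RepE_N0.
- by apply: tD_eqE (RepE_N0 _ _ _) _; rewrite GH //; exact: RepE_N0.
- apply: tD_eqE (RepE_N0 _ _ _) _.
  apply: RepE_ext (RepE_add (RepE_scale (f y) (RepE_N0 U G y)) (RepE_N0 U H y)) _ => s _.
  by rewrite /= (nu_lin j nabQ nabE).
Qed.

Lemma nu_const y (c : C) s : sv y s -> nu (mpolyC _ c : sym_fiber Q y) s = c *: s y.
Proof.
move=> Hs; rewrite -alg_mpolyC -[c%:A]addr0 (nu_lin j nabQ nabE).
have := nu_prod sj hQ hE (x := y) (m := 0) (Z := fun _ => fun z => 0 : Q z) (s := s) _ Hs.
rewrite big_ord0 => ->; last by case.
by rewrite nu_0 addr0.
Qed.

Lemma sym_smooth_const U f : open U -> smooth_fun U f ->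
  fsec_smooth U ((fun x => mpolyC _ (f x)) : sym_sheaf Q).
Proof.
move=> oU Hf x Ux; exists U; split=> //.
exists 1%N, (fun=> f), (fun=> 0%N), (fun _ _ z => 0); split.
  move=> i; split=> // k.
  by apply: (localb_vbundle Q).2 => // y _; exact: svE_0.
by move=> y _; rewrite big_ord1 big_ord0 alg_mpolyC.
Qed.

Lemma sym_prod_lift m (Z : 'I_m.+1 -> sect Q) i x :
  sym_prod Z (pred1 i) x = \prod_(k < m) sym_in (Z (lift i k) x).
Proof.
rewrite /sym_prod (@reindex_omap _ _ _ _ 'I_m (lift i) (unlift i)) /=; last first.
  by move=> k; case: unliftP => [l ->|->] //=; rewrite eqxx.
by apply: eq_bigl => k; rewrite liftK eqxx andbT eq_sym neq_lift.
Qed.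

Lemma sym_prod_all m (Z : 'I_m -> sect Q) x : sym_prod Z pred0 x = \prod_(k < m) sym_in (Z k x).
Proof. by []. Qed.

Lemma cov_sym_prodE m (Z : 'I_m.+1 -> sect Q) i x : cov_sym_prod j nabQ Z i x =
  \sum_(k < m) \prod_(l < m)
    sym_in (upd (fun l => Z (lift i l)) k (covQ (Z i) (Z (lift i k))) l x).
Proof.
rewrite /cov_sym_prod (@reindex_omap _ _ _ _ 'I_m (lift i) (unlift i)) /=; last first.
  by move=> k; case: unliftP => [l ->|->] //=; rewrite eqxx.
apply: eq_big => [k|k _]; first by rewrite liftK eqxx andbT eq_sym neq_lift.
rewrite (bigD1 k) //= {1}/upd eqxx; congr (_ * _).
rewrite /sym_prod (@reindex_omap _ _ _ _ 'I_m (lift i) (unlift i)) /=; last first.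
  by move=> l; case: unliftP => [l' ->|->] //=; rewrite eqxx.
apply: eq_big => [l|l /andP[/norP[_ lk] _]].
  by rewrite liftK eqxx andbT eq_sym (negPf (neq_lift i l)) /= (inj_eq lift_inj).
by move: lk; rewrite /= (inj_eq lift_inj) /upd => /negPf ->.
Qed.

Lemma nu_sym_prod m (Z : 'I_m -> sect Q) y s : (forall i, sv y (Z i)) -> sv y s ->
  nu (sym_prod Z pred0 y) s = Top Z s y.
Proof. by move=> HZ Hs; rewrite sym_prod_all (nu_prod sj hQ hE). Qed.

Lemma nu_cov_sym_prod m (Z : 'I_m.+1 -> sect Q) i y s : (forall i, sv y (Z i)) -> sv y s ->
  nu (cov_sym_prod j nabQ Z i y) s =
  \sum_(k < m) Top (upd (fun l => Z (lift i l)) k (covQ (Z i) (Z (lift i k)))) s y.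
Proof.
move=> HZ Hs; rewrite cov_sym_prodE.
rewrite -(eq_bigr _ (fun k _ => scale1r _)) (nu_sum j nabQ nabE).
apply: eq_bigr => k _; rewrite scale1r (nu_prod sj hQ hE) // => l.
by apply: sv_upd => //; exact: (sv_covQ sj hQ).
Qed.

Lemma msize_prod_ord m (v : forall y, 'I_m -> Q y) y :
  (msize (\prod_(k < m) sym_in (v y k) : sym_fiber Q y) <= m.+1)%N.
Proof.
have := msize_sym_prod (index_enum 'I_m) xpredT (v y); rewrite count_predT.
have -> : size (index_enum 'I_m) = m by rewrite -[RHS]card_ord cardT enumT.
by [].
Qed.

Lemma Top_dop m U (Z : 'I_m -> sect Q) : open U -> (forall i, sm U (Z i)) ->
  is_dop (F := E) m U (Top Z).
Proof.
move=> oU HZ y Uy; have HZy i : sv y (Z i) by exists U.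
split=> [s Hs|c s s' Hs Hs'|s s' Hs Hs' J].
- exact: (sv_Top sj hQ hE).
- exact: (Top_slin sj hQ hE).
- rewrite -!nu_sym_prod //; apply: (nu_jet _ Hs Hs' J).
  exact: (msize_prod_ord (fun y k => Z k y)).
Qed.

(** The operator is not among those attached to elements of the symmetric algebra,
    so that its order is read off from its components in an adapted frame. *)
Lemma covE_Top_dop m U (Z0 : sect Q) (Z : 'I_m -> sect Q) : open U -> sm U Z0 ->
  (forall i, sm U (Z i)) -> is_dop (F := E) m.+1 U (fun s => covE Z0 (Top Z s)).
Proof.
move=> oU HZ0 HZ y Uy; have HZy i z : U z -> sv z (Z i) by exists U.
have HZ0y z : U z -> sv z Z0 by exists U.
have HT s z : U z -> sv z s -> sv z (Top Z s).
  by move=> Uz Hs; apply: (sv_Top sj hQ hE) => // i; exact: HZy.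
split=> [s Hs|c s s' Hs Hs'|s s' Hs Hs' J].
- by apply: (sv_covE sj hE); [exact: HZ0y|exact: HT].
- rewrite (covE_near j hE (Z' := Z0) (s' := fun z => c *: Top Z s z + Top Z s' z : E z)) //.
  + rewrite (covE_lin j hE); [|exact: sf_cst|exact: HT|exact: HT].
    by rewrite {1}/lie vec_act_cst scale0r add0r.
  + by apply: HT => //; exact: svE_lin (sf_cst _ _) Hs Hs'.
  + by apply: svE_lin (sf_cst _ _) _ _; exact: HT.
  apply: near2 (open_nbhs_nbhs (conj oU Uy)) (nearI (sv_nearP Hs) (sv_nearP Hs')) _.
  by move=> z Uz [H1 H2]; apply: (Top_slin sj hQ hE) => // i; exact: HZy.
have [W [X [K [e ad]]]] := ad_ex y.
have oV : open (W `&` U) by apply: openI => //; exact: sys_open (ad_sys ad).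
have S := system_sub oV (@subIsetl _ W U) (ad_sys ad).
have Vy : (W `&` U) y by split=> //; exact: ad_x ad.
have be := sys_eb S Vy.
rewrite (cfr_expand (covE Z0 (Top Z s)) be) (cfr_expand (covE Z0 (Top Z s')) be).
apply: eq_bigr => k _; congr (_ *: _).
apply: (jet_eq_sys (t := fun s => cfr e k (covE Z0 (Top Z s))) S Vy Hs Hs' J).
apply: (covE_span sj hE S) => [z [_ Uz]|t z [_ Uz]|l]; [exact: HZ0y|exact: HT|].
by apply: (Top_span sj hQ hE S) => i z [_ Uz]; exact: HZy.
Qed.

(** On products of sections of [Q] the operators satisfy the recursion by
    construction. *)
Lemma N0_nabla : is_nabla j nabQ nabE N0.
Proof.
split=> [|U f oU Hf|U m Z oU HZ]; first exact: N0_morphism.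
  have D : is_dop (F := E) 0 U (fun s y => nu ((fun x => mpolyC _ (f x)) y : sym_fiber Q y) s).
    apply: dop_nu => [|y _]; first exact: sym_smooth_const.
    by rewrite msizeC; case: eqP.
  have D' : is_dop (F := E) 0 U (fun s x => f x *: s x : E x).
    move=> y Uy; have [_ H2 H3] := D y Uy; split=> [s Hs|c s s' Hs Hs'|s s' Hs Hs' J].
    - by apply: svE_scale => //; exact: sf_open oU Hf Uy.
    - have := H2 c s s' Hs Hs'; rewrite !nu_const //.
      exact: svE_lin (sf_cst _ _) Hs Hs'.
    - by have := H3 s s' Hs Hs' J; rewrite !nu_const.
  apply: (dop_class (goodb_vbundle E) oU D') => y Uy.
  by apply: RepE_ext (RepE_N0 _ _ _) _ => s Hs; rewrite nu_const.
have HZy i y : U y -> sv y (Z i) by exists U.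
have Dc i := covE_Top_dop oU (HZ i) (fun l => HZ (lift i l)).
pose Ci i : tildeD_sheaf dE E := fun x => tD (tilde_restrict dE
  (opJ (F := E) m.+1 (fun s => covE (Z i) (Top (fun l => Z (lift i l)) s) x))).
have RC i y : U y -> RepE (Ci i y) (fun s => covE (Z i) (Top (fun l => Z (lift i l)) s) y).
  by move=> Uy; exists m.+1; exact: (dop_restrict (Dc i) Uy).
exists Ci; split=> [i|y Uy].
  exists (Top (fun l => Z (lift i l))); split.
    apply: (dop_class (goodb_vbundle E) oU (Top_dop oU (fun l => HZ (lift i l)))) => y Uy.
    apply: RepE_ext (RepE_N0 _ _ _) _ => s Hs.
    rewrite sym_prod_lift -(nu_prod sj hQ hE (Z := fun l => Z (lift i l))) // => l.
    exact: HZy.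
  by apply: (dop_class (goodb_vbundle E) oU (Dc i)) => y Uy; exact: RC.
apply: tD_eqE (RepE_N0 _ _ _) _.
have R1 := RepE_scale m.+1%:R^-1 (RepE_big (fun i => RepE_add (RC i y Uy)
   (RepE_scale (-1) (RepE_N0 U (cov_sym_prod j nabQ Z i) y)))).
apply: RepE_ext R1 _ => s Hs /=.
rewrite nu_sym_prod //; last by move=> i; exact: HZy.
rewrite TopS; congr (_ *: _); apply: eq_bigr => i _; rewrite scaleN1r nu_cov_sym_prod //.
by move=> l; exact: HZy.
Qed.

(** * The PBW map on polynomials with coefficients *)

Section PBWMap.
Variable F : vbundle M.
Let gF := goodb_vbundle F.
Local Notation SH x := (symhom_fiber Q E F x).

Definition sdeg d x (S : SH x) : Prop := forall a, (d <= mdeg a)%N -> S a = 0.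

(** The operator at [x] attached to a polynomial with coefficients in
    [Hom(E, F)], truncated below degree [d]. *)
Definition PB d x (S : SH x) (s : sect E) : F x :=
  \sum_(a : bmultinom (\dim {:Q x}) d) S (bmnm a) (nu (mpolyX C (bmnm a)) s).

Lemma PB_le d d' x (S : SH x) s : (d <= d')%N -> sdeg d S -> PB d' S s = PB d S s.
Proof.
move=> dd' Sd; apply: (bsum_ext (c := fun a => S a (nu (mpolyX C a) s)) dd') => a da.
by rewrite Sd // lfunE.
Qed.

Lemma PB_eq d d' x (S : SH x) s : sdeg d S -> sdeg d' S -> PB d S s = PB d' S s.
Proof.
move=> Sd Sd'; rewrite -(PB_le s (leq_maxl d d') Sd).
by rewrite -(PB_le s (leq_maxr d d') Sd').
Qed.

Lemma PB_tensor d (G : sym_sheaf Q) (A : forall x, 'Hom(E x, F x)) x s :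
  (msize (G x) <= d)%N -> PB d (tensor G A (x := x)) s = A x (nu (G x) s).
Proof.
move=> Gd; rewrite (nuE j nabQ nabE s Gd) linear_sum; apply: eq_bigr => a _.
by rewrite linearZ /tensor lfunE /= nu_X.
Qed.

Lemma sdeg_tensor d (G : sym_sheaf Q) (A : forall x, 'Hom(E x, F x)) x :
  (msize (G x) <= d)%N -> sdeg d (tensor G A (x := x)).
Proof.
move=> Gd a da; rewrite /tensor (_ : mcoeff a (G x) = 0) ?scale0r //.
apply: memN_msupp_eq0; apply/negP => /msize_mdeg_lt.
by rewrite ltnNge (leq_trans Gd da).
Qed.

(** The local expressions of the coefficients come with degree bounds; a common
    bound is needed to have a differential operator of some order. *)
Lemma symhom_near U (S : symhom_sheaf Q E F) x : open U -> fsec_smooth U S -> U x ->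
  exists V d m (G : 'I_m -> sym_sheaf Q) (A : 'I_m -> forall x, 'Hom(E x, F x)),
  [/\ open V, V x, V `<=` U, forall i, fsec_smooth V (G i) /\ smooth_hom V (A i) &
    forall y, V y -> (forall i, (msize (G i y) <= d.+1)%N) /\
      (forall a, S y a = \sum_(i < m) tensor (G i) (A i) (x := y) a)].
Proof.
move=> oU HS Ux; have [V [oV Vx VU [m [G [A [H1 H2]]]]]] := HS x Ux.
have [r Hr] : exists r : 'I_m -> nat, forall i, \forall y \near x, (msize (G i y) <= (r i).+1)%N.
  suff H i : exists r, \forall y \near x, (msize (G i y) <= r.+1)%N.
    by exists (fun i => sval (cid (H i))) => i; case: (cid (H i)).
  have [W [r [oW Wx _ Wr]]] := sym_smooth_near (H1 i).1 Vx.
  by exists r; apply: filterS (open_nbhs_nbhs (conj oW Wx)) => y /Wr.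
have N : \forall y \near x, forall i, (msize (G i y) <= (r i).+1)%N by exact: filter_forall.
have [W [oW Wx HW]] := nearP N.
have oVW := openI oV oW.
exists (V `&` W), (\max_(i < m) r i), m, G, A; split=> //.
- by move=> y [/VU].
- move=> i; split; first exact: sym_smooth_sub oVW (@subIsetl _ V W) (H1 i).1.
  by move=> V' s oV' V'V; apply: (H1 i).2 => // y /V'V [].
move=> y [Vy Wy]; split=> [i|a]; last exact: H2.
by apply: leq_trans (HW y Wy i) _; rewrite ltnS; exact: leq_bigmax.
Qed.

Lemma PB_sum d x m (G : 'I_m -> sym_sheaf Q) (A : 'I_m -> forall x, 'Hom(E x, F x))
    (S : SH x) s : (forall i, (msize (G i x) <= d)%N) ->
  (forall a, S a = \sum_(i < m) tensor (G i) (A i) (x := x) a) ->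
  sdeg d S /\ PB d S s = \sum_(i < m) A i x (nu (G i x) s).
Proof.
move=> Gd SE; split=> [a da|].
  by rewrite SE big1 // => i _; exact: (sdeg_tensor _ (Gd i)).
under [RHS]eq_bigr => i _ do rewrite -(PB_tensor _ _ (Gd i)).
rewrite exchange_big; apply: eq_bigr => a _ /=.
by rewrite SE sum_lfunE.
Qed.

Lemma sv_PB U (S : symhom_sheaf Q E F) d s y : open U -> fsec_smooth U S -> U y ->
  (forall z, U z -> sdeg d (S z)) -> sv y s -> sv y (fun z => PB d (S z) s : F z).
Proof.
move=> oU HS Uy Sd Hs.
have [V [d' [m [G [A [oV Vy VU HGA HV]]]]]] := symhom_near oU HS Uy.
apply: (@svE_near_eq _ _ _ F y (fun z => \sum_(i < m) A i z (nu (G i z) s) : F z)).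
  apply: near2 (open_nbhs_nbhs (conj oV Vy)) (sv_nearP Hs) _ => z Vz Hz.
  have [Gd SE] := HV z Vz; have [Sd' <-] := PB_sum s Gd SE.
  by apply: PB_eq => //; apply: Sd; exact: VU.
apply: svE_sum => i _.
have /(smooth_homP _ (localb_vbundle E) (localb_vbundle F) oV) := (HGA i).2; apply=> //.
exact: sv_nu (HGA i).1 Vy Hs.
Qed.

Lemma PB_slin d x (S : SH x) c s s' : sv x s -> sv x s' ->
  PB d S (fun z => c *: s z + s' z : E z) = c *: PB d S s + PB d S s'.
Proof.
move=> Hs Hs'; rewrite /PB scaler_sumr -big_split; apply: eq_bigr => a _ /=.
by rewrite (nu_slin sj hQ hE) // linearP.
Qed.

Lemma PB_jet r x (S : SH x) s s' : sv x s -> sv x s' -> jet r x s = jet r x s' ->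
  PB r.+1 S s = PB r.+1 S s'.
Proof.
move=> Hs Hs' J; apply: eq_bigr => a _; congr (S _ _).
by apply: (nu_jet _ Hs Hs' J); rewrite msizeX; exact: bmdeg.
Qed.

Lemma PB_dop r U (S : symhom_sheaf Q E F) : open U -> fsec_smooth U S ->
  (forall z, U z -> sdeg r.+1 (S z)) -> is_dop (F := F) r U (fun s y => PB r.+1 (S y) s).
Proof.
move=> oU HS Sr y Uy; split=> [s Hs|c s s' Hs Hs'|s s' Hs Hs' J].
- exact: sv_PB oU HS Uy Sr Hs.
- exact: PB_slin.
- exact: PB_jet J.
Qed.

(** Some bound of the degree; it is only meaningful for families that have one,
    which is the case of the values of smooth sections. *)
Definition sbound x (S : SH x) : nat := xget 0%N [set r | sdeg r.+1 S].

Definition pbw0 (U : set M) (S : symhom_sheaf Q E F) : tildeD_sheaf dE F :=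
  fun x => tD (tilde_restrict dE (opJ (F := F) (sbound (S x)) (PB (sbound (S x)).+1 (S x)))).

Lemma RepE_pbw0 U (S : symhom_sheaf Q E F) x r : sdeg r.+1 (S x) ->
  RepE (pbw0 U S x) (PB r.+1 (S x)).
Proof.
move=> Sr; have Sb : sdeg (sbound (S x)).+1 (S x).
  by rewrite /sbound; case: xgetP => [r' -> //|/(_ r)].
exists (sbound (S x)); apply: Rep_restrict => s Hs; rewrite (PB_eq s Sr Sb).
apply: opJE => //; first by move=> c u v Hu Hv; exact: PB_slin.
by move=> u v Hu Hv; exact: PB_jet.
Qed.

Lemma symhom_sdeg U (S : symhom_sheaf Q E F) x : open U -> fsec_smooth U S -> U x ->
  exists V d, [/\ open V, V x, V `<=` U & forall y, V y -> sdeg d.+1 (S y)].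
Proof.
move=> oU HS Ux; have [V [d [m [G [A [oV Vy VU HGA HV]]]]]] := symhom_near oU HS Ux.
exists V, d; split=> // y Vy'; have [Gd SE] := HV y Vy'.
exact: (PB_sum (fun z => 0 : E z) Gd SE).1.
Qed.

Lemma symhom_smooth_sub U V (S : symhom_sheaf Q E F) : open V -> V `<=` U ->
  fsec_smooth U S -> fsec_smooth V S.
Proof.
move=> oV VU HS x Vx; have [W [oW Wx WU [m [G [A [H1 H2]]]]]] := HS x (VU _ Vx).
have oWV := openI oW oV.
exists (W `&` V); split=> //; exists m, G, A; split=> [i|y a [Wy _]]; last exact: H2.
split; first exact: sym_smooth_sub oWV (@subIsetl _ W V) (H1 i).1.
by move=> V' s oV' V'V; apply: (H1 i).2 => // y /V'V [].
Qed.

Lemma PB_lin d x (f : C) (S T S' : SH x) s : (forall a, S' a = f *: S a + T a) ->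
  PB d S' s = f *: PB d S s + PB d T s.
Proof.
move=> SE; rewrite /PB scaler_sumr -big_split; apply: eq_bigr => a _ /=.
by rewrite SE !lfunE /= lfunE.
Qed.

Lemma sdeg_le d d' x (S : SH x) : (d <= d')%N -> sdeg d S -> sdeg d' S.
Proof. by move=> dd' Sd a da; apply: Sd; exact: leq_trans dd' da. Qed.

Lemma pbw0_morphism : is_morphism pbw0.
Proof.
split=> [U S oU HS y Uy|U V S T oU oV VU HS HT ST y Vy|U f S T oU Hf HS HT y Uy].
- have [V [r [oV Vy VU Vr]]] := symhom_sdeg oU HS Uy.
  exists V, r; split=> //.
  apply: (dop_order gF oV (PB_dop oV (symhom_smooth_sub oV VU HS) Vr)) => z Vz.
  by apply: RepE_pbw0; exact: Vr.
- have [W [r [_ Wy _ Wr]]] := symhom_sdeg oV HT Vy.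
  have Tr := Wr y Wy; have RT := RepE_pbw0 (S := T) V Tr.
  move: Tr RT; rewrite -(ST y Vy) => Sr RT.
  exact: tD_eqE (RepE_pbw0 U Sr) RT.
have [W [r [_ Wy _ Wr]]] := symhom_sdeg oU HS Uy.
have [W' [r' [_ Wy' _ Wr']]] := symhom_sdeg oU HT Uy.
pose m := maxn r r'.
have S1 : sdeg m.+1 (S y) by apply: sdeg_le (Wr y Wy); rewrite ltnS leq_maxl.
have S2 : sdeg m.+1 (T y) by apply: sdeg_le (Wr' y Wy'); rewrite ltnS leq_maxr.
have S3 : sdeg m.+1 (fsec_add (fsec_scale f S) T y).
  by move=> a am; rewrite /= S1 // S2 // scaler0 addr0.
apply: tD_eqE (RepE_pbw0 _ S3) _.
apply: RepE_ext (RepE_add (RepE_scale (f y) (RepE_pbw0 U S1)) (RepE_pbw0 U S2)) _ => s _ /=.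
by rewrite -(PB_lin (S' := fsec_add (fsec_scale f S) T y) m.+1 s (fun a => erefl)).
Qed.

Lemma pbw0_pbw : is_pbw N0 pbw0.
Proof.
split=> [|U G A oU HG HA y Uy]; first exact: pbw0_morphism.
have [V [r [oV Vy VU Vr]]] := sym_smooth_near HG Uy.
have S1 := sdeg_tensor A (Vr y Vy).
apply: tD_eqE (RepE_pbw0 (S := fun x => tensor G A (x := x)) U S1) _.
apply: RepE_ext (RepE_post (A y) (RepE_N0 U G y)) _ => s _.
by rewrite PB_tensor //; exact: Vr.
Qed.


End PBWMap.

(** * Uniqueness of the recursive map *)

Section Uniqueness.

Lemma operator_dop (F : bundle M) r U A (T : sect E -> sect F) : goodb F -> open U ->
  is_operator_of (r := r) U A T -> is_dop r U T.
Proof.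
move=> gF oU [sA opA] y Uy.
have TE s z : U z -> sv z s -> T s z = A z (jet r z s).
  move=> Uz [V [oV Vz smV]]; rewrite (opA (V `&` U)) //; first exact: openI.
  exact: ((localb_vbundle E).1 _ _ _ (openI oV oU) (@subIsetl _ V U) smV).
split=> [s Hs|c s s' Hs Hs'|s s' Hs Hs' J].
- have H := (smooth_homJ _ gF oU).1 sA y s Uy Hs.
  apply: (gb_near gF) H.
  by apply: near2 (open_nbhs_nbhs (conj oU Uy)) (sv_nearP Hs) _ => z Uz Hz; rewrite TE.
- by rewrite !TE ?jet_lin ?linearP //; exact: svE_lin (sf_cst _ _) Hs Hs'.
- by rewrite !TE // J.
Qed.

Lemma dop_le (F : bundle M) r r' U (T : sect E -> sect F) : (r <= r')%N ->
  is_dop r U T -> is_dop r' U T.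
Proof.
move=> rr HT y Uy; have [H1 H2 H3] := HT y Uy; split=> // s s' Hs Hs' J.
by apply: H3 => //; rewrite -(truncate_jet y s rr) -(truncate_jet y s' rr) J.
Qed.

Definition dop_diff (T T0 : sect E -> sect E) : sect E -> sect E :=
  fun s z => (-1) *: T0 s z + T s z.

Lemma dop_sub r U T T0 : is_dop (F := E) r U T -> is_dop (F := E) r U T0 ->
  is_dop (F := E) r U (dop_diff T T0).
Proof.
move=> HT HT0 y Uy; have [H1 H2 H3] := HT y Uy; have [K1 K2 K3] := HT0 y Uy.
split=> [s Hs|c s s' Hs Hs'|s s' Hs Hs' J].
- by apply: svE_lin; [exact: sf_cst|exact: K1|exact: H1].
- rewrite /dop_diff H2 // K2 // !scalerDr !scalerA mulrN mulNr mulr1 mul1r.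
  by rewrite addrACA.
- by rewrite /dop_diff (H3 s s') // (K3 s s').
Qed.

(** Near [x] the operator is expanded in the frame of differential operators; its
    horizontal coefficients vanish because the horizontal part of the dual frame lies
    in the reduced jets. What remains is a combination of iterated derivatives
    with a direction of the distribution, which stay such after one more derivation
    and thus vanish on the reduced jets of order [r.+1]. *)
Lemma covE_vanish r U (Z : sect Q) (T : sect E -> sect E) x s : open U -> U x -> sv x Z ->
  is_dop (F := E) r U T ->
  (forall y s, U y -> sv y s -> tl r y s -> T s y = 0) ->
  sv x s -> tl r.+1 x s -> covE Z (T s) x = 0.
Proof.
move=> oU Ux HZ HT T0 Hs Ht.
have [W [X [K [e ad]]]] := ad_ex x; have Wx := ad_x ad.
have S := ad_sys ad; have oW := sys_open S.
have [V [L [oV Vx VW sL HL]]] := dual_frame sj hQ hE ad r.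
pose B y : 'Hom(Jet E r y, E y) := opJ (F := E) r (fun s => T s y).
have sB : smooth_hom U B := (dop_operator (goodb_vbundle E) oU HT).1.
pose w i : sect E := fun y => B y (L i y).
have sw i : sv x (w i).
  have /(smooth_homP _ (localb_Jet E r) (localb_vbundle E) oU) := sB; apply=> //.
  exact: sL.
have w0 i y : V y -> U y -> @horizontal _ _ _ Q x (bmnm i.1) -> w i y = 0.
  move=> Vy Uy hi; rewrite /w -(jet_realize (L i y)) (dop_jetE HT) //; last exact: sv_realize_self.
  apply: T0 => //; first exact: sv_realize_self.
  rewrite /tl jet_realize; apply/(dual_horizontal conE sj hQ hE ad); first exact: VW.
  move=> i' hi'; rewrite ((HL y Vy).1 i i').
  by case: eqP hi' => // <-; rewrite hi.
pose c (i : bmultinom n r.+1 * 'I_K) : M -> C :=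
  if @horizontal _ _ _ Q x (bmnm i.1) then fun=> 0 else Ob nabQ nabE ad (bmnm i.1) i.2 s.
have sc i : sf x (c i).
  rewrite /c; case: ifP => _; first exact: sf_cst.
  by apply: (Bs_smoothing S (Ob_spanr sj hQ hE ad i)).
have E1 : \forall y \near x, T s y = \sum_i c i y *: w i y.
  apply: near2 (nearI (open_nbhs_nbhs (conj oV Vx)) (open_nbhs_nbhs (conj oU Ux))) (sv_nearP Hs) _.
  move=> y [Vy Uy] Hy; rewrite -(dop_jetE HT) // ((HL y Vy).2 (jet r y s)) linear_sum.
  apply: eq_bigr => i _; rewrite linearZ /= -/(B y) -/(w i y) /c.
  case hi: (horizontal _); first by rewrite w0 // !scaler0.
  by rewrite (phiOE sj hQ hE) //; exact: VW.
have [H1 _ _] := HT x Ux.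
(* Only the value of [Z] at [x] matters; the constant extension is smooth on the
   whole domain of the adapted frame. *)
pose Zc := ext (Z x); have HZc y : W y -> sv y Zc.
  by move=> Wy; apply: sv_ext; exact: (ad_t ad).
rewrite (covE_near j hE (Z' := Zc) (H1 s Hs) _ E1); first last.
- by rewrite /Zc ext_self.
- by apply: svE_sum => i _; exact: svE_scale.
rewrite /Defs.covE (conn_sum hE) => [|i]; last exact: svE_scale.
apply: big1 => i _; rewrite (conn_scale hE) //.
rewrite /c; case hi: (horizontal _).
  by rewrite vec_act_cst !scale0r addr0.
have E2 : Ob nabQ nabE ad (bmnm i.1) i.2 s = xs X e (mword (bmnm i.1)) i.2 s.
  by rewrite /Ob hi.
have Si : span W (Bs X (fun i : 'I_n => (\dim {:Q x} <= i)%N) e r.+1 true) (xs X e (mword (bmnm i.1)) i.2).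
  apply: span_in; exists (mword (bmnm i.1)), i.2; split=> //; first exact: sorted_mword.
    by rewrite size_mword; exact: bmdeg.
  by move: hi => /negbFE.
have St : span W (Bs X (fun i : 'I_n => (\dim {:Q x} <= i)%N) e r.+2 true)
    (fun s => lie (jfield j Zc) (xs X e (mword (bmnm i.1)) i.2 s)).
  by apply: (span_raise S) Si => y Wy; apply: (sv_j sj); exact: HZc.
have z1 := tilde_zero conE ad Wx Hs Ht St.
have z2 := tilde_zero conE ad Wx Hs Ht (span_le (leqnSn _) Si).
by move: z1 z2; rewrite E2 /lie => -> ->; rewrite !scale0r addr0.
Qed.

(** The difference of two representatives vanishes on reduced jets, and so does its
    covariant derivative: composition is well defined on classes. *)
Lemma comp_unique r0 U (Z : sect Q) (T T0 : sect E -> sect E)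
    (a c : forall x, tildeD dE E x) x : open U -> sm U Z ->
  is_class_of U T a -> is_class_of U (fun s => covE Z (T s)) c ->
  is_dop (F := E) r0 U T0 -> (forall y, U y -> RepE (a y) (fun s => T0 s y)) ->
  U x -> RepE (c x) (fun s => covE Z (T0 s) x).
Proof.
move=> oU HZ Ta Tc HT0 Ra Ux; have HZx : sv x Z by exists U.
have [r1 [A [opA _]]] := Ta.
have HT := operator_dop (goodb_vbundle E) oU opA.
pose r := maxn r0 r1.
have {}HT := dop_le (leq_maxr r0 r1) HT; have {}HT0 := dop_le (leq_maxl r0 r1) HT0.
have HD := dop_sub HT HT0.
have D0 y s : U y -> sv y s -> tl r y s -> dop_diff T T0 s y = 0.
  move=> Uy Hs Ht; have [_ _ H3] := HT y Uy; have [_ _ K3] := HT0 y Uy.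
  rewrite /dop_diff (RepE_unique (class_RepE oU Uy Ta) (Ra y Uy) H3 K3 Hs Ht).
  by rewrite scaleN1r addNr.
have [N HN] := class_RepE oU Ux Tc; exists (maxn N r.+1).
apply: Rep_ext (Rep_le (leq_maxl N r.+1) HN) _ => s Hs Ht.
have [H1 _ _] := HT x Ux; have [K1 _ _] := HT0 x Ux.
have := covE_vanish oU Ux HZx HD D0 Hs (tl_le (leq_maxr N r.+1) Hs Ht).
rewrite (covE_lin j hE); [|exact: sf_cst|exact: K1|exact: H1].
rewrite {1}/lie vec_act_cst scale0r add0r scaleN1r addrC => /subr0_eq ->.
by [].
Qed.

Variable N : set M -> sym_sheaf Q -> tildeD_sheaf dE E.
Hypothesis HN : is_nabla j nabQ nabE N.
Let mN : is_morphism N. Proof. by case: HN. Qed.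

Lemma N_local U V G x t : open U -> open V -> V `<=` U -> V x -> fsec_smooth U G ->
  RepE (N V G x) t -> RepE (N U G x) t.
Proof.
move=> oU oV VU Vx HG; apply: RepE_eq; apply: tD_eq_sym.
have [_ loc _] := mN; apply: (loc U V) => //.
exact: sym_smooth_sub HG.
Qed.

(** Linearity gives [N 0 = - N 0 + N 0]. *)
Lemma N_zero U x : open U -> U x -> RepE (N U (fun x => 0 : sym_fiber Q x) x) (fun=> 0).
Proof.
move=> oU Ux; have [_ loc lin] := mN; have H0 := sym_smooth_0 Q oU.
have sm1 : smooth_fun U (fun=> -1) by move=> x0; exact: smooth_cst.
pose z : sym_sheaf Q := fun x => 0 : sym_fiber Q x.
have H1 := lin U (fun=> -1) z z oU sm1 H0 H0 x Ux.
have E0 : fsec_add (fsec_scale (fun=> -1) z) z = z.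
  by apply: functional_extensionality_dep => y; rewrite /= scaler0 addr0.
rewrite E0 in H1.
have R0 : RepE (N U z x) (act (N U z x)) by exists (projT1 (N U z x)); exact: Rep_act.
apply: RepE_eq (tD_eq_sym H1) _.
apply: RepE_ext (RepE_add (RepE_scale (-1) R0) R0) _ => s _.
by rewrite scaleN1r addNr.
Qed.

Lemma N_sum U x (I : Type) (l : seq I) (f : I -> M -> C) (G : I -> sym_sheaf Q) :
  open U -> U x -> (forall i, smooth_fun U (f i)) -> (forall i, fsec_smooth U (G i)) ->
  (forall i, RepE (N U (G i) x) (nu (G i x))) ->
  fsec_smooth U ((fun y => \sum_(i <- l) f i y *: G i y) : sym_sheaf Q) /\
  RepE (N U (fun y => \sum_(i <- l) f i y *: G i y) x) (nu (\sum_(i <- l) f i x *: G i x)).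
Proof.
move=> oU Ux Hf HG RG; elim: l => [|i l [IH1 IH2]].
  have E0 : (fun y => \sum_(i <- [::]) f i y *: G i y) = (fun y => 0 : sym_fiber Q y).
    by apply: functional_extensionality_dep => y; rewrite big_nil.
  rewrite E0; split; first exact: sym_smooth_0.
  apply: RepE_ext (N_zero oU Ux) _ => s _.
  by rewrite big_nil nu_0.
pose H : sym_sheaf Q := fun y => \sum_(i <- l) f i y *: G i y.
have E1 : (fun y => \sum_(k <- i :: l) f k y *: G k y) = fsec_add (fsec_scale (f i) (G i)) H.
  by apply: functional_extensionality_dep => y; rewrite big_cons.
rewrite E1; split; first exact: sym_smooth_lin.
have [_ loc lin] := mN.
apply: RepE_eq (tD_eq_sym (lin U (f i) (G i) H oU (Hf i) (HG i) IH1 x Ux)) _.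
apply: RepE_ext (RepE_add (RepE_scale (f i x) (RG i)) IH2) _ => s _.
by rewrite big_cons (nu_lin j nabQ nabE).
Qed.

(** By induction on the number of factors, using at each step that the composition
    with a covariant derivative only depends on the class. *)
Lemma N_prod m U (Z : 'I_m -> sect Q) x : open U -> (forall i, sm U (Z i)) -> U x ->
  RepE (N U (sym_prod Z pred0) x) (fun s => Top Z s x).
Proof.
have [_ Nc Np] := HN.
elim: m U Z x => [|m IH] U Z x oU HZ Ux.
  have sm1 : smooth_fun U (fun=> 1) by move=> x0; exact: smooth_cst.
  have E0 : sym_prod Z pred0 = (fun x => mpolyC _ 1).
    by apply: functional_extensionality_dep => y; rewrite sym_prod_all big_ord0 mpolyC1.
  rewrite E0; apply: RepE_ext (class_RepE oU Ux (Nc U (fun=> 1) oU sm1)) _ => s _.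
  by rewrite scale1r.
have HZy i y : U y -> sv y (Z i) by exists U.
have [Cm [HC HNE]] := Np U m Z oU HZ.
have sZl i l : sm U (Z (lift i l)) by [].
have RC i : RepE (Cm i x) (fun s => covE (Z i) (Top (fun l => Z (lift i l)) s) x).
  have [T [Ta Tc]] := HC i.
  apply: (comp_unique oU (HZ i) Ta Tc (Top_dop oU (sZl i))) => // y Uy.
  have -> : sym_prod Z (pred1 i) = sym_prod (fun l => Z (lift i l)) pred0.
    by apply: functional_extensionality_dep => z; rewrite sym_prod_lift.
  exact: IH.
have RK i : RepE (N U (cov_sym_prod j nabQ Z i) x) (nu (cov_sym_prod j nabQ Z i x)).
  pose ZK k := upd (fun l => Z (lift i l)) k (covQ (Z i) (Z (lift i k))).
  have sZK k l : sm U (ZK k l).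
    apply: (localb_vbundle Q).2 => // y Uy; apply: sv_upd => [r|]; first exact: HZy.
    by apply: (sv_covQ sj hQ); exact: HZy.
  have sm1 (k : 'I_m) : smooth_fun U (fun=> 1) by move=> x0; exact: smooth_cst.
  have sG k : fsec_smooth U (sym_prod (ZK k) pred0) by exact: sym_smooth_prod.
  have RG k : RepE (N U (sym_prod (ZK k) pred0) x) (nu (sym_prod (ZK k) pred0 x)).
    apply: RepE_ext (IH U (ZK k) x oU (sZK k) Ux) _ => s Hs.
    by rewrite nu_sym_prod // => l; exists U.
  have [_] := N_sum (index_enum 'I_m) oU Ux sm1 sG RG.
  have -> : (fun y => \sum_(k < m) 1 *: sym_prod (ZK k) pred0 y) = cov_sym_prod j nabQ Z i.
    apply: functional_extensionality_dep => y; rewrite cov_sym_prodE.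
    by apply: eq_bigr => k _; rewrite scale1r.
  congr (RepE _ _); congr nu; rewrite cov_sym_prodE.
  by apply: eq_bigr => k _; rewrite scale1r.
apply: RepE_eq (tD_eq_sym (HNE x Ux)) _.
have R1 := RepE_scale m.+1%:R^-1 (RepE_big (fun i => RepE_add (RC i) (RepE_scale (-1) (RK i)))).
apply: RepE_ext R1 _ => s Hs.
rewrite TopS; congr (_ *: _); apply: eq_bigr => i _; rewrite scaleN1r nu_cov_sym_prod //.
by move=> l; exact: HZy.
Qed.

(** The recursion determines the map on products, and smooth sections of the
    symmetric algebra are locally combinations of products. *)
Lemma RepE_N U G x : open U -> fsec_smooth U G -> U x -> RepE (N U G x) (nu (G x)).
Proof.
move=> oU HG Ux; have [V [oV Vx VU [m [f [d [Z [H1 H2]]]]]]] := HG x Ux.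
pose H i : sym_sheaf Q := sym_prod (fun k : 'I_(d i) => Z i k) pred0.
have sH i : fsec_smooth V (H i) by apply: sym_smooth_prod => // k; exact: (H1 i).2.
have RH i : RepE (N V (H i) x) (nu (H i x)).
  have sZ (k : 'I_(d i)) : sm V (Z i k) := (H1 i).2 k.
  apply: RepE_ext (N_prod oV sZ Vx) _ => s Hs; rewrite nu_sym_prod // => k.
  by exists V.
have [S1 S2] := N_sum (index_enum 'I_m) oV Vx (fun i => (H1 i).1) sH RH.
apply: (N_local oU oV VU Vx HG); rewrite H2 //.
apply: RepE_eq S2; have [_ loc _] := mN; apply: (loc V V) => //.
  exact: sym_smooth_sub HG.
by move=> y Vy; rewrite H2.
Qed.

End Uniqueness.

(** * The isomorphism *)

Section Isomorphism.
Variable F : vbundle M.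
Let gF := goodb_vbundle F.
Local Notation SH x := (symhom_fiber Q E F x).
Local Notation PB := (PB (F := F)).
Local Notation sdeg := (sdeg (F := F)).

Lemma PB_pick r x (S : SH x) s a v : (mdeg a <= r)%N ->
  (forall b, (mdeg b <= r)%N -> nu (mpolyX C b) s = if b == a then v else 0) ->
  PB r.+1 S s = S a v.
Proof.
move=> ar H; have ar' : (mdeg a < r.+1)%N by [].
rewrite [LHS](bigD1 (BMultinom ar')) //= H // eqxx big1 ?addr0 // => b bn.
rewrite H; last by rewrite -ltnS; exact: bmdeg.
case: eqP => [E0|]; last by rewrite linear0.
by move: bn; rewrite -val_eqE /= E0 eqxx.
Qed.

(** Values of the PBW operators on reduced jets can be prescribed, and this recovers
    the coefficients one by one. *)
Lemma PB_inj x (a a' : tildeD dE F x) (S S' : SH x) r r' : tD_eq a a' ->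
  sdeg r.+1 S -> sdeg r'.+1 S' -> RepE a (PB r.+1 S) -> RepE a' (PB r'.+1 S') -> S = S'.
Proof.
move=> aa' Sr Sr' Ra Ra'; pose m := maxn r r'.
have Sm : sdeg m.+1 S by apply: sdeg_le Sr; rewrite ltnS leq_maxl.
have Sm' : sdeg m.+1 S' by apply: sdeg_le Sr'; rewrite ltnS leq_maxr.
have Rm : RepE a (PB m.+1 S) by apply: RepE_ext Ra _ => s _; exact: PB_eq.
have Rm' : RepE a (PB m.+1 S').
  apply: RepE_eq (tD_eq_sym aa') _; apply: RepE_ext Ra' _ => s _; exact: PB_eq.
apply/funext => b; have [bm|mb] := leqP (mdeg b) m; last by rewrite Sm ?Sm'.
apply/lfunP => v.
have [s [Hs Ht H]] := tilde_surj m (fun b' : multinom (\dim {:Q x}) => if b' == b then v else 0).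
rewrite -(PB_pick S bm H) -(PB_pick S' bm H).
apply: (RepE_unique Rm Rm' _ _ Hs Ht) => u u' Hu Hu' J; exact: PB_jet J.
Qed.

Lemma symhom_sum_smooth V m (G : 'I_m -> sym_sheaf Q) (A : 'I_m -> forall x, 'Hom(E x, F x)) :
  open V -> (forall i, fsec_smooth V (G i) /\ smooth_hom V (A i)) ->
  fsec_smooth V ((fun y a => \sum_(i < m) tensor (G i) (A i) (x := y) a) : symhom_sheaf Q E F).
Proof. by move=> oV H x Vx; exists V; split=> //; exists m, G, A. Qed.

Section Map.
Variable N : set M -> sym_sheaf Q -> tildeD_sheaf dE E.
Variable pbw : set M -> symhom_sheaf Q E F -> tildeD_sheaf dE F.
Hypotheses (HN : is_nabla j nabQ nabE N) (Hp : is_pbw N pbw).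

Lemma RepE_pbw_sum V m (G : 'I_m -> sym_sheaf Q) (A : 'I_m -> forall x, 'Hom(E x, F x)) x :
  open V -> V x -> (forall i, fsec_smooth V (G i) /\ smooth_hom V (A i)) ->
  RepE (pbw V (fun y a => \sum_(i < m) tensor (G i) (A i) (x := y) a) x)
    (fun s => \sum_(i < m) A i x (nu (G i x) s)).
Proof.
move=> oV Vx; have [[_ loc lin] tens] := Hp.
elim: m G A => [|m IH] G A H.
  pose z : symhom_sheaf Q E F := fun y a => \sum_(i < 0) tensor (G i) (A i) (x := y) a.
  have sz : fsec_smooth V z by exact: symhom_sum_smooth.
  have sm1 : smooth_fun V (fun=> -1) by move=> x0; exact: smooth_cst.
  have H1 := lin V (fun=> -1) z z oV sm1 sz sz x Vx.
  have E0 : fsec_add (fsec_scale (fun=> -1) z) z = z.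
    apply: functional_extensionality_dep => y; apply/funext => a.
    by rewrite /= /z big_ord0 scaler0 addr0.
  rewrite E0 in H1.
  have R0 : RepE (pbw V z x) (act (pbw V z x)) by exists (projT1 (pbw V z x)); exact: Rep_act.
  apply: RepE_eq (tD_eq_sym H1) _.
  apply: RepE_ext (RepE_add (RepE_scale (-1) R0) R0) _ => s _.
  by rewrite big_ord0 scaleN1r addNr.
pose t : symhom_sheaf Q E F := fun y => tensor (G ord0) (A ord0) (x := y).
pose S : symhom_sheaf Q E F :=
  fun y a => \sum_(i < m) tensor (G (lift ord0 i)) (A (lift ord0 i)) (x := y) a.
have sS : fsec_smooth V S by apply: symhom_sum_smooth => // i; exact: H.
have stt : fsec_smooth V t.
  have := symhom_sum_smooth oV (fun _ : 'I_1 => H ord0).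
  congr (fsec_smooth V _); apply: functional_extensionality_dep => y; apply/funext => a.
  by rewrite big_ord1.
have sm1 : smooth_fun V (fun=> 1) by move=> x0; exact: smooth_cst.
have H1 := lin V (fun=> 1) t S oV sm1 stt sS x Vx.
have E1 : fsec_add (fsec_scale (fun=> 1) t) S =
    (fun y a => \sum_(i < m.+1) tensor (G i) (A i) (x := y) a).
  apply: functional_extensionality_dep => y; apply/funext => a.
  by rewrite /= big_ord_recl scale1r.
rewrite E1 in H1; apply: RepE_eq (tD_eq_sym H1) _.
have Rt : RepE (pbw V t x) (fun s => A ord0 x (nu (G ord0 x) s)).
  apply: RepE_eq (tD_eq_sym (tens V (G ord0) (A ord0) oV (H ord0).1 (H ord0).2 x Vx)) _.
  by apply: RepE_post; exact: (RepE_N HN oV (H ord0).1 Vx).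
have RS := IH (fun i => G (lift ord0 i)) (fun i => A (lift ord0 i)) (fun i => H (lift ord0 i)).
apply: RepE_ext (RepE_add (RepE_scale 1 Rt) RS) _ => s _.
by rewrite big_ord_recl scale1r.
Qed.

Lemma RepE_pbw U (S : symhom_sheaf Q E F) x d : open U -> fsec_smooth U S -> U x ->
  sdeg d (S x) -> RepE (pbw U S x) (PB d (S x)).
Proof.
move=> oU HS Ux Sd; have [V [d' [m [G [A [oV Vx VU HGA HV]]]]]] := symhom_near oU HS Ux.
have [Gd SE] := HV x Vx; have [[_ loc _] _] := Hp.
have sV : fsec_smooth V ((fun y a => \sum_(i < m) tensor (G i) (A i) (x := y) a) : symhom_sheaf Q E F).
  exact: symhom_sum_smooth.
have H1 : fsec_eq V (pbw U S) (pbw V (fun y a => \sum_(i < m) tensor (G i) (A i) (x := y) a)).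
  apply: loc => // y Vy; apply/funext => a; exact: (HV y Vy).2.
apply: RepE_eq (tD_eq_sym (H1 x Vx)) _.
apply: RepE_ext (RepE_pbw_sum oV Vx HGA) _ => s _.
by have [Sd' <-] := PB_sum s Gd SE; exact: PB_eq.
Qed.

Lemma pbw_inj U (S T : symhom_sheaf Q E F) : open U -> fsec_smooth U S -> fsec_smooth U T ->
  fsec_eq U (pbw U S) (pbw U T) -> fsec_eq U S T.
Proof.
move=> oU HS HT ST x Ux.
have [V [r [_ Vx _ Vr]]] := symhom_sdeg oU HS Ux.
have [W [r' [_ Wx _ Wr]]] := symhom_sdeg oU HT Ux.
apply: (PB_inj (ST x Ux) (Vr x Vx) (Wr x Wx)).
  exact: (RepE_pbw oU HS Ux (Vr x Vx)).
exact: (RepE_pbw oU HT Ux (Wr x Wx)).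
Qed.

(** For the converse, an operator of order [r] kills the reduced jets on which the
    PBW operators of degree at most [r] vanish; the coefficients of higher degree
    are read off on these. *)
Lemma pbw_filt r U (S : symhom_sheaf Q E F) : open U -> fsec_smooth U S ->
  fsec_filt r U S <-> fsec_filt r U (pbw U S).
Proof.
move=> oU HS; split=> [Sr|[A [sA HA]] x a Ux ra].
  have Sr' y : U y -> sdeg r.+1 (S y) by move=> Uy a; exact: Sr.
  apply: (dop_order gF oU (PB_dop oU HS Sr')) => y Uy.
  by apply: RepE_pbw => //; exact: Sr'.
have [V [d0 [_ Vx _ Vd]]] := symhom_sdeg oU HS Ux.
pose d := maxn d0 (mdeg a).
have Sd : sdeg d.+1 (S x) by apply: sdeg_le (Vd x Vx); rewrite ltnS leq_maxl.
have ad' : (mdeg a <= d)%N by rewrite leq_maxr.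
have rd : (r <= d)%N := ltnW (leq_trans ra ad').
have R1 := RepE_pbw oU HS Ux Sd.
pose t (s : sect E) : F x := A x (vsproj (tilde_jet dE r x) (jet r x s)).
have R2 : RepE (pbw U S x) t.
  by apply: RepE_eq (tD_eq_sym (HA x Ux)) _; exists r; split.
apply/lfunP => v.
have [s [Hs Ht H]] := tilde_surj d (fun b : multinom (\dim {:Q x}) => if b == a then v else 0).
rewrite -(PB_pick (S x) ad' H) (RepE_unique R1 R2 _ _ Hs Ht).
- (* The monomial [a] has degree greater than [r], hence the PBW operators of
     degree at most [r] kill [s]. *)
  have J0 : jet r x s = 0.
    apply: tilde_inj => //; first exact: tl_le rd Hs Ht.
    move=> b br; rewrite H; last exact: leq_trans br rd.
    by case: eqP br => // ->; rewrite leqNgt ra.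
  by rewrite /t J0 !linear0 lfunE.
- by move=> u u' Hu Hu' J; exact: PB_jet J.
move=> u u' Hu Hu' J; rewrite /t -(truncate_jet x u rd) -(truncate_jet x u' rd).
by rewrite J.
Qed.

End Map.

(** A smooth operator on reduced jets has smooth values on the horizontal part of the
    dual frame, and these values are its coefficients with respect to the
    PBW operators. *)
Lemma local_symbol r U (A : forall y, 'Hom(tildeJ dE r y, F y)) x : open U -> U x ->
  smooth_hom U A -> exists V (S : symhom_sheaf Q E F), [/\ open V, V x, V `<=` U,
    fsec_smooth V S & forall y, V y -> sdeg r.+1 (S y) /\
      forall s, sv y s -> tl r y s ->
        PB r.+1 (S y) s = A y (vsproj (tilde_jet dE r y) (jet r y s))].
Proof.
move=> oU Ux sA; have [W [X [K [e ad]]]] := ad_ex x; have Wx := ad_x ad.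
have S := ad_sys ad.
have [V0 [L [oV0 V0x V0W sL HL]]] := dual_frame sj hQ hE ad r.
have oV : open (V0 `&` U) by exact: openI.
pose hz (i : bmultinom n r.+1 * 'I_K) := @horizontal _ _ _ Q x (bmnm i.1).
pose Lt i : sect (tildeJ dE r) := fun y => vsproj (tilde_jet dE r y) (L i y).
have LtE i y : V0 y -> hz i -> vsval (Lt i y) = L i y.
  move=> Vy hi; apply: vsprojK; apply/(dual_horizontal conE sj hQ hE ad); first exact: V0W.
  move=> i' hi'; rewrite ((HL y Vy).1 i i').
  by case: eqP hi' => // <- /negP /(_ hi).
pose B i : sect F := fun y => if hz i then A y (Lt i y) else 0.
have lJ : localb (tildeJ dE r) by apply: localb_sub; exact: localb_Jet.
have sB i y : V0 y -> U y -> sv y (B i).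
  move=> Vy Uy; rewrite /B; case hi: (hz i); last exact: svE_0.
  have /(smooth_homP _ lJ (localb_vbundle F) oU) := sA; apply=> //.
  apply/sv_sub; have [V1 [oV1 V1y smL]] := sL i y Vy.
  exists (V1 `&` V0); split=> //; first exact: openI.
  apply: (localb_Jet E r).2 => [|z [V1z V0z]]; first exact: openI.
  have [V2 [oV2 V2z smL2]] := sL i z V0z.
  have oV20 := openI oV2 oV0.
  exists (V2 `&` V0); split=> //.
  move=> z' [V2z' V0z']; have [V3 [oV3 V3z' V32 [m [f [t [H1 H2]]]]]] := smL2 z' V2z'.
  have oV30 := openI oV3 oV0.
  exists (V3 `&` V0); split=> //; first by move=> z'' [/V32].
  exists m, f, t; split=> [k|z'' [V3z'' V0z'']]; last by rewrite LtE // H2.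
  split; first exact: smooth_fun_sub (@subIsetl _ V3 V0) (H1 k).1.
  exact: ((localb_vbundle E).1 _ _ _ oV30 (@subIsetl _ V3 V0) (H1 k).2).
pose A' i y : 'Hom(E y, F y) := linfun (fun u : E y => coord (frtup e y) i.2 u *: B i y).
have A'E i y (u : E y) : A' i y u = coord (frtup e y) i.2 u *: B i y.
  by apply: linfunE => c u1 u2; rewrite linearP /= scalerDl scalerA.
pose Z (i : bmultinom n r.+1 * 'I_K) (k : 'I_(size (mword (dn ad (bmnm i.1))))) :=
  vb (tnth (in_tuple (mword (dn ad (bmnm i.1)))) k).
pose G i : sym_sheaf Q := if hz i then sym_prod (Z i) pred0 else fun y => 0 : sym_fiber Q y.
pose m := #|{: bmultinom n r.+1 * 'I_K}|.
have HGA (i : 'I_m) : fsec_smooth (V0 `&` U) (G (enum_val i)) /\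
    smooth_hom (V0 `&` U) (A' (enum_val i)).
  move: (enum_val i) => {}i; split.
    rewrite /G; case: ifP => _; last exact: sym_smooth_0.
    apply: sym_smooth_prod => // k; apply: (localb_vbundle Q).2 => // y [Vy _].
    by apply: (sv_vbW ad); exact: V0W.
  apply/(smooth_homP _ (localb_vbundle E) (localb_vbundle F) oV) => y s [Vy Uy] Hs.
  apply: (@svE_near_eq _ _ _ F y (fun z => cfr e i.2 s z *: B i z : F z)).
    by apply: nearW => z; rewrite A'E.
  apply: svE_scale; last exact: sB.
  by apply: (sf_cfr_sys S) => //; exact: V0W.
exists (V0 `&` U), (fun y a => \sum_(i < m) tensor (G (enum_val i)) (A' (enum_val i)) (x := y) a).
split=> //; first exact: symhom_sum_smooth.
move=> y [Vy Uy]; have Wy := V0W y Vy.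
have Gd (i : 'I_m) : (msize (G (enum_val i) y) <= r.+1)%N.
  move: (enum_val i) => {}i; rewrite /G; case hi: (hz i); last by rewrite msize0.
  apply: leq_trans (msize_prod_ord (fun z k => Z i k z) y) _.
  rewrite size_mword -(mdeg_upm ad) upm_dn //; exact: bmdeg.
pose Sy : SH y := fun a => \sum_(i < m) tensor (G (enum_val i)) (A' (enum_val i)) (x := y) a.
split=> [|s Hs Ht]; first exact: (PB_sum (S := Sy) (fun z => 0 : E z) Gd (fun a => erefl)).1.
rewrite (PB_sum (S := Sy) s Gd (fun a => erefl)).2.
have -> : vsproj (tilde_jet dE r y) (jet r y s) =
    \sum_i (if hz i then phiO nabQ nabE ad y i (jet r y s) else 0) *: Lt i y.
  rewrite {1}((HL y Vy).2 (jet r y s)) linear_sum; apply: eq_bigr => i _.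
  rewrite linearZ -/(Lt i y); case hi: (hz i) => //.
  have p0 : phiO nabQ nabE ad y i (jet r y s) = 0.
    by have /(dual_horizontal conE sj hQ hE ad) := Ht => /(_ Wy i); apply; exact: negbT hi.
  by rewrite p0 /= !scale0r.
rewrite linear_sum [RHS](reindex (fun k : 'I_m => enum_val k)) /=; last first.
  by apply: onW_bij; exact: enum_val_bij.
apply: eq_bigr => l _; rewrite linearZ A'E; move: (enum_val l) => i /=.
rewrite /B /G; case hi: (hz i); last by rewrite scaler0 scale0r.
congr (_ *: _); rewrite nu_sym_prod //; last by move=> k; exact: (sv_vbW ad).
rewrite (phiOE sj hQ hE) // /Ob.
by move: hi; rewrite /hz => ->.
Qed.

(** Local preimages are unique, hence they glue: the preimage is defined point by
    point and coincides near each point with a smooth local one. *)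
Lemma pbw_surj (N : set M -> sym_sheaf Q -> tildeD_sheaf dE E)
    (pbw : set M -> symhom_sheaf Q E F -> tildeD_sheaf dE F) U (b : tildeD_sheaf dE F) :
  is_nabla j nabQ nabE N -> is_pbw N pbw -> open U -> fsec_smooth U b ->
  exists2 S, fsec_smooth U S & fsec_eq U (pbw U S) b.
Proof.
move=> HN Hp oU Hb.
pose good y (S : SH y) := exists r, sdeg r.+1 S /\ RepE (b y) (PB r.+1 S).
pose Sb : symhom_sheaf Q E F := fun y => xget (fun _ => 0) [set S : SH y | good y S].
have loc x : U x -> exists V (S : symhom_sheaf Q E F), [/\ open V, V x, V `<=` U,
    fsec_smooth V S & forall y, V y -> good y (S y) /\ Sb y = S y].
  move=> Ux; have [V [r [oV Vx VU [A [sA HA]]]]] := Hb x Ux.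
  have [V' [S [oV' V'x V'V sS HS]]] := local_symbol oV Vx sA.
  exists V', S; split=> //; first by move=> y /V'V /VU.
  move=> y V'y; have [Sr SE] := HS y V'y.
  have gS : good y (S y).
    exists r; split=> //; apply: RepE_eq (tD_eq_sym (HA y (V'V _ V'y))) _.
    by exists r; split=> // s Hs Ht; rewrite SE.
  split=> //; rewrite /Sb; case: xgetP => [S' -> [r' [Sr' Rr']]|/(_ _ gS) //].
  by have [r1 [Sr1 Rr1]] := gS; apply: (PB_inj (tD_eq_refl (b y)) Sr' Sr1 Rr' Rr1).
have sSb : fsec_smooth U Sb.
  move=> x Ux; have [V [S [oV Vx VU sS HS]]] := loc x Ux.
  have [V' [oV' V'x V'V [m [G [A [H1 H2]]]]]] := sS x Vx.
  exists V'; split=> //; first by move=> y /V'V /VU.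
  exists m, G, A; split=> // y a V'y; rewrite (HS y (V'V _ V'y)).2; exact: H2.
exists Sb => // x Ux; have [V [S [oV Vx VU sS HS]]] := loc x Ux.
have [[r [Sr Rr]] E0] := HS x Vx; rewrite -E0 in Sr Rr.
exact: tD_eqE (RepE_pbw HN Hp oU sSb Ux Sr) Rr.
Qed.

Lemma pbw_iso (N : set M -> sym_sheaf Q -> tildeD_sheaf dE E)
    (pbw : set M -> symhom_sheaf Q E F -> tildeD_sheaf dE F) :
  is_nabla j nabQ nabE N -> is_pbw N pbw -> is_filtered_iso pbw.
Proof.
move=> HN Hp; split.
- by case: Hp.
- exact: (pbw_inj HN Hp).
- by move=> U b; exact: pbw_surj HN Hp.
- exact: (pbw_filt HN Hp).
Qed.

End Isomorphism.

End Construction.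

Theorem theorem1p3 (R : realType) (n : nat) (M : manifold R n)
    (P : forall x : M, {vspace TMC M x}) (hP : nirenberg_integrable P)
    (Q : vbundle M) (proj : forall x : M, 'Hom(TMC M x, Q x))
    (hQ : is_quotient P proj)
    (E : vbundle M) (dE : sect E -> forall x : M, 'Hom(Pbundle P x, E x))
    (hE : is_Pmodule dE) (hE_free : locally_free dE)
    (E' : vbundle M) (dE' : sect E' -> forall x : M, 'Hom(Pbundle P x, E' x))
    (hE' : is_Pmodule dE') (hE'_free : locally_free dE')
    (j : forall x : M, 'Hom(Q x, TMC M x)) (hj : is_splitting proj j)
    (nabQ : sect Q -> forall x : M, 'Hom(TMC M x, Q x))
    (hnabQ : is_TMC_connection nabQ) (hnabQ_tf : torsion_free proj nabQ)
    (nabE : sect E -> forall x : M, 'Hom(TMC M x, E x))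
    (hnabE : is_TMC_connection nabE) (hnabE_ext : extends dE nabE) :
  (exists (N : set M -> sym_sheaf Q -> tildeD_sheaf dE E)
          (pbw : set M -> symhom_sheaf Q E E' -> tildeD_sheaf dE E'),
     is_nabla j nabQ nabE N /\ is_pbw N pbw) /\
  (forall (N : set M -> sym_sheaf Q -> tildeD_sheaf dE E)
          (pbw : set M -> symhom_sheaf Q E E' -> tildeD_sheaf dE E'),
     is_nabla j nabQ nabE N -> is_pbw N pbw -> is_filtered_iso pbw).
Proof.
have [subP _ invP _] := hP.
have conE := hE.1.
split.
  exists (N0 dE j nabQ nabE), (pbw0 dE j nabQ nabE (F := E')); split.
    exact: (N0_nabla subP invP hQ hj hE_free conE hnabQ hnabE).
  exact: (pbw0_pbw subP invP hQ hj hE_free conE hnabQ hnabE E').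
move=> N pbw HN Hp.
exact: (pbw_iso subP invP hQ hj hE_free conE hnabQ hnabE HN Hp).
Qed.
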